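(* Let $(X_N)_{N\in\mathbb{N}}$ be a self-adjoint random matrix ensemble and let $M>0$, $K>0$ be constants such that: (i) for all $m,n\in\mathbb{N}$ the limits $\alpha_n=\lim_{N\to\infty}\frac1N\mathbb{E}(\mathrm{Tr}(X_N^n))$ and $\alpha_{m,n}=\lim_{N\to\infty}\mathrm{Cov}(\mathrm{Tr}(X_N^m),\mathrm{Tr}(X_N^n))$ exist; (ii) $\lim_{N\to\infty}N^8\,\mathbb{P}(\|X_N\|>M)=0$; (iii) for all $f\in C^1(\mathbb{R})$ and $N\in\mathbb{N}$, $\mathrm{Var}(\mathrm{Tr}(f(X_N)))\le K\|f'\|_\infty^2$. Let $\rho$ be the associated asymptotic covariance map and $G_2$ the second-order Cauchy transform, analytically extended to $(\mathbb{C}\setminus[-M,M])^2$. Assume that $f,g\in\mathcal{S}$ are such that $f|_M$ and $g|_M$ extend analytically to a complex domain $\Omega\supset[-M,M]$. Then $$\rho(f,g)=\frac{1}{(2\pi i)^2}\int_{\mathcal{C}}\int_{\mathcal{C}}f(z)g(w)G_2(z,w)\,\mathrm{d}z\,\mathrm{d}w,$$ where $\mathcal{C}\subset\Omega$ is a positively oriented simple closed contour enclosing $[-M,M]$. Here $\rho(f,g)$ means $\rho(f|_M,g|_M)$, and $f(z),g(w)$ in the integrand denote the analytic extensions of $f|_M$, $g|_M$ to $\Omega$.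
   Context: A self-adjoint random matrix ensemble $(X_N)_{N}$ is a sequence in which $X_N$ is an $N\times N$ self-adjoint complex random matrix; all moments $\mathbb{E}(\mathrm{Tr}(X_N^n))$ and covariances $\mathrm{Cov}(\mathrm{Tr}(X_N^m),\mathrm{Tr}(X_N^n))$ are assumed finite. $\|X_N\|$ is the operator norm; $\mathrm{Tr}$ is the unnormalized trace; $\mathrm{Tr}(f(X_N))=\sum_k f(\lambda_k)$, with $\lambda_1,\dots,\lambda_N$ the eigenvalues of $X_N$. $\mathrm{Cov}(X,Y)=\mathbb{E}(XY)-\mathbb{E}(X)\mathbb{E}(Y)$ (no complex conjugation) and $\mathrm{Var}(X)=\mathbb{E}|X-\mathbb{E}X|^2$ for complex random variables. $C^1(\mathbb{R})$ is the space of complex-valued functions on $\mathbb{R}$ with continuous derivative; $f|_M$ is the restriction of $f$ to $[-M,M]$; $C^1([-M,M])=\{f|_M:f\in C^1(\mathbb{R})\}$; $\|h\|_M=\sup_{|x|\le M}|h(x)|$; $\|h\|_\infty=\sup_{x\in\mathbb{R}}|h(x)|$. $\mathcal{S}=\{f\in C^1(\mathbb{R}):f\text{ is polynomially bounded}\}$. The asymptotic covariance map $\rho:C^1([-M,M])\times C^1([-M,M])\to\mathbb{C}$ is the unique bilinear map such that $\rho(x^m,x^n)=\alpha_{m,n}$ for $m,n\ge1$, $\rho(1,f)=\rho(f,1)=0$ for all $f$, and $|\rho(f,g)|\le K\|f'\|_M\|g'\|_M$ for all $f,g\in C^1([-M,M])$ (obtained by continuous extension from polynomials, which are dense). The second-order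 Cauchy transform is $G_2(z,w)=\sum_{m,n\ge1}\frac{\alpha_{m,n}}{z^{m+1}w^{n+1}}$ for $|z|,|w|>M$; it has a unique analytic extension to $(\mathbb{C}\setminus[-M,M])^2$, also denoted $G_2$.
   Formalization: The contour C is required to have its whole enclosed region inside Ω, not only C ⊂ Ω; without this the formula fails when C surrounds a hole of Ω (e.g. f(x)=1/(x-3i), Ω=ℂ∖{3i}, C a large circle). *)

(* Defs.v *)
From HB Require Import structures.
From mathcomp Require Import all_boot all_order all_algebra finmap.
From mathcomp Require Import complex.
From mathcomp Require Import all_classical all_reals all_analysis.
From mathcomp Require Import summability.
Set Implicit Arguments.
Unset Strict Implicit.
Unset Printing Implicit Defensive.
Import Order.TTheory GRing.Theory Num.Theory.
Import numFieldNormedType.Exports.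
Local Open Scope classical_set_scope.
Local Open Scope ring_scope.
Local Open Scope complex_scope.

(* MathComp-Analysis puts the metric topology of the
   numFieldType [R[i]] on its alias [R[i]^o]; the latter is used wherever a
   topology is needed, and [Normc.normc : R[i] -> R] is the modulus. *)

Notation modulus := Normc.normc.

Section ComplexRandomVariables.
Context (R : realType) (d : measure_display) (T : measurableType d)
  (P : probability T R).
Implicit Types Z W : T -> R[i].

Definition cintegrable Z : Prop :=
  P.-integrable setT (fun w => (complex.Re (Z w))%:E) /\
  P.-integrable setT (fun w => (complex.Im (Z w))%:E).

Definition cexpectation Z : R[i] :=
  fine ('E_P[fun w => complex.Re (Z w)])%E +i*
  fine ('E_P[fun w => complex.Im (Z w)])%E.

(* No complex conjugation. *)
Definition ccovariance Z W : R[i] :=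
  cexpectation (fun w => Z w * W w) - cexpectation Z * cexpectation W.

Definition cvariance Z : \bar R :=
  ('E_P[fun w => (modulus (Z w - cexpectation Z) ^+ 2)%R])%E.

End ComplexRandomVariables.

Section Matrices.
Context (R : realType).

Definition euclidean_norm n (v : 'cV[R[i]]_n) : R :=
  Num.sqrt (\sum_i modulus (v i 0) ^+ 2).

Definition operator_norm n (A : 'M[R[i]]_n) : R :=
  sup [set euclidean_norm (A *m v) | v in [set v | euclidean_norm v <= 1]].

(* [spectral_diag A] lists the eigenvalues of the normal matrix [A] with
   multiplicity; they are real for self-adjoint [A]. *)
Definition trace_fun n (f : R -> R[i]) (A : 'M[R[i]]_n) : R[i] :=
  \sum_(k < n) f (complex.Re (spectral_diag A 0 k)).

End Matrices.

(* The matrices [X N], of size N, may live on different probability spaces,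
   as only the law of each [X N] matters.  The index N = 0 gives the empty
   matrix, for which every condition below holds trivially. *)
Record self_adjoint_ensemble (R : realType) (d : nat -> measure_display)
    (T : forall N, measurableType (d N)) (P : forall N, probability (T N) R)
    (X : forall N, T N -> 'M[R[i]]_N) : Prop := SelfAdjointEnsemble {
  ensemble_measurable_Re : forall N (i j : 'I_N),
    measurable_fun setT (fun w => complex.Re (X N w i j)) ;
  ensemble_measurable_Im : forall N (i j : 'I_N),
    measurable_fun setT (fun w => complex.Im (X N w i j)) ;
  ensemble_self_adjoint : forall N w, X N w \is hermsymmx ;
  ensemble_moment : forall N n,
    cintegrable (P N) (fun w => \tr (X N w ^+ n)) ;
  ensemble_covariance : forall N m n,
    cintegrable (P N) (fun w => \tr (X N w ^+ m) * \tr (X N w ^+ n)) }.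

Section ContinuouslyDifferentiable.
Context (R : realType).
Implicit Types f g : R -> R[i].

Definition cderive f : R -> R[i] := fun x =>
  derive1 (fun t => complex.Re (f t)) x +i*
  derive1 (fun t => complex.Im (f t)) x.

Definition C1 : set (R -> R[i]) := [set f : R -> R[i] |
  [/\ forall x : R, derivable (fun t : R => complex.Re (f t)) x 1,
      forall x : R, derivable (fun t : R => complex.Im (f t)) x 1 &
      continuous (cderive f : R -> R[i]^o)]].

Definition polynomially_bounded f : Prop :=
  exists (c : R) (k : nat), forall x, modulus (f x) <= c * (1 + `|x| ^+ k).

Definition classS : set (R -> R[i]) :=
  [set f | C1 f /\ polynomially_bounded f].

Definition sup_norm (h : R -> R[i]) : \bar R :=
  ereal_sup [set (modulus (h x))%:E | x in [set: R]].

Definition sup_norm_on (M : R) (h : R -> R[i]) : R :=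
  sup [set modulus (h x) | x in `[- M, M]].

Definition segment (M : R) := {x : R | x \in `[- M, M]}.

Definition restr (M : R) f : segment M -> R[i] := fun x => f (sval x).

Definition C1_segment (M : R) : set (segment M -> R[i]) :=
  [set restr (M := M) f | f in C1].

(* Only the values of [rho] on C^1([-M,M]) x C^1([-M,M]) are meaningful. *)
Record asymptotic_covariance (K M : R) (alpha : nat -> nat -> R[i])
    (rho : (segment M -> R[i]) -> (segment M -> R[i]) -> R[i]) : Prop :=
    AsymptoticCovariance {
  rho_linear_l : forall (a : R[i]) h1 h2 h, C1_segment h1 -> C1_segment h2 ->
    C1_segment h ->
    rho (fun x => a * h1 x + h2 x) h = a * rho h1 h + rho h2 h ;
  rho_linear_r : forall (a : R[i]) h h1 h2, C1_segment h -> C1_segment h1 ->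
    C1_segment h2 ->
    rho h (fun x => a * h1 x + h2 x) = a * rho h h1 + rho h h2 ;
  rho_monomial : forall m n, (1 <= m)%N -> (1 <= n)%N ->
    rho (restr (fun x => x%:C ^+ m)) (restr (fun x => x%:C ^+ n)) = alpha m n ;
  rho_1l : forall h, C1_segment h -> rho (fun=> 1) h = 0 ;
  rho_1r : forall h, C1_segment h -> rho h (fun=> 1) = 0 ;
  rho_bound : forall f g, C1 f -> C1 g ->
    modulus (rho (restr f) (restr g)) <=
      K * sup_norm_on M (cderive f) * sup_norm_on M (cderive g) }.

End ContinuouslyDifferentiable.

Section ComplexAnalysis.
Context (R : realType).
Local Notation C := (R[i]^o).

Definition csegment (M : R) : set C := [set x%:C | x in `[- M, M]].

(* Analytic means locally the sum of a power series; for D open this says that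
   f is analytic on D. *)
Definition analytic_on (D : set C) (f : C -> C) : Prop :=
  forall a, D a -> exists c : nat -> C,
    \forall z \near a, series (fun k => c k * (z - a) ^+ k) @ \oo --> f z.

(* Double series are summed along the finite subsets of nat * nat, i.e.
   unconditionally. *)
Definition analytic2_on (D : set (C * C)) (F : C -> C -> C) : Prop :=
  forall p, D p -> exists c : nat * nat -> C, \forall q \near p,
    partial_sum (fun k => c k * (q.1 - p.1) ^+ k.1 * (q.2 - p.2) ^+ k.2 : C)
      @ totally --> F q.1 q.2.

(* In the series the indices are m = k.1 + 1 and n = k.2 + 1. *)
Definition second_order_cauchy (M : R) (alpha : nat -> nat -> R[i])
    (G2 : C -> C -> C) : Prop :=
  (forall z w : C, M < modulus z -> M < modulus w ->
    partial_sum (fun k : nat * nat =>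
        alpha k.1.+1 k.2.+1 / (z ^+ k.1.+2 * w ^+ k.2.+2) : C)
      @ totally --> G2 z w) /\
  analytic2_on (~` csegment M `*` ~` csegment M) G2.

(* A contour is given by a piecewise C^1 parametrization on [0,1].  The pieces
   are closed and share their end points, which makes it continuous. *)
Definition piecewise_C1 (gamma : R -> C) : Prop :=
  exists2 s : seq R, itv_partition 0 1 s &
    forall k, (k < size s)%N -> exists2 h : R -> R[i], C1 h &
      {in `[nth 0 (0 :: s) k, nth 0 s k], gamma =1 h}.

Definition trace_curve (gamma : R -> C) : set C := gamma @` `[0, 1].

Definition simple_closed_contour (gamma : R -> C) : Prop :=
  [/\ piecewise_C1 gamma, gamma 0 = gamma 1 &
      {in `[0, 1[ &, injective gamma}].

Definition cintegral01 (h : R -> C) : C :=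
  (\int[lebesgue_measure]_(t in `[0, 1]) complex.Re (h t))%R +i*
  (\int[lebesgue_measure]_(t in `[0, 1]) complex.Im (h t))%R.

(* [cderive gamma] is the true derivative off the finitely many break points,
   which do not affect the integral. *)
Definition contour_integral (gamma : R -> C) (F : C -> C) : C :=
  cintegral01 (fun t => F (gamma t) * cderive gamma t).

Definition two_pi_i : C := 0 +i* (2 * pi).

Definition winding_number (gamma : R -> C) (a : C) : C :=
  two_pi_i^-1 * contour_integral gamma (fun z => (z - a)^-1).

(* The points lying in a bounded component of the complement of the curve. *)
Definition enclosed (gamma : R -> C) : set C :=
  [set a | (~` trace_curve gamma) a /\
    bounded_set (connected_component (~` trace_curve gamma) a)].

Definition positively_oriented (gamma : R -> C) : Prop :=
  forall a, enclosed gamma a -> winding_number gamma a = 1.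

End ComplexAnalysis.

(* Main.v *)
(** For [z] off [-M, M] put [r_z(x) = 1 / (z - x)].  A functional [L] on
    C^1([-M, M]) with [|L h| <= C * sup |h'|] commutes with Cauchy's integral:
    [2 pi i L(f)] is the contour integral of [F(z) L(r_z)], because contour
    integrals are approximated by finite sums [sum_i W_i H(z_i)] uniformly in
    the Lipschitz constant of [H].  Applied to [rho] in each variable, this
    expresses [rho(f, g)] by [rho(r_z, r_w)].  Expanding the resolvents,
    [rho(r_z, r_w)] is analytic in each variable and equals the series of
    [G2] for large [z] and [w], hence equals [G2] everywhere.

    Cauchy's formula for the given contour is proved by Dixon's argument; its
    use of Liouville's theorem only needs the maximum principle, which is read
    off local power series expansions. *)

(* The obstacle is that rho is known only through a bound by first derivatives: it has no integral
   representation, so it cannot be exchanged with a contour integral by Fubini's theorem. Finite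
   sums of resolvents do pass through it, but their convergence must then hold for the derivatives
   in x on [-M, M]. As the derivative of r_z is r_z^2, the sums are used for two families: H(z) =
   L(r_z), and H(z) = r_z(x)^2 for all x in [-M, M] at once. Both have Lipschitz constants
   controlled by the distance from the contour to [-M, M], so one choice of nodes serves them all.
   The second family calls for Cauchy's formula for the derivative of f on the real interval.

   Remainders of resolvent expansions are differentiated too, which puts a factor n in front of a
   geometric term; a halved radius or the square root of the ratio absorbs it. Analyticity is used
   as geometric decay of Taylor remainders, a form shared by power series, Cauchy transforms and
   functionals of resolvents. *)
Require Import Defs.
From HB Require Import structures.
From mathcomp Require Import all_boot all_order all_algebra finmap.
From mathcomp Require Import complex.
From mathcomp Require Import all_classical all_reals all_analysis.
From mathcomp Require Import measurable_realfun summability.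
From mathcomp Require Import ring lra.
Set Implicit Arguments.
Unset Strict Implicit.
Unset Printing Implicit Defensive.
Import Order.TTheory GRing.Theory Num.Theory.
Import numFieldNormedType.Exports.
Local Open Scope classical_set_scope.
Local Open Scope ring_scope.
Local Open Scope complex_scope.

(** * Modulus and topology of the complex numbers *)

Section Modulus.
Context (R : realType).
Local Notation C := R[i].
Implicit Types (z w : C) (x y e : R).

Lemma modulus_ge0 z : 0 <= modulus z.
Proof. by case: z => a b; exact: sqrtr_ge0. Qed.

Lemma modulusD z w : modulus (z + w) <= modulus z + modulus w.
Proof. exact: (le_normcD (z : Rcomplex R) (w : Rcomplex R)). Qed.

Lemma modulusN z : modulus (- z) = modulus z.
Proof. exact: (normcN (z : Rcomplex R)). Qed.

Lemma modulusB_sym z w : modulus (z - w) = modulus (w - z).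
Proof. by rewrite -modulusN opprB. Qed.

Lemma modulusB z w : modulus (z - w) <= modulus z + modulus w.
Proof. by apply: le_trans (modulusD _ _) _; rewrite modulusN. Qed.

Lemma modulus_triangle z w t : modulus (z - w) <= modulus (z - t) + modulus (t - w).
Proof. by apply: le_trans (modulusD _ _); rewrite addrA subrK. Qed.

Lemma modulusX z n : modulus (z ^+ n) = modulus z ^+ n.
Proof.
by elim: n => [|n IH]; rewrite ?expr0 ?Normc.normc1// !exprS Normc.normcM IH.
Qed.

Lemma modulus_eq0 z : (modulus z == 0) = (z == 0).
Proof.
apply/eqP/eqP => [/Normc.eq0_normc//|->]; exact: Normc.normc0.
Qed.

Lemma modulus_gt0 z : (0 < modulus z) = (z != 0).
Proof. by rewrite lt0r modulus_ge0 andbT modulus_eq0. Qed.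

Lemma modulus_sum (I : Type) (s : seq I) (P : pred I) (F : I -> C) :
  modulus (\sum_(i <- s | P i) F i) <= \sum_(i <- s | P i) modulus (F i).
Proof.
elim/big_ind2: _ => //; first by rewrite Normc.normc0.
by move=> *; apply: le_trans (modulusD _ _) (lerD _ _).
Qed.

Lemma modulus_real x : modulus x%:C = `|x|.
Proof. by rewrite /= expr0n /= addr0 sqrtr_sqr. Qed.

Lemma normr_Re_le z : `|complex.Re z| <= modulus z.
Proof.
by case: z => a b /=; rewrite -sqrtr_sqr ler_sqrt ?addr_ge0 ?sqr_ge0// lerDl sqr_ge0.
Qed.

Lemma normr_Im_le z : `|complex.Im z| <= modulus z.
Proof.
by case: z => a b /=; rewrite -sqrtr_sqr ler_sqrt ?addr_ge0 ?sqr_ge0// lerDr sqr_ge0.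
Qed.

Lemma modulus_le_ReIm z : modulus z <= `|complex.Re z| + `|complex.Im z|.
Proof.
case: z => a b /=; rewrite -[leRHS]ger0_norm ?addr_ge0// -sqrtr_sqr.
rewrite ler_sqrt ?sqr_ge0// sqrrD !real_normK ?num_real//.
by rewrite -addrAC lerDl mulrn_wge0// mulr_ge0.
Qed.

Lemma normr_modulus z : `|z| = (modulus z)%:C.
Proof. by case: z. Qed.

(* The metric of [R[i]^o] takes values in [R[i]]. *)
Lemma ball_modulus (z w : R[i]^o) e : ball z e%:C w <-> modulus (w - z) < e.
Proof.
rewrite -ball_normE /= /ball_ /= normr_modulus (_ : modulus (z - w) = modulus (w - z)) ?ltcR//.
exact: modulusB_sym.
Qed.

Lemma nearC (a : R[i]^o) (P : R[i]^o -> Prop) :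
  (\forall z \near a, P z) <->
  exists2 e : R, 0 < e & forall z, modulus (z - a) < e -> P z.
Proof.
split=> [/nbhs_ballP[e /= e0 H]|[e e0 H]].
  (* Positive elements for the partial order of [R[i]] are real. *)
  have eE : e = (complex.Re e)%:C.
    by move: e0 {H}; case: e => u v; rewrite ltcE /= => /andP[/eqP -> _].
  exists (complex.Re e); first by rewrite eE ltcR in e0.
  by move=> z /ball_modulus ze; apply: H; rewrite eE.
apply/nbhs_ballP; exists e%:C; first by rewrite /= ltcR.
by move=> z /ball_modulus/H.
Qed.

Lemma cvgC (u : nat -> R[i]^o) (l : R[i]^o) : (u @ \oo --> l) ->
  forall e, 0 < e -> exists n0, forall n, (n0 <= n)%N -> modulus (u n - l) < e.
Proof.
move=> ul e e0.
have := ul [set z | modulus (z - l) < e].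
case; first by apply/nearC; exists e.
by move=> n0 _ H; exists n0 => n /H.
Qed.

Lemma continuousC_real (u : R -> R[i]^o) : continuous u ->
  forall t e, 0 < e ->
    exists2 d, 0 < d & forall s, `|s - t| < d -> modulus (u s - u t) < e.
Proof.
move=> uc t e e0.
have := uc t [set z | modulus (z - u t) < e].
case/(_ _)/nbhs_ballP => [|d d0 H]; first by apply/nearC; exists e.
by exists d => // s st; apply: H; rewrite -ball_normE /= distrC.
Qed.

Lemma modulus_le0 z : (forall e, 0 < e -> modulus z <= e) -> z = 0.
Proof.
move=> H; apply/eqP; rewrite -modulus_eq0 eq_le modulus_ge0 andbT leNgt.
apply/negP => z0; have := H (modulus z / 2); rewrite divr_gt0// => /(_ isT).
by move: (modulus z) z0 => m; lra.
Qed.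

Lemma geometric_small q e : 0 <= q -> q < 1 -> 0 < e ->
  exists n0, forall n, (n0 <= n)%N -> q ^+ n < e.
Proof.
move=> q0 q1 e0.
have : `|q| < 1 by rewrite ger0_norm.
move/cvg_expr/cvgrPdist_lt/(_ _ e0) => [n0 _ H]; exists n0 => n /H /=.
by rewrite sub0r normrN ger0_norm// exprn_ge0.
Qed.

End Modulus.

(** * Quantitative analyticity *)

Section Expansion.
Context (R : realType).
Local Notation C := R[i].
Implicit Types (f h : C -> C) (a z w : C) (c : nat -> C) (B r e : R).

(* A quantitative form of analyticity at [a]: Taylor remainders decay
   geometrically, uniformly on a disc. *)
Definition expansion f a c B r : Prop :=
  [/\ 0 < r, 0 <= B &
    forall z, modulus (z - a) < r -> forall n,
    modulus (f z - \sum_(k < n) c k * (z - a) ^+ k) <=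
      B * (modulus (z - a) / r) ^+ n].

Definition expandable f a : Prop := exists c B r, expansion f a c B r.

Lemma expansion_at f a c B r : expansion f a c B r -> f a = c 0%N.
Proof.
move=> [r0 B0 H]; apply/eqP; rewrite -subr_eq0 -modulus_eq0 eq_le modulus_ge0 andbT.
have := H a; rewrite subrr Normc.normc0 => /(_ r0 1%N).
by rewrite big_ord1 expr0 mulr1 expr1 mul0r mulr0.
Qed.

(** At distance r / 2 from a, the remainders of orders n and n + 1 differ by the n-th term, and each
    is at most B / 2^n. *)
Lemma expansion_coef f a c B r : expansion f a c B r ->
  forall n, modulus (c n) <= 2 * B / r ^+ n.
Proof.
move=> [r0 B0 H] n.
pose x := r / 2; have x0 : 0 < x by rewrite divr_gt0.
have xa : modulus (a + x%:C - a) = x by rewrite addrAC subrr add0r modulus_real gtr0_norm.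
have xr : modulus (a + x%:C - a) < r by rewrite xa /x; lra.
have := H _ xr n; have := H _ xr n.+1; rewrite big_ord_recr /= xa.
set S := \sum_(_ < _) _; set y := _ * _ ^+ n => H1 H2.
have xrE : x / r = 2^-1 by rewrite /x mulrAC divff ?mul1r// gt_eqF.
have : modulus y <= 2 * B * 2^-1 ^+ n.
  rewrite (_ : y = (f (a + x%:C) - S) - (f (a + x%:C) - (S + y))); last by ring.
  apply: le_trans (modulusB _ _) _; apply: le_trans (lerD H2 H1) _.
  rewrite xrE -mulrDr [_ ^+ n.+1]exprS -mulrA mulrCA ler_wpM2l//.
  by have := exprn_ge0 n (_ : 0 <= 2^-1 :> R); lra.
rewrite /y Normc.normcM modulusX xa ler_pdivlMr ?exprn_gt0//.
by rewrite {1}/x exprMn mulrA ler_pM2r// exprn_gt0// invr_gt0.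
Qed.

Lemma expansion_shrink f a c B r r' : 0 < r' -> r' <= r ->
  expansion f a c B r -> expansion f a c B r'.
Proof.
move=> r'0 r'r [r0 B0 H]; split=> // z zr n.
apply: le_trans (H z (lt_le_trans zr r'r) n) _.
apply: ler_wpM2l => //.
apply: lerXn2r; rewrite ?nnegrE ?divr_ge0 ?modulus_ge0 ?(ltW r0) ?(ltW r'0)//.
by apply: ler_wpM2l; rewrite ?modulus_ge0// lef_pV2 ?posrE.
Qed.

Lemma expandable_continuous f a : expandable f a -> forall e, 0 < e ->
  exists2 d, 0 < d & forall z, modulus (z - a) < d -> modulus (f z - f a) < e.
Proof.
move=> [c [B [r E]]] e e0; have fa := expansion_at E; case: E => r0 B0 H.
have B1 : 0 < B + 1 by rewrite ltr_wpDl.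
exists (Num.min r (e * r / (B + 1))).
  by rewrite lt_min r0 divr_gt0// mulr_gt0.
move=> z; rewrite lt_min => /andP[zr ze]; have := H z zr 1%N.
rewrite big_ord1 expr0 mulr1 -fa expr1 => /le_lt_trans; apply.
rewrite mulrA ltr_pdivrMr//; move: ze; rewrite ltr_pdivlMr//.
have := modulus_ge0 (z - a); nra.
Qed.

Lemma expandable_near f h a e : 0 < e ->
  (forall z, modulus (z - a) < e -> f z = h z) -> expandable f a -> expandable h a.
Proof.
move=> e0 fh [c [B [r E]]]; exists c, B, (Num.min r e).
have m0 : 0 < Num.min r e by case: E => r0 _ _; rewrite lt_min r0.
have m1 : Num.min r e <= r by rewrite ge_min lexx.
have [_ B0 H] := expansion_shrink m0 m1 E; split=> // z zr n.
by rewrite -fh ?H//; move: zr; rewrite lt_min => /andP[].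
Qed.

Lemma expandableB f h a : expandable f a -> expandable h a ->
  expandable (fun z => f z - h z) a.
Proof.
move=> [c [B [r E]]] [c' [B' [r' E']]].
exists (fun k => c k - c' k), (B + B'), (Num.min r r').
have m0 : 0 < Num.min r r' by case: E E' => ? _ _ [? _ _]; rewrite lt_min; apply/andP.
have m1 : Num.min r r' <= r by rewrite ge_min lexx.
have m2 : Num.min r r' <= r' by rewrite ge_min lexx orbT.
have [_ B0 H] := expansion_shrink m0 m1 E.
have [_ B0' H'] := expansion_shrink m0 m2 E'.
split=> //; first exact: addr_ge0.
move=> z zr n; rewrite mulrDl.
under eq_bigr do rewrite mulrBl.
rewrite big_split sumrN /= (_ : _ - _ =
  (f z - \sum_(k < n) c k * (z - a) ^+ k) - (h z - \sum_(k < n) c' k * (z - a) ^+ k)).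
  by apply: le_trans (modulusB _ _) (lerD (H _ zr n) (H' _ zr n)).
ring.
Qed.

(** Either all coefficients after the first vanish, and then f z - f a is a remainder of every
    order, hence 0; or the first nonzero one gives the leading term b (z - a)^k, with the next
    remainder as error. *)
Lemma expandable_dichotomy f a : expandable f a ->
  (exists2 e, 0 < e & forall z, modulus (z - a) < e -> f z = f a) \/
  exists k (b : C) B r, [/\ (0 < k)%N, b != 0, 0 < r, 0 <= B & forall z,
    modulus (z - a) < r ->
    modulus (f z - f a - b * (z - a) ^+ k) <= B * modulus (z - a) ^+ k.+1].
Proof.
move=> [c [B [r E]]]; have fa := expansion_at E; case: E => r0 B0 H.
have [c0|] := pselect (forall k, c k.+1 = 0).
  left; exists r => // z zr; apply/eqP; rewrite -subr_eq0; apply/eqP.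
  apply: modulus_le0 => e e0.
  have q0 : 0 <= modulus (z - a) / r by rewrite divr_ge0 ?modulus_ge0 1?ltW.
  have q1 : modulus (z - a) / r < 1 by rewrite ltr_pdivrMr// mul1r.
  have B1 : 0 < e / (B + 1) by rewrite divr_gt0// ltr_wpDl.
  have [n0 /(_ n0.+1 (leqnSn _)) Hn] := geometric_small q0 q1 B1.
  have := H z zr n0.+1; rewrite big_ord_recl expr0 mulr1 big1 ?addr0 => [|i _]; last first.
    by rewrite lift0 c0 mul0r.
  rewrite -fa => /le_trans; apply; move: Hn; rewrite ltr_pdivlMr ?ltr_wpDl//.
  have := exprn_ge0 n0.+1 q0; nra.
move=> /existsNP nc; right.
have ex : exists k, c k.+1 != 0 by case: nc => k /eqP; exists k.
case: (ex_minnP ex) => k ck kmin; exists k.+1, (c k.+1), (B / r ^+ k.+2), r.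
split=> //; first by rewrite divr_ge0 ?exprn_ge0// ltW.
move=> z zr; have := H z zr k.+2; rewrite big_ord_recr /= big_ord_recl expr0 mulr1.
rewrite big1 ?addr0 => [|i _]; last first.
  rewrite lift0 /=; have [->|/kmin] := eqVneq (c i.+1) 0; first by rewrite mul0r.
  by rewrite leqNgt ltn_ord.
by rewrite -fa opprD addrA => /le_trans; apply; rewrite expr_div_n mulrA mulrAC.
Qed.

(** If f is not locally constant, a zero z close to a gives |b| |z - a|^k <= B |z - a|^(k+1), which
    fails for 0 < |z - a| < |b| / (B + 1). *)
Lemma expandable_isolated_zero f a : expandable f a ->
  (forall e, 0 < e -> exists z, [/\ z != a, modulus (z - a) < e & f z = 0]) ->
  exists2 e, 0 < e & forall z, modulus (z - a) < e -> f z = 0.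
Proof.
move=> fA Z; have fa : f a = 0.
  apply: modulus_le0 => e e0; have [d d0 H] := expandable_continuous fA e0.
  have [z [_ zd fz]] := Z _ d0; have := H z zd.
  by rewrite fz sub0r modulusN => /ltW.
case: (expandable_dichotomy fA) => [|[k [b [B [r [k0 b0 r0 B0 H]]]]]].
  by rewrite fa.
exfalso; have b1 : 0 < modulus b by rewrite modulus_gt0.
have B1 : 0 < B + 1 by rewrite ltr_wpDl.
have [|z [za]] := Z (Num.min r (modulus b / (B + 1))).
  by rewrite lt_min r0 divr_gt0.
rewrite lt_min => /andP[zr zb] fz; have := H z zr.
rewrite fz fa subrr sub0r modulusN Normc.normcM modulusX exprS mulrA ler_pM2r; last first.
  by rewrite exprn_gt0// modulus_gt0 subr_eq0.
move: zb; rewrite ltr_pdivlMr//; have := modulus_ge0 (z - a); nra.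
Qed.

Lemma expandable_local_max f a : expandable f a ->
  (forall z, modulus (f z) <= modulus (f a)) ->
  exists2 e, 0 < e & forall z, modulus (z - a) < e -> f z = f a.
Proof.
move=> fA mx; have [fa|fa] := eqVneq (f a) 0.
  exists 1 => // z _; apply/eqP; rewrite fa -modulus_eq0 eq_le modulus_ge0 andbT.
  by apply: le_trans (mx z) _; rewrite fa Normc.normc0.
case: (expandable_dichotomy fA) => // -[k [b [B [r [k0 b0 r0 B0 H]]]]]; exfalso.
(* in the direction [u] the leading term is a positive multiple of [f a] *)
pose u := k.-root (f a / b); have uk : b * u ^+ k = f a.
  by rewrite rootCK// mulrC divfK.
have u0 : 0 < modulus u.
  rewrite modulus_gt0; apply: contra_neq fa => u0.
  by rewrite -uk u0 expr0n gtn_eqF// mulr0.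
pose m := modulus (f a); have m0 : 0 < m by rewrite modulus_gt0.
pose D := B * modulus u ^+ k.+1; have D0 : 0 <= D by rewrite mulr_ge0// exprn_ge0// ltW.
(* The first bound keeps the point in the disc; the second makes the gain m t^k exceed the error D
   t^(k+1). *)
pose t := Num.min (r / modulus u) (m / (D + 1)) / 2.
have D1 : 0 < D + 1 by rewrite ltr_wpDl.
have t0 : 0 < t by rewrite divr_gt0// lt_min !divr_gt0.
have [t1 t2] : t < r / modulus u /\ t < m / (D + 1).
  by apply/andP; rewrite -lt_min /t ltr_pdivrMr// ltr_pMr ?lt_min ?divr_gt0// ltr1n.
clearbody t; have zE : modulus (a + t%:C * u - a) = t * modulus u.
  by rewrite addrAC subrr add0r Normc.normcM modulus_real gtr0_norm.
have := H (a + t%:C * u); rewrite zE -ltr_pdivlMr// => /(_ t1).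
rewrite [a + _ - a]addrAC subrr add0r; set z := a + _ => Hz.
have := mx z; apply/negP; rewrite -ltNge.
have E : f a * (1 + t ^+ k)%:C = f z - (f z - f a - b * (t%:C * u) ^+ k).
  by rewrite exprMn mulrCA uk rmorphD rmorph1 rmorphXn /=; ring.
have : modulus (f a * (1 + t ^+ k)%:C) <= modulus (f z) + D * t ^+ k.+1.
  rewrite E; apply: le_trans (modulusB _ _) _; rewrite lerD2l.
  by apply: le_trans Hz _; rewrite exprMn /D mulrCA [_ * (B * _)]mulrC.
rewrite Normc.normcM modulus_real ger0_norm ?addr_ge0 ?exprn_ge0 ?(ltW t0)// -/m.
rewrite mulrDr mulr1 exprS -(ltrD2r (D * (t * t ^+ k))); apply: lt_le_trans.
rewrite ltrD2l mulrA ltr_pM2r ?exprn_gt0//; move: t2; rewrite ltr_pdivlMr//; nra.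
Qed.

End Expansion.

(** * Maximum and identity principles *)

Section GlobalPrinciples.
Context (R : realType).
Local Notation C := R[i].
Implicit Types (f h : C -> C) (a z w : C).

(** Connectedness of the half-line, in the form that propagates a property along a ray or a segment:
    the supremum of the parameters up to which P holds can be passed. *)
Lemma real_induction (P : R -> Prop) : P 0 ->
  (forall t, 0 < t -> (forall s, 0 <= s -> s < t -> P s) -> P t) ->
  (forall t, 0 <= t -> P t ->
     exists2 e, 0 < e & forall s, t < s -> s < t + e -> P s) ->
  forall t, 0 <= t -> P t.
Proof.
move=> P0 Pclosed Popen b b0; apply: contrapT => Pb.
pose A := [set t | 0 <= t /\ forall s, 0 <= s -> s <= t -> P s].
have A0 : A 0 by split=> // s s0 s0'; rewrite (_ : s = 0)//; apply/le_anti/andP.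
have Ab : ubound A b.
  by move=> t [_ H]; rewrite leNgt; apply/negP => /ltW bt; apply: Pb; apply: H.
have Asup : has_sup A by split; [exists 0 | exists b].
pose T := sup A; have T0 : 0 <= T by apply: ub_le_sup => //; exists b.
have PT s : 0 <= s -> s < T -> P s.
  move=> s0 sT; have := sup_adherent (_ : 0 < T - s) Asup.
  rewrite subr_gt0 => /(_ sT)[t [_ H]]; rewrite opprB addrCA subrr addr0 => st.
  by apply: H => //; exact: ltW.
have PTT : P T.
  move: T0; rewrite le_eqVlt => /orP[/eqP <-//|T0]; exact: Pclosed.
have [e e0 He] := Popen _ T0 PTT.
suff : A (T + e / 2).
  by move=> /(ub_le_sup (ex_intro _ b Ab)); rewrite -/T; lra.
split=> [|s s0 sT]; first by lra.
have [/PT|Ts|->//] := ltgtP s T; first exact.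
by apply: He => //; lra.
Qed.

(** Decay at infinity and compactness of a square make |h| attain its global maximum at some w. By
    the local maximum principle the value h w persists along the horizontal ray from w, against the
    decay. *)
Lemma expandable_vanishing h : (forall a, expandable h a) ->
  (forall e, 0 < e -> exists r, forall z, r < modulus z -> modulus (h z) < e) ->
  forall z, h z = 0.
Proof.
move=> hA h0 z1; apply/eqP/negP => /negP hz1.
have m0 : 0 < modulus (h z1) by rewrite modulus_gt0.
have [r Hr] := h0 _ m0.
pose r' := Num.max r (modulus z1).
pose k (p : R * R) := modulus (h (p.1 +i* p.2)).
have kc : continuous k.
  move=> p; apply/cvgrPdist_lt => e e0.
  have [d d0 H] := expandable_continuous (hA (p.1 +i* p.2)) e0.
  exists (ball p.1 (d / 2), ball p.2 (d / 2)).
    by split; apply: nbhsx_ballx; rewrite divr_gt0.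
  move=> q [/= q1 q2]; rewrite /k.
  have : modulus (h (q.1 +i* q.2) - h (p.1 +i* p.2)) < e.
    apply: H; apply: le_lt_trans (modulus_le_ReIm _) _ => /=.
    move: q1 q2; rewrite -ball_normE /= /ball_ /= (distrC p.1) (distrC p.2); lra.
  apply: le_lt_trans; rewrite ler_norml; apply/andP; split.
    have := modulusD (h (q.1 +i* q.2) - h (p.1 +i* p.2)) (h (p.1 +i* p.2)).
    by rewrite subrK; lra.
  have := modulusB (h (q.1 +i* q.2)) (h (q.1 +i* q.2) - h (p.1 +i* p.2)).
  by rewrite opprB addrCA subrr addr0; lra.
pose S : set R := [set` `[- r', r']]; have kK : compact (S `*` S : set (R * R)).
  by apply: compact_setX; exact: segment_compact.
have inK z : modulus z <= r' ->
    (S `*` S : set (R * R)) (complex.Re z, complex.Im z).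
  move=> zr; split; rewrite /S /= in_itv /= -ler_norml; apply: le_trans zr.
  - exact: normr_Re_le.
  - exact: normr_Im_le.
have z1K : (S `*` S : set (R * R)) (complex.Re z1, complex.Im z1).
  by apply: inK; rewrite /r' le_max lexx orbT.
have [|[x y] _ Hmax] := compact_EVT_max _ kK (continuous_subspaceT kc).
  by exists (complex.Re z1, complex.Im z1).
pose w := x +i* y.
have Hw z : modulus (h z) <= modulus (h w).
  have [/inK/mem_set/Hmax|zr] := leP (modulus z) r'; first by rewrite /k /=; case: z.
  apply: le_trans (_ : modulus (h z1) <= _).
    by apply/ltW/Hr; apply: le_lt_trans zr; rewrite /r' le_max lexx.
  by have /mem_set/Hmax := z1K; rewrite /k /=; case: (z1).
(* The set of good t is closed by continuity, and open because every point with the value h w is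
   again a global maximum. *)
have hray : forall t, 0 <= t -> h (w + t%:C) = h w.
  apply: real_induction; first by rewrite addr0.
    move=> t t0 Ht; apply/eqP; rewrite -subr_eq0; apply/eqP.
    apply: modulus_le0 => e e0.
    have [d d0 Hd] := expandable_continuous (hA (w + t%:C)) e0.
    pose s := Num.max 0 (t - d / 2).
    have [s0 st sd] : [/\ 0 <= s, s < t & t - s < d].
      rewrite /s le_max lexx gt_max t0 /=; split=> //; first by lra.
      by rewrite ltrBlDl -ltrBlDr lt_max; apply/orP; right; lra.
    rewrite -(Ht s)// modulusB_sym; apply/ltW/Hd.
    by rewrite opprD addrACA subrr add0r -rmorphB modulus_real distrC gtr0_norm ?subr_gt0.
  move=> t t0 Ht; have [|e e0 He] := expandable_local_max (hA (w + t%:C)).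
    by move=> z; rewrite Ht.
  exists e => // s ts se; rewrite He//.
  by rewrite opprD addrACA subrr add0r -rmorphB modulus_real gtr0_norm; lra.
have [r2 Hr2] := h0 (modulus (h w)) (lt_le_trans m0 (Hw z1)).
pose t := `|r2| + modulus w + 1.
have t0 : 0 <= t by rewrite /t !addr_ge0 ?modulus_ge0.
have := Hr2 (w + t%:C); rewrite hray// ltxx => H.
suff : r2 < modulus (w + t%:C) by move/H.
have := modulusB (w + t%:C) w; rewrite addrAC subrr add0r modulus_real ger0_norm//.
by have := ler_norm r2; rewrite /t; lra.
Qed.

Lemma csegmentP (M : R) z : csegment M z <-> complex.Im z = 0 /\ `|complex.Re z| <= M.
Proof.
split=> [[x /= + <-] /=|]; first by rewrite in_itv /= -ler_norml.
case: z => x y /= [-> xM]; exists x => //.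
by rewrite /= in_itv /= -ler_norml.
Qed.

(** A real point off the segment already has modulus above M. A nonreal one is reached from that
    region along a vertical path avoiding the real axis, on which zeros accumulate at each new
    point. *)
Lemma expandable_identity (M : R) f : 0 < M ->
  (forall a, ~ csegment M a -> expandable f a) ->
  (forall z, M < modulus z -> f z = 0) ->
  forall z, ~ csegment M z -> f z = 0.
Proof.
move=> M0 fA f0 [x y] zM; have [y0|y0] := eqVneq y 0.
  apply: f0; rewrite y0 modulus_real ltNge; apply/negP => xM.
  by apply: zM; apply/csegmentP; rewrite y0.
(* a vertical segment from a far away point down to [x + i y] *)
pose p t : C := x +i* (y + Num.sg y * (M - t)).
have pB s t : modulus (p s - p t) = `|s - t|.
  rewrite /= subrr expr0n add0r /= sqrtr_sqr.
  rewrite (_ : _ - _ = Num.sg y * (t - s)); last by ring.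
  by rewrite normrM normr_sg y0 mul1r distrC.
have yE : `|y| = Num.sg y * y by rewrite normrEsg.
have sg2 : Num.sg y * Num.sg y = 1 by rewrite -expr2 sqr_sg y0.
have pseg t : t <= M -> ~ csegment M (p t).
  move=> tM /csegmentP[/= H _]; have : Num.sg y * (y + Num.sg y * (M - t)) = 0.
    by rewrite H mulr0.
  rewrite mulrDr mulrA sg2 mul1r -yE; have := normr_gt0 y; rewrite y0; lra.
(* [real_induction] runs over the whole half-line while the path stays off the axis only for t <= M;
   the guard t <= M is part of the property, and the goal is its instance at t = M. *)
suff : M <= M -> exists2 e, 0 < e & forall w, modulus (w - p M) < e -> f w = 0.
  case=> // e e0 /(_ (p M)); rewrite subrr Normc.normc0 => /(_ e0).
  by rewrite /p subrr mulr0 addr0.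
apply: (real_induction (P := fun t => t <= M ->
    exists2 e, 0 < e & forall w, modulus (w - p t) < e -> f w = 0)) => [_|t t0 IH tM|t t0 IH|].
- have pM : M < modulus (p 0).
    apply: lt_le_trans (normr_Im_le _); rewrite /= subr0.
    have : `|Num.sg y * (y + Num.sg y * M)| = `|y + Num.sg y * M|.
      by rewrite normrM normr_sg y0 mul1r.
    rewrite mulrDr mulrA sg2 mul1r -yE => <-.
    by rewrite ger0_norm ?addr_ge0 ?(ltW M0)// ltrDr normr_gt0.
  exists (modulus (p 0) - M); first by rewrite subr_gt0.
  move=> w wp; apply: f0; have := modulusB w (w - p 0).
  by rewrite opprB addrCA subrr addr0; lra.
- apply: expandable_isolated_zero; first exact/fA/pseg.
  move=> e e0; pose s := Num.max 0 (t - e / 2).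
  have [s0 st se] : [/\ 0 <= s, s < t & t - s < e].
    rewrite /s le_max lexx gt_max t0 /=; split=> //; first by lra.
    by rewrite ltrBlDl -ltrBlDr lt_max; apply/orP; right; lra.
  have [|d d0 Hd] := IH s s0 st; first by lra.
  have ps : modulus (p s - p t) = t - s by rewrite pB distrC gtr0_norm// subr_gt0.
  exists (p s); split; [|by rewrite ps|].
    by rewrite -subr_eq0 -modulus_gt0 ps subr_gt0.
  by apply: Hd; rewrite subrr Normc.normc0.
- have [tM|Mt] := leP t M; last by exists 1 => // s ts _ sM; lra.
  have [e e0 He] := IH tM; exists (e / 2); first by rewrite divr_gt0.
  move=> s ts se _; exists (e / 2); first by rewrite divr_gt0.
  move=> w ws; apply: He; apply: le_lt_trans (modulus_triangle _ _ (p s)) _.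
  by rewrite pB gtr0_norm; lra.
- exact: ltW.
Qed.

End GlobalPrinciples.

(** * Cauchy transforms along a closed curve *)

Section ContinuityWithin.
Context (R : realType).
Local Notation C := (R[i]^o).
Implicit Types (D : set C) (f g : C -> C) (a z w : C).

Definition continuous_at_in D f z : Prop :=
  f x @[x --> within D (nbhs z)] --> f z.

Definition continuous_in D f : Prop := forall z, D z -> continuous_at_in D f z.

Lemma continuous_at_inP D f z : continuous_at_in D f z <->
  forall e : R, 0 < e -> exists2 d : R, 0 < d &
    forall w, D w -> modulus (w - z) < d -> modulus (f w - f z) < e.
Proof.
split=> [fc e e0|H A /nearC[e e0 HA]].
  have /nearC[d d0 Hd] : \forall x \near z, D x -> modulus (f x - f z) < e.
    by apply: (fc [set w | modulus (w - f z) < e]); apply/nearC; exists e.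
  by exists d => // w Dw wz; exact: Hd.
apply/nearC; have [d d0 Hd] := H _ e0.
by exists d => // w wd Dw; apply: HA; exact: Hd.
Qed.

Lemma continuous_at_in_cst D (b : C) z : continuous_at_in D (fun=> b) z.
Proof.
by apply/continuous_at_inP => e e0; exists 1 => // w _ _; rewrite subrr Normc.normc0.
Qed.

Lemma continuous_at_in_id D z : continuous_at_in D id z.
Proof. by apply/continuous_at_inP => e e0; exists e. Qed.

Lemma continuous_at_inD D f g z : continuous_at_in D f z ->
  continuous_at_in D g z -> continuous_at_in D (fun x => f x + g x) z.
Proof. exact: cvgD. Qed.

Lemma continuous_at_inB D f g z : continuous_at_in D f z ->
  continuous_at_in D g z -> continuous_at_in D (fun x => f x - g x) z.
Proof. exact: cvgB. Qed.

Lemma continuous_at_inM D f g z : continuous_at_in D f z ->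
  continuous_at_in D g z -> continuous_at_in D (fun x => f x * g x) z.
Proof. exact: cvgM. Qed.

Lemma continuous_at_inV D f z : f z != 0 -> continuous_at_in D f z ->
  continuous_at_in D (fun x => (f x)^-1) z.
Proof. by move=> fz; exact: cvgV. Qed.

Lemma continuous_at_inX D f z n : continuous_at_in D f z ->
  continuous_at_in D (fun x => f x ^+ n) z.
Proof.
move=> fc; elim: n => [|n IH].
  by under eq_fun do rewrite expr0; exact: continuous_at_in_cst.
by under eq_fun do rewrite exprS; exact: (continuous_at_inM fc IH).
Qed.

Lemma continuous_at_in_sum D n (F : nat -> C -> C) z :
  (forall k, (k < n)%N -> continuous_at_in D (F k) z) ->
  continuous_at_in D (fun x => \sum_(k < n) F k x) z.
Proof.
elim: n => [|n IH] H.
  by under eq_fun do rewrite big_ord0; exact: continuous_at_in_cst.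
under eq_fun do rewrite big_ord_recr /=.
by apply: continuous_at_inD; [apply: IH => k /ltnW/H | exact: H].
Qed.

Lemma expandable_continuous_at_in D f z : expandable f z -> continuous_at_in D f z.
Proof.
move=> /expandable_continuous H; apply/continuous_at_inP => e /H[d d0 Hd].
by exists d => // w _; exact: Hd.
Qed.

Lemma eq_continuous_at_in D f g z d : 0 < d ->
  (forall w, modulus (w - z) < d -> f w = g w) ->
  continuous_at_in D f z -> continuous_at_in D g z.
Proof.
move=> d0 fg /continuous_at_inP fc; apply/continuous_at_inP => e /fc[d' d'0 H].
exists (Num.min d d'); first by rewrite lt_min d0.
move=> w Dw; rewrite lt_min => /andP[wd wd'].
by rewrite -!fg ?subrr ?Normc.normc0// H.
Qed.

Lemma continuous_at_in_resolvent D a z n : z != a ->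
  continuous_at_in D (fun x => ((x - a) ^+ n)^-1) z.
Proof.
move=> za; apply: continuous_at_inV; first by rewrite expf_neq0// subr_eq0.
apply: continuous_at_inX; apply: continuous_at_inB; last exact: continuous_at_in_cst.
exact: continuous_at_in_id.
Qed.

End ContinuityWithin.

(** * Cauchy transforms and winding numbers of an abstract contour functional *)

Section ContourFunctional.
Context (R : realType).
Local Notation C := (R[i]^o).
Implicit Types (F H : C -> C) (a b z w : C).

(* The properties of [H |-> contour_integral gamma H], on functions that are
   continuous along the trace [Tr] of the closed curve [gamma], from which the
   homology form of Cauchy's formula follows. *)
Record contour_functional (Tr : set C) (V : R) (I : (C -> C) -> C) : Prop :=
    ContourFunctional {
  contour_ge0 : 0 <= V ;
  contour_ext : forall H1 H2, (forall z, Tr z -> H1 z = H2 z) -> I H1 = I H2 ;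
  contour_linear : forall (a : C) H1 H2, continuous_in Tr H1 -> continuous_in Tr H2 ->
    I (fun z => a * H1 z + H2 z) = a * I H1 + I H2 ;
  contour_bound : forall H (B : R), continuous_in Tr H -> 0 <= B ->
    (forall z, Tr z -> modulus (H z) <= B) -> modulus (I H) <= V * B ;
  contour_bounded : forall H, continuous_in Tr H ->
    exists2 B : R, 0 <= B & forall z, Tr z -> modulus (H z) <= B ;
  contour_exp : forall k, I (fun z => z ^+ k) = 0 ;
  contour_inv : forall a k, ~ Tr a -> I (fun z => ((z - a) ^+ k.+2)^-1) = 0 }.

Context (Tr : set C) (V : R) (I : (C -> C) -> C).
Hypothesis IP : contour_functional Tr V I.
Let V0 := contour_ge0 IP.

Lemma continuous_in_cst (b : C) : continuous_in Tr (fun=> b).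
Proof. by move=> z _; exact: continuous_at_in_cst. Qed.

Lemma contour0 : I (fun=> 0) = 0.
Proof.
have := contour_linear IP 1 (@continuous_in_cst 0) (@continuous_in_cst 0).
under eq_fun do rewrite mulr0 addr0.
by rewrite mul1r => /eqP; rewrite -subr_eq0 opprD addrA subrr sub0r oppr_eq0 => /eqP.
Qed.

Lemma contourZ (a : C) H : continuous_in Tr H -> I (fun z => a * H z) = a * I H.
Proof.
move=> Hc; have := contour_linear IP a Hc (@continuous_in_cst 0).
by rewrite contour0 addr0; under eq_fun do rewrite addr0.
Qed.

Lemma contourB H1 H2 : continuous_in Tr H1 -> continuous_in Tr H2 ->
  I (fun z => H1 z - H2 z) = I H1 - I H2.
Proof.
move=> c1 c2; have := contour_linear IP (- 1) c2 c1.
by under eq_fun do rewrite mulN1r addrC; rewrite mulN1r addrC.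
Qed.

Lemma contour_sum n (c : nat -> C) (H : nat -> C -> C) :
  (forall k, (k < n)%N -> continuous_in Tr (H k)) ->
  I (fun z => \sum_(k < n) c k * H k z) = \sum_(k < n) c k * I (H k).
Proof.
elim: n => [|n IH] Hc.
  by rewrite big_ord0; under eq_fun do rewrite big_ord0; exact: contour0.
under eq_fun do rewrite big_ord_recr /= addrC.
rewrite (contour_linear IP); last 2 first.
- exact: Hc.
- move=> z Dz; apply: (continuous_at_in_sum (F := fun k x => c k * H k x)) => k kn.
  apply: continuous_at_inM.
    exact: continuous_at_in_cst.
  exact: (Hc k (ltnW kn) z Dz).
by rewrite IH ?big_ord_recr/= 1?addrC// => k /ltnW; exact: Hc.
Qed.

Lemma resolvent_continuous a n : ~ Tr a -> continuous_in Tr (fun z => ((z - a) ^+ n)^-1).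
Proof.
move=> Ta z Tz; apply: continuous_at_in_resolvent.
by apply/negP => /eqP za; apply: Ta; rewrite -za.
Qed.

Lemma continuous_inM H1 H2 : continuous_in Tr H1 -> continuous_in Tr H2 ->
  continuous_in Tr (fun z => H1 z * H2 z).
Proof. by move=> c1 c2 z Tz; apply: continuous_at_inM; [exact: c1|exact: c2]. Qed.

(** Boundedness of continuous functions on the trace takes the place of compactness: an upper bound
    for 1 / (z - a) is a lower bound for the distance. *)
Lemma dist_contour a : ~ Tr a ->
  exists2 d : R, 0 < d & forall z, Tr z -> d <= modulus (z - a).
Proof.
move=> Ta; have [B B0 HB] := contour_bounded IP (resolvent_continuous (n := 1) Ta).
exists (B + 1)^-1; first by rewrite invr_gt0 ltr_wpDl.
move=> z Tz; have := HB z Tz; rewrite expr1 Normc.normcV.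
have za : 0 < modulus (z - a).
  by rewrite modulus_gt0 subr_eq0; apply/negP => /eqP za; apply: Ta; rewrite -za.
rewrite -[X in _ -> _ <= X]invrK lef_pV2 ?posrE ?invr_gt0 ?ltr_wpDl// => ?.
lra.
Qed.

(** Finite geometric series with exact remainder. Shifting x and y by a centre expands a resolvent
    about that centre; without a shift it is the expansion at infinity. *)
Lemma resolvent_expand (x y : C) n : x != 0 -> x != y ->
  (x - y)^-1 = \sum_(k < n) y ^+ k / x ^+ k.+1 + (y / x) ^+ n / (x - y).
Proof.
move=> x0 xy; elim: n => [|n IH]; first by rewrite big_ord0 add0r expr0 mul1r.
rewrite big_ord_recr /= {1}IH -addrA; congr (_ + _).
rewrite !exprMn !exprVn !exprS; field.
by rewrite subr_eq0 xy expf_neq0// x0.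
Qed.

(** The remainder is the integral of H(z) ((b - a) / (z - a))^n / (z - b). Half the distance d to
    the trace is taken as radius, so that b keeps distance d / 2 from the trace, whence the factor 2
    / d. *)
Lemma cauchy_transform_expandable H a : continuous_in Tr H -> ~ Tr a ->
  exists B r, expansion (fun b => I (fun z => H z / (z - b))) a
    (fun k => I (fun z => H z / (z - a) ^+ k.+1)) B r.
Proof.
move=> Hc Ta; have [d d0 Hd] := dist_contour Ta.
have [B B0 HB] := contour_bounded IP Hc.
exists (V * (B * (2 / d))), (d / 2); split.
- by rewrite divr_gt0.
- by rewrite !mulr_ge0// invr_ge0 ltW.
move=> b bd n.
have dzb z : Tr z -> d / 2 <= modulus (z - b).
  move=> /Hd; have := modulus_triangle z a b; rewrite (modulusB_sym b a) in bd *; lra.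
have Tb : ~ Tr b.
  by move=> /dzb; rewrite subrr Normc.normc0; lra.
have E1 : I (fun z => H z / (z - b)) -
    \sum_(k < n) I (fun z => H z / (z - a) ^+ k.+1) * (b - a) ^+ k =
    I (fun z => H z * (((b - a) / (z - a)) ^+ n / (z - b))).
  rewrite -[LHS]/(_ - _).
  under eq_bigr do rewrite mulrC.
  rewrite -(contour_sum (H := fun k z => H z / (z - a) ^+ k.+1) (fun k => (b - a) ^+ k)) => [|k _]; last first.
    exact: continuous_inM Hc (resolvent_continuous Ta).
  rewrite -contourB; last 2 first.
  - by apply: (continuous_inM Hc); exact: (resolvent_continuous (n := 1) Tb).
  - move=> z Tz.
    apply: (continuous_at_in_sum (F := fun k x => (b - a) ^+ k * (H x / (x - a) ^+ k.+1))).
    move=> k _; apply: continuous_at_inM; first exact: continuous_at_in_cst.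
    exact: continuous_inM Hc (resolvent_continuous Ta) _ Tz.
  apply: (contour_ext IP) => z Tz.
  have za : z - a != 0 by rewrite -modulus_gt0; apply: lt_le_trans (Hd z Tz).
  have zb : z - a != b - a.
    by rewrite (inj_eq (addIr _)); apply/negP => /eqP zb; apply: Tb; rewrite -zb.
  have := resolvent_expand n za zb; rewrite opprB addrA subrK => E1; rewrite {1}E1.
  rewrite mulrDr mulr_sumr addrAC -[RHS]add0r; congr (_ + _).
  by apply/eqP; rewrite subr_eq0; apply/eqP; apply: eq_bigr => k _; ring.
rewrite E1 -mulrA.
have -> : (B * (2 / d)) * (modulus (b - a) / (d / 2)) ^+ n =
    B * ((modulus (b - a) / (d / 2)) ^+ n / (d / 2)).
  by rewrite [_ / (d / 2)]mulrC invf_div; ring.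
apply: (contour_bound IP).
- apply: (continuous_inM Hc); under eq_fun do rewrite exprMn exprVn.
  apply: continuous_inM; last exact: (resolvent_continuous (n := 1) Tb).
  apply: continuous_inM; first exact: continuous_in_cst.
  exact: resolvent_continuous.
- by rewrite !mulr_ge0 ?invr_ge0 ?exprn_ge0 ?divr_ge0 ?modulus_ge0// ltW.
move=> z Tz; rewrite Normc.normcM; apply: ler_pM; rewrite ?modulus_ge0 ?HB//.
have d2 : 0 < d / 2 by rewrite divr_gt0.
have za : d / 2 <= modulus (z - a) by have := Hd _ Tz; lra.
rewrite Normc.normcM modulusX Normc.normcM !Normc.normcV.
apply: ler_pM; rewrite ?invr_ge0 ?exprn_ge0 ?divr_ge0 ?modulus_ge0//; last first.
  by rewrite lef_pV2 ?posrE ?dzb// (lt_le_trans d2)// dzb.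
apply: lerXn2r; rewrite ?nnegrE ?divr_ge0 ?modulus_ge0 ?(ltW d2) ?(ltW d0)//.
by apply: ler_wpM2l; rewrite ?modulus_ge0// lef_pV2 ?posrE ?(lt_le_trans d2 za).
Qed.

Definition winding a := I (fun z => (z - a)^-1).

Lemma windingE a : winding a = I (fun z => 1 / (z - a)).
Proof. by rewrite /winding; under [in RHS]eq_fun do rewrite mul1r. Qed.

(** The coefficients of positive index are integrals of (z - a)^-(k+2), which vanish by
    [contour_inv]. *)
Lemma winding_locally_constant a : ~ Tr a ->
  exists2 d : R, 0 < d & forall b, modulus (b - a) < d -> ~ Tr b /\ winding b = winding a.
Proof.
move=> Ta; have [d d0 Hd] := dist_contour Ta.
have [B [r E]] := cauchy_transform_expandable (@continuous_in_cst 1) Ta.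
have E0 := expansion_at E; case: E => r0 B0 HE.
exists (Num.min d r); first by rewrite lt_min d0.
move=> b; rewrite lt_min => /andP[bd br]; split.
  by move=> /Hd; rewrite leNgt bd.
rewrite !windingE; apply/eqP; rewrite -subr_eq0; apply/eqP; apply: modulus_le0 => e e0.
have q0 : 0 <= modulus (b - a) / r by rewrite divr_ge0 ?modulus_ge0// ltW.
have q1 : modulus (b - a) / r < 1 by rewrite ltr_pdivrMr// mul1r.
have [n0 /(_ n0.+1 (leqnSn _)) Hn] := geometric_small q0 q1 (divr_gt0 e0 (ltr_wpDl B0 ltr01)).
have := HE b br n0.+1; rewrite big_ord_recl expr0 mulr1 big1 => [|i _]; last first.
  rewrite lift0; under eq_fun do rewrite mul1r.
  by rewrite (contour_inv IP) ?mul0r.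
rewrite addr0 -E0 => /le_trans; apply.
move: Hn; rewrite ltr_pdivlMr ?ltr_wpDl//; have := exprn_ge0 n0.+1 q0; nra.
Qed.

Lemma contour_trace_bounded : exists2 rho : R, 0 < rho & forall z, Tr z -> modulus z <= rho.
Proof.
have [B B0 HB] := contour_bounded IP (H := id) (fun z _ => @continuous_at_in_id _ Tr z).
by exists (B + 1); [rewrite ltr_wpDl | move=> z /HB; lra].
Qed.

(** Expanding 1 / (z - a) in powers of z / a, the polynomial part integrates to 0 by [contour_exp],
    and the remainder decays geometrically because the trace lies in the disc of radius rho. So the
    winding is exactly 0, not merely small. *)
Lemma winding_far : exists2 rho : R, 0 < rho & forall a, rho < modulus a -> winding a = 0.
Proof.
have [rho rho0 Hrho] := contour_trace_bounded; exists rho => // a ra.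
have Ta : ~ Tr a by move=> /Hrho; rewrite leNgt ra.
have a0 : a != 0 by rewrite -modulus_gt0 (lt_trans rho0).
apply: modulus_le0 => e e0.
pose q := rho / modulus a; have ma : 0 < modulus a by rewrite modulus_gt0.
have q0 : 0 <= q by rewrite divr_ge0 ?modulus_ge0// ltW.
have q1 : q < 1 by rewrite ltr_pdivrMr// mul1r.
have D0 : 0 < modulus a - rho by rewrite subr_gt0.
pose D := V / (modulus a - rho); have DD : 0 <= D by rewrite divr_ge0// ltW.
have [n0 /(_ n0 (leqnn _)) Hn] := geometric_small q0 q1 (divr_gt0 e0 (ltr_wpDl DD ltr01)).
have W : winding a = I (fun z => (z / a) ^+ n0 / (z - a)).
  have c1 k : continuous_in Tr (fun z : C => z ^+ k).
    by move=> z _; apply: continuous_at_inX; exact: continuous_at_in_id.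
  rewrite -[LHS]subr0 -[X in _ - X](_ : \sum_(k < n0) (- (a ^+ k.+1)^-1) * I (fun z => z ^+ k) = 0).
    rewrite -(contour_sum (H := fun k z => z ^+ k) (fun k => - (a ^+ k.+1)^-1))// -contourB; last 2 first.
    - exact: (resolvent_continuous (n := 1) Ta).
    - move=> z Tz.
      apply: (continuous_at_in_sum (F := fun k x => - (a ^+ k.+1)^-1 * x ^+ k)) => k _.
      by apply: continuous_at_inM; [exact: continuous_at_in_cst|exact: c1].
    apply: (contour_ext IP) => z Tz.
    have az : a != z by apply/negP => /eqP az; apply: Ta; rewrite az.
    have -> : \sum_(k < n0) - (a ^+ k.+1)^-1 * z ^+ k = - \sum_(k < n0) z ^+ k / a ^+ k.+1.
      by rewrite -sumrN; apply: eq_bigr => k _; rewrite mulNr mulrC.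
    have E := resolvent_expand n0 a0 az.
    by rewrite -[z - a]opprB invrN {1}E; ring.
  by rewrite big1// => k _; rewrite (contour_exp IP) mulr0.
rewrite W; apply: le_trans (_ : V * (q ^+ n0 / (modulus a - rho)) <= _).
  apply: (contour_bound IP).
  - under eq_fun do rewrite exprMn; apply: continuous_inM; last first.
      exact: (resolvent_continuous (n := 1) Ta).
    apply: continuous_inM; last exact: continuous_in_cst.
    by move=> z _; apply: continuous_at_inX; exact: continuous_at_in_id.
  - by rewrite divr_ge0 ?exprn_ge0// ltW.
  move=> z Tz; rewrite Normc.normcM modulusX Normc.normcM !Normc.normcV.
  have za : modulus a - rho <= modulus (z - a).
    by have := Hrho z Tz; have := modulusB z (z - a); rewrite opprB addrCA subrr addr0; lra.
  apply: ler_pM; rewrite ?invr_ge0 ?exprn_ge0 ?divr_ge0 ?modulus_ge0//; last first.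
    by rewrite lef_pV2 ?posrE// (lt_le_trans D0).
  apply: lerXn2r; rewrite ?nnegrE ?divr_ge0 ?modulus_ge0 ?(ltW rho0)// /q.
  by apply: ler_wpM2r; rewrite ?invr_ge0 ?modulus_ge0 ?Hrho.
rewrite mulrCA -/D; move: Hn; rewrite ltr_pdivlMr ?ltr_wpDl//.
have := exprn_ge0 n0 q0; nra.
Qed.

Lemma cauchy_transform_far H (e : R) : continuous_in Tr H -> 0 < e ->
  exists2 rho : R, 0 < rho & forall a, rho < modulus a ->
    ~ Tr a /\ modulus (I (fun z => H z / (z - a))) < e.
Proof.
move=> Hc e0; have [rho rho0 Hrho] := contour_trace_bounded.
have [B B0 HB] := contour_bounded IP Hc.
have VB : 0 <= V * B by rewrite mulr_ge0.
exists (rho + (V * B + 1) / e).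
  by rewrite addr_gt0// divr_gt0// ltr_wpDl.
move=> a ra; have D0 : 0 < (V * B + 1) / e by rewrite divr_gt0// ltr_wpDl.
have D1 : 0 < modulus a - rho by lra.
have Ta : ~ Tr a by move=> /Hrho; lra.
split=> //; apply: le_lt_trans (_ : V * (B / (modulus a - rho)) < _).
  apply: (contour_bound IP).
  - exact: (continuous_inM Hc (resolvent_continuous (n := 1) Ta)).
  - by rewrite divr_ge0// ltW.
  move=> z Tz; rewrite Normc.normcM Normc.normcV.
  have za : modulus a - rho <= modulus (z - a).
    by have := Hrho z Tz; have := modulusB z (z - a); rewrite opprB addrCA subrr addr0; lra.
  apply: ler_pM; rewrite ?invr_ge0 ?modulus_ge0 ?HB//.
  by rewrite lef_pV2 ?posrE// (lt_le_trans D1).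
rewrite mulrA ltr_pdivrMr//.
have : (V * B + 1) / e < modulus a - rho by lra.
rewrite ltr_pdivrMr//; nra.
Qed.

End ContourFunctional.

(** * Cauchy's formula, homology form *)

Section TaylorTail.
Context (R : realType).
Local Notation C := (R[i]^o).
Implicit Types (F f : C -> C) (a z w : C) (c : nat -> C) (B r : R).

(** The power series with coefficients c n, c (n+1), ..., continued beyond the disc of convergence
    through F. For n = 1 this is the difference quotient of F at a, with the derivative on the
    diagonal. *)
Definition taylor_tail F c a n z : C :=
  if z == a then c n else (F z - \sum_(k < n) c k * (z - a) ^+ k) / (z - a) ^+ n.

Lemma taylor_tail0 F c a B r z : expansion F a c B r -> taylor_tail F c a 0 z = F z.
Proof.
move=> E; rewrite /taylor_tail; case: eqP => [->|_]; first by rewrite (expansion_at E).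
by rewrite big_ord0 subr0 divr1.
Qed.

Lemma taylor_tail_rec F c a n z :
  taylor_tail F c a n z = c n + (z - a) * taylor_tail F c a n.+1 z.
Proof.
rewrite /taylor_tail; case: eqVneq => [->|za]; first by rewrite subrr mul0r addr0.
rewrite big_ord_recr /= exprS; field.
by rewrite subr_eq0 za expf_neq0// subr_eq0.
Qed.

(** Off a the remainders of F divided by (z - a)^n give the constant B / r^n; the factor 2 serves z
    = a at order 0, where the claim is the coefficient bound. *)
Lemma taylor_tail_expansion F c a B r n : expansion F a c B r ->
  expansion (taylor_tail F c a n) a (fun m => c (n + m)%N) (2 * B / r ^+ n) r.
Proof.
move=> E; have ce := expansion_coef E n; case: E => r0 B0 H.
have rn : 0 < r ^+ n by rewrite exprn_gt0.
split=> //; first by rewrite divr_ge0 ?mulr_ge0// ltW.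
move=> z zr N; rewrite /taylor_tail; case: eqVneq => [->|za].
  case: N => [|N]; first by rewrite big_ord0 subr0 expr0 mulr1.
  rewrite big_ord_recl big1 => [|i _]; last by rewrite subrr expr0n mulr0.
  rewrite subrr expr0 mulr1 addn0 addr0 subrr Normc.normc0 mul0r expr0n mulr0.
  exact: lexx.
have zn : 0 < modulus (z - a) by rewrite modulus_gt0 subr_eq0.
rewrite (_ : _ - _ =
    (F z - \sum_(k < n + N) c k * (z - a) ^+ k) / (z - a) ^+ n); last first.
  rewrite big_split_ord /= [in RHS]opprD [in RHS]addrA [in RHS]mulrBl; congr (_ - _).
  rewrite mulr_suml; apply: eq_bigr => k _.
  by rewrite exprD mulrCA [RHS]mulrC mulKf// expf_neq0// subr_eq0.
rewrite Normc.normcM Normc.normcV modulusX ler_pdivrMr ?exprn_gt0//.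
apply: le_trans (H z zr _) _; rewrite exprD expr_div_n.
set x := (_ / r) ^+ N; have x0 : 0 <= x by rewrite exprn_ge0 ?divr_ge0// ltW.
rewrite (_ : 2 * B / r ^+ n * x * modulus (z - a) ^+ n =
  2 * (B * (modulus (z - a) ^+ n / r ^+ n * x))); last by ring.
rewrite ler_peMl ?ler1n// !mulr_ge0// ?exprn_ge0 ?modulus_ge0//.
by rewrite invr_ge0 ltW.
Qed.

Lemma expandable_taylor_tail_continuous D F c a B r n z : expansion F a c B r ->
  expandable F z -> continuous_at_in D (taylor_tail F c a n) z.
Proof.
move=> E Fz; have [->|za] := eqVneq z a.
  apply: expandable_continuous_at_in.
  by exists (fun m => c (n + m)%N), (2 * B / r ^+ n), r; exact: taylor_tail_expansion.
have d0 : 0 < modulus (z - a) by rewrite modulus_gt0 subr_eq0.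
apply: (@eq_continuous_at_in _ _
    (fun z => (F z - \sum_(k < n) c k * (z - a) ^+ k) / (z - a) ^+ n) _ _ _ d0).
  move=> w wz; rewrite /taylor_tail; case: eqVneq => // wa.
  by move: wz; rewrite wa modulusB_sym ltxx.
apply: continuous_at_inM; last exact: continuous_at_in_resolvent.
apply: continuous_at_inB; first exact: expandable_continuous_at_in.
apply: (continuous_at_in_sum (F := fun k x => c k * (x - a) ^+ k)) => k _.
apply: continuous_at_inM.
  exact: continuous_at_in_cst.
apply: continuous_at_inX; apply: continuous_at_inB; last exact: continuous_at_in_cst.
exact: continuous_at_in_id.
Qed.

Lemma sum_half_le (n : nat) : \sum_(k < n) k%:R * (2^-1 : R) ^+ k <= 2.
Proof.
suff -> : \sum_(k < n) k%:R * (2^-1 : R) ^+ k = 2 - (n%:R + 1) * 2 * 2^-1 ^+ n.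
  by rewrite gerBl !mulr_ge0 ?addr_ge0 ?exprn_ge0 ?invr_ge0.
elim: n => [|n IH]; first by rewrite big_ord0 add0r mul1r mulr1 subrr.
by rewrite big_ord_recr /= IH exprS -natr1; field.
Qed.

Lemma modulus_subX_le (x y : C) (s : R) n : modulus x <= s -> modulus y <= s ->
  modulus (x ^+ n - y ^+ n) <= n%:R * s ^+ n.-1 * modulus (x - y).
Proof.
move=> xs ys; have s0 : 0 <= s := le_trans (modulus_ge0 _) xs.
rewrite subrXX Normc.normcM mulrC ler_wpM2r ?modulus_ge0//.
apply: le_trans (modulus_sum _ _ _) _.
rewrite -[n%:R]/(n%:R) mulr_natl -[X in _ *+ X]card_ord -sumr_const.
apply: ler_sum => i _; rewrite Normc.normcM !modulusX.
apply: le_trans (_ : s ^+ (n.-1 - i) * s ^+ i <= _).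
  by apply: ler_pM; rewrite ?exprn_ge0 ?modulus_ge0// lerXn2r ?nnegrE ?modulus_ge0.
by rewrite -exprD subnK// -ltnS (leq_trans (ltn_ord i))// leqSpred.
Qed.

(** On the disc of radius r / 2 the k-th term has Lipschitz constant k (2B / r^k) (r/2)^(k-1) = (4B
    / r) k / 2^k, and the sum of k / 2^k is at most 2. *)
Lemma expansion_lipschitz f a c B r z w : expansion f a c B r ->
  modulus (z - a) <= r / 2 -> modulus (w - a) <= r / 2 ->
  modulus (f z - f w) <= 8 * B / r * modulus (z - w).
Proof.
move=> E zr wr; have ce := expansion_coef E; case: E => r0 B0 H.
apply/ler_addgt0Pr => e e0.
have q0 : (0 : R) <= 2^-1 by rewrite invr_ge0.
have q1 : (2^-1 : R) < 1 by rewrite invf_lt1 ?ltr1n.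
have B1 : 0 < e / (2 * B + 1) by rewrite divr_gt0// ltr_wpDl// mulr_ge0.
have [N /(_ N (leqnn _)) HN] := geometric_small q0 q1 B1.
have rem u : modulus (u - a) <= r / 2 ->
    modulus (f u - \sum_(k < N) c k * (u - a) ^+ k) <= B * 2^-1 ^+ N.
  move=> ur; apply: le_trans (H u _ N) _; first by lra.
  apply: ler_wpM2l => //; apply: lerXn2r; rewrite ?nnegrE ?divr_ge0 ?modulus_ge0 ?(ltW r0)//.
  by rewrite ler_pdivrMr// mulrC.
have r2 : 0 < r / 2 by rewrite divr_gt0.
set Sz := \sum_(k < N) c k * (z - a) ^+ k; set Sw := \sum_(k < N) c k * (w - a) ^+ k.
have SS : modulus (Sz - Sw) <= 8 * B / r * modulus (z - w).
  rewrite -sumrB; apply: le_trans (modulus_sum _ _ _) _.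
  apply: le_trans (_ : \sum_(k < N) (4 * B / r * modulus (z - w)) * (k%:R * 2^-1 ^+ k) <= _).
    apply: ler_sum => k _; rewrite -mulrBr Normc.normcM.
    have := modulus_subX_le k zr wr.
    rewrite (_ : z - a - (w - a) = z - w); last by ring.
    move=> Hk; apply: le_trans (ler_pM (modulus_ge0 _) (modulus_ge0 _) (ce k) Hk) _.
    case: {Hk} (nat_of_ord k) => [|m]; first by rewrite !mul0r !mulr0.
    rewrite le_eqVlt; apply/orP; left; apply/eqP => /=.
    rewrite !exprMn !exprS; field.
    by rewrite ?expf_neq0 ?gt_eqF.
  rewrite -mulr_sumr; apply: le_trans (ler_wpM2l _ (sum_half_le N)) _.
    by rewrite mulr_ge0 ?modulus_ge0// divr_ge0 ?mulr_ge0// ltW.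
  by rewrite le_eqVlt; apply/orP; left; apply/eqP; ring.
rewrite (_ : f z - f w = (f z - Sz) - (f w - Sw) + (Sz - Sw)); last by ring.
apply: le_trans (modulusD _ _) _; rewrite addrC; apply: lerD => //.
apply: le_trans (modulusB _ _) _; apply: le_trans (lerD (rem z zr) (rem w wr)) _.
move: HN; rewrite ltr_pdivlMr ?ltr_wpDl ?mulr_ge0//.
have := exprn_ge0 N q0; nra.
Qed.

(* The difference quotient of [F] between [z] and [w], expanded in powers of
   [w - a]: its Taylor coefficients are the tails of [F] at [a]. *)
Lemma difference_quotient_expand F c a B r z w n : expansion F a c B r -> z != w ->
  (F z - F w) / (z - w) - \sum_(k < n) taylor_tail F c a k.+1 z * (w - a) ^+ k =
  (w - a) ^+ n * ((taylor_tail F c a n z - taylor_tail F c a n w) / (z - w)).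
Proof.
move=> E zw; elim: n => [|n IH].
  by rewrite big_ord0 subr0 expr0 mul1r !(taylor_tail0 _ E).
rewrite big_ord_recr /= opprD addrA IH ![taylor_tail F c a n _]taylor_tail_rec exprS.
by field; rewrite subr_eq0.
Qed.

End TaylorTail.

Arguments expandable_taylor_tail_continuous {R} D {F c a B r} n {z}.

(** * Dixon's argument *)

Section Cauchy.
Context (R : realType).
Local Notation C := (R[i]^o).
Context (Tr : set C) (V : R) (I : (C -> C) -> C).
Hypothesis IP : contour_functional Tr V I.
Let V0 := contour_ge0 IP.
Context (Omega : set C) (F : C -> C).
Hypothesis Omega_open : forall a, Omega a ->
  exists2 d : R, 0 < d & forall z, modulus (z - a) < d -> Omega z.
Hypothesis F_expandable : forall a, Omega a -> expandable F a.
Hypothesis Tr_Omega : forall z, Tr z -> Omega z.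
Hypothesis winding_Omega : forall a, ~ Omega a -> winding I a = 0.
Implicit Types (a z w : C).

Let F_continuous : continuous_in Tr F.
Proof.
move=> z Tz; apply: expandable_continuous_at_in; exact/F_expandable/Tr_Omega.
Qed.

Let tail_continuous a c B r n : expansion F a c B r ->
  continuous_in Tr (taylor_tail F c a n).
Proof.
move=> E z Tz; exact: (expandable_taylor_tail_continuous _ _ E (F_expandable (Tr_Omega Tz))).
Qed.

(** Inside the disc this is the expansion of the tail. For |z - a| >= r, the value of F and the n
    terms subtracted from it are each O(|z - a|^n / r^n), so the tail is O((n + 1) / r^n); n + 1 <=
    2^n is absorbed into the ratio. *)
Let taylor_tail_bound a c B r : expansion F a c B r ->
  exists2 A : R, 0 <= A & forall n z, Tr z \/ modulus (z - a) < r ->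
    modulus (taylor_tail F c a n z) <= A * (2 / r) ^+ n.
Proof.
move=> E; have ce := expansion_coef E; have [r0 B0 H] := E.
have [BF BF0 HBF] := contour_bounded IP F_continuous.
exists (BF + 2 * B); first by rewrite addr_ge0// mulr_ge0.
move=> n z Hz; apply: le_trans (_ : (BF + 2 * B) * (n.+1%:R / r ^+ n) <= _); last first.
  apply: ler_wpM2l; first by rewrite addr_ge0// mulr_ge0.
  rewrite exprMn exprVn ler_pM2r ?invr_gt0 ?exprn_gt0//.
  by rewrite -natrX ler_nat; exact: ltn_expl.
have rn : 0 < r ^+ n by rewrite exprn_gt0.
rewrite mulrA ler_pdivlMr//.
have [zr|rz] := ltP (modulus (z - a)) r.
  have [_ _ HT] := taylor_tail_expansion n E; have := HT z zr 0%N.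
  rewrite big_ord0 subr0 expr0 mulr1 ler_pdivlMr// => /le_trans; apply.
  have n1 : (1 : R) <= n.+1%:R by rewrite ler1n.
  by apply: le_trans (_ : (BF + 2 * B) * 1 <= _); [lra | apply: ler_wpM2l; lra].
have Tz : Tr z by case: Hz => // zr; move: rz; rewrite leNgt zr.
have za : z != a.
  by apply/negP => /eqP za; move: rz; rewrite za subrr Normc.normc0; lra.
have zn : 0 < modulus (z - a) by rewrite modulus_gt0 subr_eq0.
rewrite /taylor_tail (negbTE za) Normc.normcM Normc.normcV modulusX.
rewrite mulrAC ler_pdivrMr ?exprn_gt0//.
have rzn m : r ^+ m <= modulus (z - a) ^+ m by rewrite lerXn2r ?nnegrE ?modulus_ge0 ?(ltW r0).
have S_le : modulus (\sum_(k < n) c k * (z - a) ^+ k) * r ^+ n <=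
    2 * B * n%:R * modulus (z - a) ^+ n.
  apply: le_trans (ler_wpM2r (ltW rn) (modulus_sum _ _ _)) _.
  rewrite mulr_suml; apply: le_trans (_ : \sum_(k < n) 2 * B * modulus (z - a) ^+ n <= _).
    apply: ler_sum => k _; rewrite Normc.normcM modulusX.
    have kn : (k <= n)%N by rewrite ltnW.
    have expE (x : R) : x ^+ n = x ^+ k * x ^+ (n - k) by rewrite -exprD subnKC.
    rewrite !expE.
    apply: le_trans (_ : (2 * B / r ^+ k * modulus (z - a) ^+ k) * (r ^+ k * r ^+ (n - k)) <= _).
      rewrite ler_wpM2r ?mulr_ge0 ?exprn_ge0 ?(ltW r0)//.
      by rewrite ler_wpM2r ?exprn_ge0 ?modulus_ge0.
    rewrite (_ : _ * (r ^+ k * _) = 2 * B * (modulus (z - a) ^+ k * r ^+ (n - k))); last first.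
      by field; rewrite gt_eqF// exprn_gt0.
    rewrite ler_wpM2l ?mulr_ge0//.
    by rewrite ler_wpM2l ?exprn_ge0 ?modulus_ge0.
  by rewrite sumr_const card_ord -mulr_natr; rewrite le_eqVlt; apply/orP; left; apply/eqP; ring.
have F_le : modulus (F z) * r ^+ n <= BF * modulus (z - a) ^+ n.
  by apply: ler_pM; rewrite ?modulus_ge0 ?HBF ?(ltW rn).
apply: le_trans (ler_wpM2r (ltW rn) (modulusB _ _)) _.
rewrite mulrDl; apply: le_trans (lerD F_le S_le) _.
rewrite -mulrDl ler_wpM2r ?exprn_ge0 ?modulus_ge0// -natr1.
have := ler0n R n; nra.
Qed.

Let coef_exists : exists coef : C -> nat -> C,
  forall a, Omega a -> exists B r, expansion F a (coef a) B r.
Proof.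
have /choice[f Hf] : forall a, exists c : nat -> C, Omega a -> exists B r, expansion F a c B r.
  move=> a; have [/F_expandable[c [B [r E]]]|na] := pselect (Omega a).
    by exists c => _; exists B, r.
  by exists (fun=> 0).
by exists f.
Qed.

(* Dixon's proof of the homology form of Cauchy's formula. *)
Lemma cauchy_formula a : Omega a -> ~ Tr a ->
  I (fun z => F z / (z - a)) = F a * winding I a.
Proof.
have [coef coefP] := coef_exists.
pose dq w := taylor_tail F (coef w) w 1.
have dqE w z : Omega w -> z != w -> dq w z = (F z - F w) / (z - w).
  move=> Ow zw; have [B [r /expansion_at E]] := coefP _ Ow.
  by rewrite /dq /taylor_tail (negbTE zw) big_ord1 !expr0 mulr1 -E expr1.
have dq_off w : Omega w -> ~ Tr w ->
    I (dq w) = I (fun z => F z / (z - w)) - F w * winding I w.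
  move=> Ow Tw; rewrite -(contourZ IP); last exact: (resolvent_continuous (n := 1) Tw).
  rewrite -(contourB IP).
  - apply: (contour_ext IP) => z Tz; rewrite dqE ?mulrBl//.
    by apply/negP => /eqP zw; apply: Tw; rewrite -zw.
  - exact: (continuous_inM F_continuous (resolvent_continuous (n := 1) Tw)).
  - apply: continuous_inM; first exact: (@continuous_in_cst _ _ (F w)).
    exact: (resolvent_continuous (n := 1) Tw).
(* Where the winding vanishes the two formulas agree, by [dq_off]. Hence h is entire and tends to 0
   at infinity, so it is 0; on Omega this is the claim. *)
pose h w := if `[< Omega w >] then I (dq w) else I (fun z => F z / (z - w)).
have h_off w : ~ Tr w -> winding I w = 0 -> h w = I (fun z => F z / (z - w)).
  move=> Tw W0; rewrite /h; case: asboolP => // Ow.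
  by rewrite dq_off// W0 mulr0 subr0.
suff h0 : forall w, h w = 0.
  move=> Oa Ta; have := h0 a; rewrite /h; case: asboolP => // _.
  by rewrite dq_off// => /eqP; rewrite subr_eq0 => /eqP.
apply: expandable_vanishing; last first.
  move=> e e0; have [rho1 _ H1] := cauchy_transform_far IP F_continuous e0.
  have [rho2 _ H2] := winding_far IP; exists (Num.max rho1 rho2) => z.
  by rewrite gt_max => /andP[/H1[Tz Hz] /H2 W]; rewrite h_off.
(* Off Omega the winding is 0 near a, so h is locally the Cauchy transform of F. *)
move=> {}a; have [Oa|Oa] := pselect (Omega a); last first.
  have Ta : ~ Tr a by move=> /Tr_Omega.
  have [d d0 Hd] := winding_locally_constant IP Ta.
  have [B [r E]] := cauchy_transform_expandable IP F_continuous Ta.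
  apply: (expandable_near d0 (f := fun b => I (fun z => F z / (z - b)))).
    by move=> z /Hd[Tz Wz]; rewrite h_off// Wz winding_Omega.
  by eexists; exists B, r; exact: E.
have [B [r E]] := coefP _ Oa; set c := coef a in E.
have [A A0 HA] := taylor_tail_bound E.
have [d d0 Hd] := Omega_open Oa; have [r0 B0 _] := E.
have r2 : 0 < 2 / r by rewrite divr_gt0.
(* The first summand bounds the difference quotients of the tails for |z - w| < r / 4, by their
   Lipschitz constant; the second bounds them for |z - w| >= r / 4, by the triangle inequality and
   the size of the tails. *)
pose L := 16 * B / r + 8 * A / r.
have L0 : 0 <= L by rewrite addr_ge0// divr_ge0 ?mulr_ge0 ?(ltW r0).
exists (fun k => I (taylor_tail F c a k.+1)), (V * L), (Num.min d (r / 4) / 2).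
have m0 : 0 < Num.min d (r / 4) by rewrite lt_min d0 divr_gt0.
split; [by rewrite divr_gt0 | exact: mulr_ge0 |] => w wr n.
have [wd wr4] : modulus (w - a) < d /\ modulus (w - a) < r / 4.
  by apply/andP; rewrite -lt_min; lra.
have Ow := Hd _ wd; have [Bw [rw Ew]] := coefP _ Ow.
rewrite {1}/h; case: asboolP => // _.
pose Rm z := dq w z - \sum_(k < n) (w - a) ^+ k * taylor_tail F c a k.+1 z.
have -> : I (dq w) - \sum_(k < n) I (taylor_tail F c a k.+1) * (w - a) ^+ k = I Rm.
  under eq_bigr do rewrite mulrC.
  rewrite -(contour_sum IP (H := fun k => taylor_tail F c a k.+1) (fun k => (w - a) ^+ k)).
    rewrite -(contourB IP (H1 := dq w)
      (H2 := fun z => \sum_(k < n) (w - a) ^+ k * taylor_tail F c a k.+1 z)); first exact: erefl.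
      exact: (@tail_continuous _ _ _ _ 1 Ew).
    move=> z Tz.
    apply: (continuous_at_in_sum (F := fun k x => (w - a) ^+ k * taylor_tail F c a k.+1 x)).
    move=> k _; apply: continuous_at_inM; first exact: continuous_at_in_cst.
    exact: tail_continuous E z Tz.
  by move=> k _; exact: tail_continuous E.
have Rm_continuous D z : Omega z -> continuous_at_in D Rm z.
  move=> Oz; apply: continuous_at_inB.
    exact: (expandable_taylor_tail_continuous _ _ Ew (F_expandable Oz)).
  apply: (continuous_at_in_sum (F := fun k x => (w - a) ^+ k * taylor_tail F c a k.+1 x)).
  move=> k _; apply: continuous_at_inM; first exact: continuous_at_in_cst.
  exact: (expandable_taylor_tail_continuous _ _ E (F_expandable Oz)).
have Rm_bound z : z != w -> Tr z \/ modulus (z - a) < r ->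
    modulus (Rm z) <= L * (modulus (w - a) * (2 / r)) ^+ n.
  move=> zw Hz; rewrite /Rm dqE//.
  under eq_bigr do rewrite mulrC.
  rewrite (difference_quotient_expand _ E zw) Normc.normcM modulusX.
  rewrite exprMn mulrCA; apply: ler_wpM2l; first by rewrite exprn_ge0 ?modulus_ge0.
  have zw0 : 0 < modulus (z - w) by rewrite modulus_gt0 subr_eq0.
  rewrite Normc.normcM Normc.normcV ler_pdivrMr// /L.
  have r2n : 0 <= (2 / r) ^+ n by rewrite exprn_ge0// ltW.
  have [zwr|rzw] := ltP (modulus (z - w)) (r / 4).
    have wr2 : modulus (w - a) <= r / 2 by lra.
    have zr2 : modulus (z - a) <= r / 2 by have := modulus_triangle z a w; lra.
    apply: le_trans (expansion_lipschitz (taylor_tail_expansion n E) zr2 wr2) _.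
    apply: ler_wpM2r; first exact: modulus_ge0.
    apply: le_trans (_ : 16 * B / r * (2 / r) ^+ n <= _); last first.
      by apply: ler_wpM2r => //; rewrite lerDl divr_ge0 ?mulr_ge0 ?(ltW r0).
    rewrite (_ : 8 * (2 * B / r ^+ n) / r = 16 * B / r * (r ^+ n)^-1); last by ring.
    apply: ler_wpM2l; first by rewrite divr_ge0 ?mulr_ge0 ?(ltW r0).
    rewrite exprMn exprVn ler_peMl ?invr_ge0 ?exprn_ge0 ?(ltW r0)//.
    by rewrite exprn_ege1// ler1n.
  have wT : modulus (w - a) < r by lra.
  apply: le_trans (modulusB _ _) _.
  apply: le_trans (lerD (HA n z Hz) (HA n w (or_intror wT))) _.
  apply: le_trans (_ : 8 * A / r * (2 / r) ^+ n * (r / 4) <= _).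
    by rewrite le_eqVlt; apply/orP; left; apply/eqP; field; rewrite gt_eqF.
  apply: ler_pM => //; first by rewrite !mulr_ge0 ?invr_ge0 ?(ltW r0).
    by rewrite divr_ge0 ?(ltW r0).
  by apply: ler_wpM2r => //; rewrite lerDr divr_ge0 ?mulr_ge0 ?(ltW r0).
rewrite -mulrA.
apply: le_trans (_ : V * (L * (modulus (w - a) * (2 / r)) ^+ n) <= _); last first.
  apply: ler_wpM2l => //; apply: ler_wpM2l => //.
  have m2 : 0 <= Num.min d (r / 4) / 2 by rewrite divr_ge0 ?(ltW m0).
  apply: lerXn2r; rewrite ?nnegrE ?mulr_ge0 ?invr_ge0 ?modulus_ge0 ?(ltW r0)//.
  apply: ler_wpM2l; first exact: modulus_ge0.
  rewrite -[2 / r]invf_div lef_pV2 ?posrE ?divr_gt0//.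
  by rewrite ler_pM2r ?invr_gt0// ge_min; apply/orP; right; lra.
have W0 : 0 <= L * (modulus (w - a) * (2 / r)) ^+ n.
  by rewrite mulr_ge0 ?exprn_ge0 ?mulr_ge0 ?modulus_ge0 ?invr_ge0 ?(ltW r0).
apply: (contour_bound IP); first by move=> z Tz; exact: (Rm_continuous _ _ (Tr_Omega Tz)).
  exact: W0.
move=> z Tz; have [->|zw] := eqVneq z w; last by apply: Rm_bound => //; left.
(* at [z = w] the bound follows by continuity *)
apply/ler_addgt0Pr => e e0.
have /continuous_at_inP/(_ _ e0)[d1 d10 H1] := Rm_continuous setT w Ow.
pose s := Num.min d1 (r / 4) / 2.
have s0 : 0 < s by rewrite divr_gt0// lt_min d10 divr_gt0.
have [s1 s2] : s < d1 /\ s < r / 4.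
  apply/andP; rewrite -lt_min /s ltr_pdivrMr// ltr_pMr ?ltr1n//.
  by rewrite lt_min d10 divr_gt0.
have sE : modulus (w + s%:C - w) = s by rewrite addrAC subrr add0r modulus_real gtr0_norm.
have := H1 (w + s%:C) Logic.I; rewrite sE => /(_ s1) Hs.
have sw : w + s%:C != w by rewrite -subr_eq0 -modulus_gt0 sE.
have sr : modulus (w + s%:C - a) < r.
  apply: le_lt_trans (modulus_triangle _ _ w) _; rewrite sE; lra.
have Hb := Rm_bound _ sw (or_intror sr).
have Ht : modulus (Rm w) <= modulus (Rm (w + s%:C)) + modulus (Rm (w + s%:C) - Rm w).
  by have := modulusB (Rm (w + s%:C)) (Rm (w + s%:C) - Rm w); rewrite opprB addrC subrK.
by apply: le_trans Ht (lerD Hb (ltW Hs)).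
Qed.

End Cauchy.

(** * Calculus along curves *)

Section CurveDerivative.
Context (R : realType).
Local Notation C := R[i].
Implicit Types (u v : R -> C) (t : R) (l k : C).

Lemma ReD (z w : C) : complex.Re (z + w) = complex.Re z + complex.Re w.
Proof. by case: z w => [? ?] [? ?]. Qed.

Lemma ImD (z w : C) : complex.Im (z + w) = complex.Im z + complex.Im w.
Proof. by case: z w => [? ?] [? ?]. Qed.

Lemma ReB (z w : C) : complex.Re (z - w) = complex.Re z - complex.Re w.
Proof. by case: z w => [? ?] [? ?]. Qed.

Lemma ImB (z w : C) : complex.Im (z - w) = complex.Im z - complex.Im w.
Proof. by case: z w => [? ?] [? ?]. Qed.

Lemma ReM (z w : C) :
  complex.Re (z * w) = complex.Re z * complex.Re w - complex.Im z * complex.Im w.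
Proof. by case: z w => [? ?] [? ?]. Qed.

Lemma ImM (z w : C) :
  complex.Im (z * w) = complex.Re z * complex.Im w + complex.Im z * complex.Re w.
Proof. by case: z w => [? ?] [? ?]. Qed.

Definition is_cderive u t l : Prop :=
  is_derive t (1 : R) (fun s => complex.Re (u s)) (complex.Re l) /\
  is_derive t (1 : R) (fun s => complex.Im (u s)) (complex.Im l).

Lemma is_cderiveE u t l : is_cderive u t l -> cderive u t = l.
Proof.
by case: l => a b [H1 H2]; rewrite /cderive !derive1E !derive_val.
Qed.

Lemma is_cderive_cst (b : C) t : is_cderive (fun=> b) t 0.
Proof. by split; exact: is_derive_cst. Qed.

Lemma is_cderive_real (phi : R -> R) t (a : R) : is_derive t (1 : R) phi a ->
  is_cderive (fun s => (phi s)%:C) t a%:C.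
Proof. by split => //=; exact: is_derive_cst. Qed.

Lemma is_cderiveD u v t l k : is_cderive u t l -> is_cderive v t k ->
  is_cderive (fun s => u s + v s) t (l + k).
Proof.
move=> [u1 u2] [v1 v2]; split.
- rewrite (_ : (fun s => complex.Re (u s + v s)) =
    (fun s => complex.Re (u s)) + (fun s => complex.Re (v s))).
    by rewrite ReD; exact: is_deriveD.
  by apply/funext => s; rewrite ReD.
- rewrite (_ : (fun s => complex.Im (u s + v s)) =
    (fun s => complex.Im (u s)) + (fun s => complex.Im (v s))).
    by rewrite ImD; exact: is_deriveD.
  by apply/funext => s; rewrite ImD.
Qed.

Lemma is_cderiveM u v t l k : is_cderive u t l -> is_cderive v t k ->
  is_cderive (fun s => u s * v s) t (u t * k + v t * l).
Proof.
move=> [u1 u2] [v1 v2]; split.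
- rewrite (_ : (fun s => complex.Re (u s * v s)) =
    (fun s => complex.Re (u s)) * (fun s => complex.Re (v s)) -
    (fun s => complex.Im (u s)) * (fun s => complex.Im (v s))); last first.
    by apply/funext => s; rewrite ReM.
  apply: (is_derive_eq (is_deriveB (is_deriveM u1 v1) (is_deriveM u2 v2))); rewrite /GRing.scale /=.
  by case: (u t) (v t) l k {u1 u2 v1 v2} => [? ?] [? ?] [? ?] [? ?] /=; ring.
- rewrite (_ : (fun s => complex.Im (u s * v s)) =
    (fun s => complex.Re (u s)) * (fun s => complex.Im (v s)) +
    (fun s => complex.Im (u s)) * (fun s => complex.Re (v s))); last first.
    by apply/funext => s; rewrite ImM.
  apply: (is_derive_eq (is_deriveD (is_deriveM u1 v2) (is_deriveM u2 v1))); rewrite /GRing.scale /=.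
  by case: (u t) (v t) l k {u1 u2 v1 v2} => [? ?] [? ?] [? ?] [? ?] /=; ring.
Qed.

Lemma is_cderiveZ (a : C) u t l : is_cderive u t l ->
  is_cderive (fun s => a * u s) t (a * l).
Proof. by move=> ul; have := is_cderiveM (is_cderive_cst a t) ul; rewrite mulr0 addr0. Qed.

Lemma is_cderiveN u t l : is_cderive u t l -> is_cderive (fun s => - u s) t (- l).
Proof.
by move=> /(is_cderiveZ (- 1)); rewrite mulN1r; under eq_fun do rewrite mulN1r.
Qed.

Lemma is_cderiveB u v t l k : is_cderive u t l -> is_cderive v t k ->
  is_cderive (fun s => u s - v s) t (l - k).
Proof. by move=> ul /is_cderiveN; exact: is_cderiveD. Qed.

Lemma is_cderiveX u t l n : is_cderive u t l ->
  is_cderive (fun s => u s ^+ n) t (n%:R * u t ^+ n.-1 * l).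
Proof.
move=> ul; elim: n => [|n IH].
  by rewrite !mul0r; under eq_fun do rewrite expr0; exact: is_cderive_cst.
under eq_fun do rewrite exprS.
have := is_cderiveM ul IH; congr is_cderive.
case: n {IH} => [|n]; first by rewrite /= mulr0n !mul0r mulr0 add0r expr0 mulr1n !mul1r.
by rewrite -natr1 !exprS /=; ring.
Qed.

(** The inverse is the conjugate times the inverse of the squared modulus q, a real function, so
    real calculus applies. *)
Lemma is_cderiveV u t l : u t != 0 -> is_cderive u t l ->
  is_cderive (fun s => (u s)^-1) t (- l / u t ^+ 2).
Proof.
move=> ut [u1 u2].
pose q s : R := complex.Re (u s) ^+ 2 + complex.Im (u s) ^+ 2.
have qE s : q s = complex.Re (u s) * complex.Re (u s) + complex.Im (u s) * complex.Im (u s).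
  by rewrite /q !expr2.
have qt : q t != 0.
  apply: contra ut; rewrite /q; case: (u t) => a b /=.
  by rewrite paddr_eq0 ?sqr_ge0// !sqrf_eq0 eq_complex.
have qd : is_derive t (1 : R) (fun s => (q s)^-1) (- (q t) ^- 2 *
   (2 * (complex.Re (u t) * complex.Re l + complex.Im (u t) * complex.Im l))).
  have qd : is_derive t (1 : R) q (complex.Re (u t) * complex.Re l + complex.Re (u t) * complex.Re l +
      (complex.Im (u t) * complex.Im l + complex.Im (u t) * complex.Im l)).
    rewrite (_ : q = (fun s => complex.Re (u s)) * (fun s => complex.Re (u s)) +
       (fun s => complex.Im (u s)) * (fun s => complex.Im (u s))); last first.
      by apply/funext => s; rewrite qE.
    exact: (is_deriveD (is_deriveM u1 u1) (is_deriveM u2 u2)).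
  by apply: (is_derive_eq (is_deriveV qt qd)); rewrite /GRing.scale /=; ring.
have -> : (fun s => (u s)^-1) = (fun s => (complex.Re (u s) -i* complex.Im (u s)) * (q s)^-1%:C).
  apply/funext => s; rewrite /q; case: (u s) => a b /=; rewrite /GRing.inv /= /ComplexField.invc.
  by simpc.
have cd : is_cderive (fun s => complex.Re (u s) -i* complex.Im (u s)) t
    (complex.Re l -i* complex.Im l).
  by split => //=; exact: is_deriveN.
have := is_cderiveM cd (is_cderive_real qd); congr is_cderive.
move: qt ut; rewrite /q {q qE qd cd u1 u2}; case: (u t) l => a b [c d] /= qt ut.
have invE (x y : R) : (x +i* y)^-1 = (x / (x ^+ 2 + y ^+ 2)) -i* (y / (x ^+ 2 + y ^+ 2)) by [].
have -> : (a +i* b) ^+ 2 = (a ^+ 2 - b ^+ 2) +i* (2 * a * b).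
  by apply/eqP; rewrite eq_complex /=; apply/andP; split; apply/eqP; ring.
rewrite invE (_ : (a ^+ 2 - b ^+ 2) ^+ 2 + (2 * a * b) ^+ 2 = (a ^+ 2 + b ^+ 2) ^+ 2); last by ring.
by apply/eqP; rewrite eq_complex /=; apply/andP; split; apply/eqP; field.
Qed.

End CurveDerivative.

(** * Integrals of complex functions over an interval *)

Section IntervalIntegral.
Context (R : realType).
Local Notation C := R[i].
Local Notation mu := (@lebesgue_measure R).
Implicit Types (phi psi : R -> C) (a b c t : R).

Definition cint a b phi : C :=
  (\int[mu]_(t in `[a, b]) complex.Re (phi t))%R +i*
  (\int[mu]_(t in `[a, b]) complex.Im (phi t))%R.

(** Weaker than continuity: the derivative of a piecewise C^1 curve may jump at a break point, and
    [cderive] need not be meaningful there. *)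
Definition bmeasurable a b phi : Prop :=
  [/\ measurable_fun `[a, b] (fun t => complex.Re (phi t)),
      measurable_fun `[a, b] (fun t => complex.Im (phi t)) &
      exists2 B : R, 0 <= B & forall t, t \in `[a, b] -> modulus (phi t) <= B].

Definition continuous_on a b phi : Prop :=
  forall t, t \in `[a, b] -> forall e : R, 0 < e -> exists2 d : R, 0 < d &
    forall s, s \in `[a, b] -> `|s - t| < d -> modulus (phi s - phi t) < e.

Let bounded_integrable a b (f : R -> R) (B : R) : measurable_fun `[a, b] f ->
  (forall t, t \in `[a, b] -> `|f t| <= B) -> mu.-integrable `[a, b] (EFin \o f).
Proof.
move=> mf fB; apply: measurable_bounded_integrable => //.
  by rewrite /= lebesgue_measure_itv /=; case: ifP => // _; rewrite -EFinB ltry.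
exists B; split; first exact: num_real.
by move=> x Bx t /= /fB/le_trans; apply; exact: ltW.
Qed.

Lemma bmeasurable_Re a b phi : bmeasurable a b phi ->
  mu.-integrable `[a, b] (EFin \o (fun t => complex.Re (phi t))).
Proof.
move=> [mR _ [B _ HB]]; apply: (bounded_integrable (B := B)) => // t tab.
exact: le_trans (normr_Re_le _) (HB t tab).
Qed.

Lemma bmeasurable_Im a b phi : bmeasurable a b phi ->
  mu.-integrable `[a, b] (EFin \o (fun t => complex.Im (phi t))).
Proof.
move=> [_ mI [B _ HB]]; apply: (bounded_integrable (B := B)) => // t tab.
exact: le_trans (normr_Im_le _) (HB t tab).
Qed.

Lemma bmeasurable_linear a b (k : C) phi psi : bmeasurable a b phi ->
  bmeasurable a b psi -> bmeasurable a b (fun t => k * phi t + psi t).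
Proof.
move=> [r1 i1 [B1 B10 H1]] [r2 i2 [B2 B20 H2]]; split.
- rewrite (_ : (fun t => _) = (fun t => complex.Re k * complex.Re (phi t) -
    complex.Im k * complex.Im (phi t) + complex.Re (psi t))); last first.
    by apply/funext => t; rewrite ReD ReM.
  apply: measurable_funD => //; apply: measurable_funB.
    by apply: measurable_funM => //; exact: measurable_cst.
  by apply: measurable_funM => //; exact: measurable_cst.
- rewrite (_ : (fun t => _) = (fun t => complex.Re k * complex.Im (phi t) +
    complex.Im k * complex.Re (phi t) + complex.Im (psi t))); last first.
    by apply/funext => t; rewrite ImD ImM.
  apply: measurable_funD => //; apply: measurable_funD.
    by apply: measurable_funM => //; exact: measurable_cst.
  by apply: measurable_funM => //; exact: measurable_cst.
- exists (modulus k * B1 + B2); first by rewrite addr_ge0 ?mulr_ge0 ?modulus_ge0.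
  move=> t tab; apply: le_trans (modulusD _ _) _; rewrite Normc.normcM.
  by apply: lerD; [apply: ler_wpM2l; [exact: modulus_ge0|exact: H1]|exact: H2].
Qed.

Lemma cint_linear a b (k : C) phi psi : bmeasurable a b phi -> bmeasurable a b psi ->
  cint a b (fun t => k * phi t + psi t) = k * cint a b phi + cint a b psi.
Proof.
move=> m1 m2.
have mab : measurable (`[a, b] : set (measurableTypeR R)) by exact: measurable_itv.
have [R1 I1] := (bmeasurable_Re m1, bmeasurable_Im m1).
have [R2 I2] := (bmeasurable_Re m2, bmeasurable_Im m2).
have intZ (x : R) (f : R -> R) : mu.-integrable `[a, b] (EFin \o f) ->
    mu.-integrable `[a, b] (EFin \o (fun t => x * f t)).
  by move=> fi; apply: eq_integrable (integrableZl mab x fi).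
apply/eqP; rewrite eq_complex; apply/andP; split; apply/eqP.
- rewrite ReD ReM /= -!RintegralZl// -RintegralB//; [|exact: intZ..].
  rewrite -RintegralD//; last first.
    by apply: eq_integrable (integrableB mab (intZ _ _ R1) (intZ _ _ I1)).
  by apply: eq_Rintegral => t _; rewrite ReD ReM.
- rewrite ImD ImM /= -!RintegralZl// -RintegralD//; [|exact: intZ..].
  rewrite -RintegralD//; last first.
    by apply: eq_integrable (integrableD mab (intZ _ _ I1) (intZ _ _ R1)).
  by apply: eq_Rintegral => t _; rewrite ImD ImM.
Qed.

Let Rintegral_le a b (f : R -> R) (B : R) : a <= b -> measurable_fun `[a, b] f ->
  (forall t, t \in `[a, b] -> `|f t| <= B) ->
  `|\int[mu]_(t in `[a, b]) f t| <= B * (b - a).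
Proof.
move=> ab mf fB; have fi := bounded_integrable mf fB.
have mab : measurable (`[a, b] : set (measurableTypeR R)) by exact: measurable_itv.
apply: le_trans (le_normr_Rintegral mab fi) _.
apply: le_trans (_ : \int[mu]_(t in `[a, b]) (cst B t) <= _); last first.
  rewrite Rintegral_cst//= lebesgue_measure_itv /=.
  by move: ab; rewrite le_eqVlt => /orP[/eqP ->|ab]; rewrite lte_fin ?ltxx ?subrr// ab.
apply: le_Rintegral => //; first exact: integrable_norm.
apply: (bounded_integrable (B := `|B|)) => //; exact: measurable_cst.
Qed.

(** The factor 2 comes from bounding the real and imaginary parts separately. *)
Lemma cint_le a b phi (B : R) : a <= b -> bmeasurable a b phi ->
  (forall t, t \in `[a, b] -> modulus (phi t) <= B) ->
  modulus (cint a b phi) <= 2 * (B * (b - a)).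
Proof.
move=> ab [mR mI _] H; apply: le_trans (modulus_le_ReIm _) _ => /=.
rewrite mulr_natl mulr2n; apply: lerD; apply: Rintegral_le => // t /H; apply: le_trans.
- exact: normr_Re_le.
- exact: normr_Im_le.
Qed.

Let itv_cat a b c : a <= b -> b <= c ->
  [set` `[a, c]] = [set` `[a, b]] `|` [set` `[b, c]] :> set R.
Proof.
move=> ab bc; apply/seteqP; split=> t /=; rewrite !in_itv /=.
  by move=> /andP[at_ tc]; have [tb|bt] := leP t b; [left; rewrite at_|right; rewrite tc ltW].
by case=> /andP[h1 h2]; apply/andP; split; [|exact: le_trans bc|exact: le_trans h1|].
Qed.

Lemma bmeasurable_cat a b c phi : a <= b -> b <= c -> bmeasurable a b phi ->
  bmeasurable b c phi -> bmeasurable a c phi.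
Proof.
move=> ab bc [r1 i1 [B1 B10 H1]] [r2 i2 [B2 B20 H2]].
split; rewrite ?(itv_cat ab bc); try by apply/measurable_funU.
exists (B1 + B2); first exact: addr_ge0.
move=> t tac; have : [set` `[a, c]] t by [].
by rewrite (itv_cat ab bc) => -[/H1|/H2]; lra.
Qed.

Lemma cint_cat a b c phi : a <= b -> b <= c -> bmeasurable a b phi ->
  bmeasurable b c phi -> cint a c phi = cint a b phi + cint b c phi.
Proof.
move=> ab bc m1 m2; have m := bmeasurable_cat ab bc m1 m2.
have key (f : R -> R) : mu.-integrable `[a, c] (EFin \o f) ->
    mu.-integrable `[b, c] (EFin \o f) ->
    \int[mu]_(t in `[a, c]) f t =
    \int[mu]_(t in `[a, b]) f t + \int[mu]_(t in `[b, c]) f t.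
  move=> fi fbc; have := Rintegral_itvB fi (x := b) ab bc.
  rewrite Rintegral_itv_obnd_cbnd; first by move=> <-; rewrite addrC subrK.
  apply: integrableS fbc => //; exact: subset_itv_oc_cc.
apply/eqP; rewrite eq_complex; apply/andP; split; apply/eqP => /=; apply: key.
- exact: bmeasurable_Re m.
- exact: bmeasurable_Re m2.
- exact: bmeasurable_Im m.
- exact: bmeasurable_Im m2.
Qed.

(** Equality is asked only inside, since at a break point the integrands of the curve and of its
    smooth piece may differ; the values at the two end points are added to the bound. *)
Lemma eq_bmeasurable a b phi psi : (forall t, t \in `]a, b[ -> phi t = psi t) ->
  bmeasurable a b psi -> bmeasurable a b phi.
Proof.
move=> E [mR mI [B B0 HB]].
have S : [set` `]a, b[] `<=` [set` `[a, b]] by exact: subset_itv_oo_cc.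
split.
- apply: (@measurable_fun_itv_cc _ a b false true).
  apply: (eq_measurable_fun (fun t => complex.Re (psi t))).
    by move=> t /set_mem/= tab; rewrite E.
  exact: measurable_funS mR.
- apply: (@measurable_fun_itv_cc _ a b false true).
  apply: (eq_measurable_fun (fun t => complex.Im (psi t))).
    by move=> t /set_mem/= tab; rewrite E.
  exact: measurable_funS mI.
- exists (B + modulus (phi a) + modulus (phi b)); first by rewrite !addr_ge0 ?modulus_ge0.
  move=> t tab; have := modulus_ge0 (phi a); have := modulus_ge0 (phi b).
  have [->|ta] := eqVneq t a; first by lra.
  have [->|tb] := eqVneq t b; first by lra.
  have : t \in `]a, b[.
    move: tab; rewrite !in_itv /= => /andP[h1 h2].
    by rewrite !lt_neqAle h1 h2 eq_sym ta tb.
  by move=> /[dup] /E -> /S /HB; lra.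
Qed.

Lemma eq_cint a b phi psi : (forall t, t \in `]a, b[ -> phi t = psi t) ->
  bmeasurable a b psi -> cint a b phi = cint a b psi.
Proof.
move=> E m; have m' := eq_bmeasurable E m.
have S : [set` `]a, b[] `<=` [set` `[a, b]] by exact: subset_itv_oo_cc.
have key (f g : R -> R) : (forall t, t \in `]a, b[ -> f t = g t) ->
    measurable_fun `[a, b] f -> measurable_fun `[a, b] g ->
    \int[mu]_(t in `[a, b]) f t = \int[mu]_(t in `[a, b]) g t.
  move=> fg mf mg; rewrite /Rintegral [in LHS]integral_itv_bndoo; last first.
    by apply/measurable_EFinP; exact: measurable_funS mf.
  rewrite [in RHS]integral_itv_bndoo; last first.
    by apply/measurable_EFinP; exact: measurable_funS mg.
  by congr fine; apply: eq_integral => t /set_mem /= /fg ->.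
case: m m' => [mR mI _] [mR' mI' _].
by apply/eqP; rewrite eq_complex; apply/andP; split; apply/eqP => /=; apply: key => // t /E ->.
Qed.

Lemma continuous_on_within a b phi (f : C -> R) :
  (forall z w, `|f z - f w| <= modulus (z - w)) -> continuous_on a b phi ->
  {within `[a, b], continuous (fun t => f (phi t))}.
Proof.
move=> H pc; apply/subspace_continuousP => t /= tab; apply/cvgrPdist_lt => e e0.
have [d d0 Hd] := pc t tab e e0.
apply/nbhs_ballP; exists d => //= s st sab.
apply: le_lt_trans (H _ _) _; rewrite modulusB_sym; apply: Hd => //.
by move: st; rewrite -ball_normE /= distrC.
Qed.

Lemma lipschitz_Re (z w : C) : `|complex.Re z - complex.Re w| <= modulus (z - w).
Proof. by rewrite -ReB; exact: normr_Re_le. Qed.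

Lemma lipschitz_Im (z w : C) : `|complex.Im z - complex.Im w| <= modulus (z - w).
Proof. by rewrite -ImB; exact: normr_Im_le. Qed.

Lemma lipschitz_modulus (z w : C) : `|modulus z - modulus w| <= modulus (z - w).
Proof.
have h1 : modulus z <= modulus (z - w) + modulus w.
  by apply: le_trans (modulusD _ _); rewrite subrK.
have h2 : modulus w <= modulus (z - w) + modulus z.
  by rewrite modulusB_sym; apply: le_trans (modulusD _ _); rewrite subrK.
by rewrite ler_norml; apply/andP; split; lra.
Qed.

Lemma continuous_on_bmeasurable a b phi : a <= b -> continuous_on a b phi ->
  bmeasurable a b phi.
Proof.
move=> ab pc; have mab : measurable (`[a, b] : set (measurableTypeR R)) by exact: measurable_itv.
split.
- apply: subspace_continuous_measurable_fun => //.
  exact: continuous_on_within lipschitz_Re pc.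
- apply: subspace_continuous_measurable_fun => //.
  exact: continuous_on_within lipschitz_Im pc.
- have [t0 _ H] := EVT_max ab (continuous_on_within lipschitz_modulus pc).
  by exists (modulus (phi t0)); [exact: modulus_ge0|].
Qed.

Lemma is_cderive_continuous (u : R -> C) t l : is_cderive u t l ->
  forall e : R, 0 < e -> exists2 d : R, 0 < d &
    forall s, `|s - t| < d -> modulus (u s - u t) < e.
Proof.
move=> [[u1 _] [u2 _]] e e0; have e2 : 0 < e / 2 by rewrite divr_gt0.
have /derivable1_diffP/differentiable_continuous/cvgrPdist_lt/(_ _ e2)/nbhs_ballP[d1 d10 H1] := u1.
have /derivable1_diffP/differentiable_continuous/cvgrPdist_lt/(_ _ e2)/nbhs_ballP[d2 d20 H2] := u2.
exists (Num.min d1 d2); first by rewrite lt_min; apply/andP; split.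
move=> s; rewrite lt_min => /andP[s1 s2].
apply: le_lt_trans (modulus_le_ReIm _) _; rewrite ReB ImB.
have := H1 s; have := H2 s; rewrite -!ball_normE /= (distrC t s) => /(_ s2) h2 /(_ s1) h1.
rewrite [X in X + _ < _]distrC [X in _ + X < _]distrC; move: h1 h2 => /=.
set x := `| _ |; set y := `| _ |; lra.
Qed.

Lemma cint_FTC a b (U phi : R -> C) : a < b ->
  (forall t, t \in `[a, b] -> is_cderive U t (phi t)) -> continuous_on a b phi ->
  cint a b phi = U b - U a.
Proof.
move=> ab dU pc.
have S : [set` `]a, b[] `<=` [set` `[a, b]] by exact: subset_itv_oo_cc.
have aab : a \in `[a, b] by rewrite in_itv /= lexx ltW.
have bab : b \in `[a, b] by rewrite in_itv /= lexx ltW.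
have key (f V : R -> R) : {within `[a, b], continuous f} ->
    (forall t, t \in `[a, b] -> is_derive t (1 : R) V (f t)) ->
    \int[mu]_(t in `[a, b]) f t = V b - V a.
  move=> fc dV; rewrite /Rintegral (continuous_FTC2 ab fc (F := V))//.
    split.
    - by move=> t /S /dV [].
    - apply: cvg_at_right_filter; apply: differentiable_continuous.
      by apply/derivable1_diffP; case: (dV a aab).
    - apply: cvg_at_left_filter; apply: differentiable_continuous.
      by apply/derivable1_diffP; case: (dV b bab).
  by move=> t /S /dV ?; rewrite derive1E derive_val.
apply/eqP; rewrite eq_complex; apply/andP; split; apply/eqP.
- rewrite ReB; apply: (key _ (fun t => complex.Re (U t))).
    exact: continuous_on_within lipschitz_Re pc.
  by move=> t /dU[].
- rewrite ImB; apply: (key _ (fun t => complex.Im (U t))).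
    exact: continuous_on_within lipschitz_Im pc.
  by move=> t /dU[].
Qed.

End IntervalIntegral.

(** * Piecewise C^1 curves and quadrature along them *)

Section Contour.
Context (R : realType).
Local Notation C := (R[i]^o).
Implicit Types (a b c s t : R) (H F : C -> C) (h : R -> R[i]).

Lemma C1_is_cderive h t : C1 h -> is_cderive h t (cderive h t).
Proof.
move=> [d1 d2 _]; split; rewrite /cderive /= derive1E.
- exact: derivableP (d1 t).
- exact: derivableP (d2 t).
Qed.

Lemma continuous_onM a b (phi psi : R -> R[i]) : continuous_on a b phi ->
  continuous_on a b psi -> continuous_on a b (fun t => phi t * psi t).
Proof.
move=> c1 c2 t tab e e0.
pose p := modulus (phi t) + 1; pose q := modulus (psi t) + 1.
have p0 : 0 < p by rewrite ltr_wpDl ?modulus_ge0.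
have q0 : 0 < q by rewrite ltr_wpDl ?modulus_ge0.
have e1 : 0 < e / (2 * q) by rewrite divr_gt0 ?mulr_gt0.
have e2 : 0 < Num.min 1 (e / (2 * p)) by rewrite lt_min ltr01 divr_gt0 ?mulr_gt0.
have [d1 d10 H1] := c1 t tab _ e1; have [d2 d20 H2] := c2 t tab _ e2.
exists (Num.min d1 d2); first by rewrite lt_min; apply/andP; split.
move=> s sab; rewrite lt_min => /andP[s1 s2].
have h1 := H1 s sab s1; have := H2 s sab s2; rewrite lt_min => /andP[h2 h3].
rewrite (_ : _ - _ = (phi s - phi t) * psi s + phi t * (psi s - psi t)); last by ring.
apply: le_lt_trans (modulusD _ _) _; rewrite !Normc.normcM.
have ps : modulus (psi s) <= q.
  by have := modulusD (psi s - psi t) (psi t); rewrite subrK /q; lra.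
move: h1 h3; rewrite !ltr_pdivlMr ?mulr_gt0// => h1 h3.
have := modulus_ge0 (phi s - phi t); have := modulus_ge0 (psi s - psi t).
have := modulus_ge0 (psi s); have := modulus_ge0 (phi t).
rewrite /p in h3 p0 *; nra.
Qed.

Context (gamma : R -> C).
Local Notation Tr := (trace_curve gamma).

Definition arc_integral a b H : C := cint a b (fun t => H (gamma t) * cderive gamma t).

(* Integration of [F * H] along the arc is approximated by finite weighted
   sums of values of [H], uniformly in the Lipschitz constant of [H]. *)
Definition quadrature F a b (e : R) : Prop :=
  exists2 ws : seq (C * C), (forall p, p \in ws -> Tr p.2) &
    forall H (L : R), continuous_in Tr H -> 0 <= L ->
      (forall z w, Tr z -> Tr w -> modulus (H z - H w) <= L * modulus (z - w)) ->
      modulus (arc_integral a b (fun z => F z * H z) - \sum_(p <- ws) p.1 * H p.2) <= e * L.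

(** Each property is stable under concatenation, so it suffices to establish them for one C^1 piece.
    A primitive is described by the chain rule along differentiable paths, in place of a complex
    derivative. *)
Record arc a b : Prop := Arc {
  arc_bmeasurable : forall H, continuous_in Tr H ->
    bmeasurable a b (fun t => H (gamma t) * cderive gamma t) ;
  arc_le : exists2 V : R, 0 <= V & forall H (B : R), continuous_in Tr H -> 0 <= B ->
    (forall z, Tr z -> modulus (H z) <= B) -> modulus (arc_integral a b H) <= V * B ;
  arc_bounded : forall H, continuous_in Tr H -> exists2 B : R, 0 <= B &
    forall t, t \in `[a, b] -> modulus (H (gamma t)) <= B ;
  arc_primitive : forall Psi H, continuous_in Tr H ->
    (forall (u : R -> R[i]) t l, Tr (u t) -> is_cderive u t l ->
      is_cderive (fun s => Psi (u s)) t (H (u t) * l)) ->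
    arc_integral a b H = Psi (gamma b) - Psi (gamma a) ;
  arc_quadrature : forall F (e : R), continuous_in Tr F -> 0 < e -> quadrature F a b e }.

Lemma quadrature_cat F a b c (e1 e2 : R) : continuous_in Tr F -> a <= b -> b <= c ->
  (forall H, continuous_in Tr H ->
    bmeasurable a b (fun t => H (gamma t) * cderive gamma t)) ->
  (forall H, continuous_in Tr H ->
    bmeasurable b c (fun t => H (gamma t) * cderive gamma t)) ->
  quadrature F a b e1 -> quadrature F b c e2 -> quadrature F a c (e1 + e2).
Proof.
move=> Fc ab bc m1 m2 [ws1 T1 H1] [ws2 T2 H2]; exists (ws1 ++ ws2).
  by move=> p; rewrite mem_cat => /orP[/T1|/T2].
move=> H L Hc L0 HL; rewrite big_cat /=.
have FH : continuous_in Tr (fun z => F z * H z) by exact: continuous_inM.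
rewrite /arc_integral (cint_cat ab bc (m1 _ FH) (m2 _ FH)) opprD addrACA mulrDl.
apply: le_trans (modulusD _ _) _; apply: lerD; [exact: H1 | exact: H2].
Qed.

Lemma arc_cat a b c : a <= b -> b <= c -> arc a b -> arc b c -> arc a c.
Proof.
move=> ab bc [m1 [V1 V10 l1] b1 p1 q1] [m2 [V2 V20 l2] b2 p2 q2].
have cat H : continuous_in Tr H ->
    arc_integral a c H = arc_integral a b H + arc_integral b c H.
  by move=> Hc; apply: cint_cat => //; [exact: m1|exact: m2].
split.
- by move=> H Hc; apply: (bmeasurable_cat ab bc); [exact: m1|exact: m2].
- exists (V1 + V2); first exact: addr_ge0.
  move=> H B Hc B0 HB; rewrite cat// mulrDl; apply: le_trans (modulusD _ _) _.
  by apply: lerD; [exact: l1|exact: l2].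
- move=> H Hc; have [B1 B10 H1] := b1 H Hc; have [B2 B20 H2] := b2 H Hc.
  exists (B1 + B2); first exact: addr_ge0.
  move=> t; rewrite in_itv /= => /andP[at_ tc]; have [tb|bt] := leP t b.
    by apply: le_trans (H1 _ _) _; [rewrite in_itv /= at_|rewrite lerDl].
  by apply: le_trans (H2 _ _) _; [rewrite in_itv /= (ltW bt)|rewrite lerDr].
- move=> Psi H Hc HPsi; rewrite cat// (p1 Psi)// (p2 Psi)//; ring.
- move=> F e Fc e0; rewrite [e]splitr.
  by apply: (quadrature_cat Fc ab bc) => //; [apply: q1|apply: q2]; rewrite ?divr_gt0.
Qed.

Section Piece.
Context (h : R -> R[i]) (h1 : C1 h).

Let hd t : is_cderive h t (cderive h t). Proof. exact: C1_is_cderive. Qed.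

Let h'c a b : continuous_on a b (cderive h).
Proof.
move=> t _ e e0; case: h1 => _ _ hc; have [d d0 Hd] := continuousC_real hc t e0.
by exists d => // s _; exact: Hd.
Qed.

Definition piece a b : Prop :=
  (forall t, t \in `[a, b] -> gamma t = h t) /\ (forall t, t \in `[a, b] -> Tr (h t)).

Lemma piece_sub a b c d : a <= c -> d <= b -> piece a b -> piece c d.
Proof.
move=> ac db [H1 H2].
have S u : u \in `[c, d] -> u \in `[a, b].
  by rewrite !in_itv /= => /andP[g1 g2]; rewrite (le_trans ac g1) (le_trans g2 db).
by split=> t /S; [exact: H1|exact: H2].
Qed.

Let piece_continuous a b H : piece a b -> continuous_in Tr H ->
  continuous_on a b (fun t => H (h t) * cderive h t).
Proof.
move=> [_ hT] Hc; apply: continuous_onM; last exact: h'c.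
move=> t tab e e0; have /continuous_at_inP/(_ _ e0)[d d0 Hd] := Hc _ (hT t tab).
have [d' d'0 Hd'] := is_cderive_continuous (hd t) d0.
by exists d' => // s sab st; apply: Hd; [exact: hT|exact: Hd'].
Qed.

(** The derivative is two-sided, so the end points, where gamma may leave h, are excluded. *)
Let piece_cderive a b t : piece a b -> t \in `]a, b[ -> cderive gamma t = cderive h t.
Proof.
move=> [gh _] tab.
have nr : \forall s \near t, gamma s = h s.
  have : nbhs t [set` `]a, b[] by apply: near_in_itvoo.
  apply: filterS => s /= sab; apply: gh; exact: subset_itv_oo_cc sab.
rewrite /cderive !derive1E; congr (_ +i* _); apply: near_eq_derive.
- by apply: filterS nr => s ->.
- by apply: filterS nr => s ->.
Qed.

Let piece_eq a b H : piece a b -> forall t, t \in `]a, b[ ->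
  H (gamma t) * cderive gamma t = H (h t) * cderive h t.
Proof.
move=> p t tab; rewrite (piece_cderive p tab); case: p => gh _.
by rewrite gh//; exact: subset_itv_oo_cc tab.
Qed.

Let piece_bmeasurable a b H : a <= b -> piece a b -> continuous_in Tr H ->
  bmeasurable a b (fun t => H (gamma t) * cderive gamma t).
Proof.
move=> ab p Hc; apply: (eq_bmeasurable (piece_eq H p)).
by apply: continuous_on_bmeasurable => //; exact: piece_continuous.
Qed.

Let piece_integral a b H : a <= b -> piece a b -> continuous_in Tr H ->
  arc_integral a b H = cint a b (fun t => H (h t) * cderive h t).
Proof.
move=> ab p Hc; apply: (eq_cint (piece_eq H p)).
by apply: continuous_on_bmeasurable => //; exact: piece_continuous.
Qed.

Let piece_lipschitz a b (V : R) : (forall t, t \in `[a, b] -> modulus (cderive h t) <= V) ->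
  forall t, t \in `[a, b] -> modulus (h t - h a) <= 2 * (V * (t - a)).
Proof.
move=> HV t; rewrite in_itv /= => /andP[at_ tb].
move: at_; rewrite le_eqVlt => /orP[/eqP <-|at_].
  by rewrite !subrr mulr0 mulr0 Normc.normc0.
have hc : continuous_on a t (cderive h) by exact: h'c.
rewrite -(cint_FTC at_ (fun t _ => hd t) hc).
apply: cint_le; [exact: ltW|exact: continuous_on_bmeasurable (ltW at_) hc|].
by move=> s; rewrite in_itv /= => /andP[as_ st]; apply: HV; rewrite in_itv /= as_ (le_trans st).
Qed.

(** A single node h a, weighted by the integral of F. There |H(h t) - H(h a)| <= 2 L V (b - a);
    integrating this against B over the interval brings another 2 (b - a). *)
Let quadrature_step F a b (B V : R) : a <= b -> piece a b -> continuous_in Tr F ->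
  0 <= B -> 0 <= V ->
  (forall t, t \in `[a, b] -> modulus (F (h t) * cderive h t) <= B) ->
  (forall t, t \in `[a, b] -> modulus (cderive h t) <= V) ->
  quadrature F a b (4 * B * V * (b - a) ^+ 2).
Proof.
move=> ab p Fc B0 V0 HB HV.
have aab : a \in `[a, b] by rewrite in_itv /= lexx.
have Ta : Tr (h a) by case: p => _; exact.
exists [:: (arc_integral a b F, h a : C)]; first by move=> q; rewrite inE => /eqP ->.
move=> H L Hc L0 HL; rewrite big_seq1 /=.
have FH : continuous_in Tr (fun z => F z * H z) by exact: continuous_inM.
have mF : bmeasurable a b (fun t => F (h t) * cderive h t).
  by apply: continuous_on_bmeasurable => //; exact: piece_continuous.
have mFH : bmeasurable a b (fun t => F (h t) * H (h t) * cderive h t).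
  by apply: continuous_on_bmeasurable => //; exact: (piece_continuous p FH).
rewrite !piece_integral//.
rewrite mulrC addrC -mulNr -cint_linear//.
have := cint_le (B := B * (L * (2 * (V * (b - a))))) ab
  (bmeasurable_linear (- H (h a)) mF mFH).
move=> /(_ _)/le_trans; apply; last by rewrite le_eqVlt; apply/orP; left; apply/eqP; ring.
move=> t tab; rewrite (_ : _ + _ = (F (h t) * cderive h t) * (H (h t) - H (h a))); last by ring.
rewrite Normc.normcM; apply: ler_pM; rewrite ?modulus_ge0 ?HB//.
have Tt : Tr (h t) by case: p => _; exact.
apply: le_trans (HL _ _ Tt Ta) _; apply: ler_wpM2l => //.
apply: le_trans (piece_lipschitz HV tab) _.
move: tab; rewrite in_itv /= => /andP[at_ tb].
by do 2!apply: ler_wpM2l => //; rewrite lerD2r.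
Qed.

Lemma piece_arc a b : a < b -> piece a b -> arc a b.
Proof.
move=> ab p; have ab' := ltW ab.
have mab (phi : R -> R[i]) : continuous_on a b phi ->
    exists2 B : R, 0 <= B & forall t, t \in `[a, b] -> modulus (phi t) <= B.
  by move=> /(continuous_on_bmeasurable ab')[].
have hT t : t \in `[a, b] -> Tr (h t) by case: p => _; exact.
have [V V0 HV] := mab _ (@h'c a b).
split.
- by move=> H; exact: piece_bmeasurable.
- exists (2 * (V * (b - a))); first by rewrite !mulr_ge0// subr_ge0.
  move=> H B Hc B0 HB; rewrite piece_integral//.
  have := cint_le (B := B * V) ab' (continuous_on_bmeasurable ab' (piece_continuous p Hc)).
  move=> /(_ _)/le_trans; apply; last by rewrite le_eqVlt; apply/orP; left; apply/eqP; ring.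
  by move=> t tab; rewrite Normc.normcM; apply: ler_pM; rewrite ?modulus_ge0 ?HB ?HV//; exact: hT.
- move=> H Hc; have [|B B0 HB] := mab (fun t => H (h t)).
    move=> t tab e e0; have /continuous_at_inP/(_ _ e0)[d d0 Hd] := Hc _ (hT t tab).
    have [d' d'0 Hd'] := is_cderive_continuous (hd t) d0.
    by exists d' => // s sab st; apply: Hd; [exact: hT|exact: Hd'].
  by exists B => // t tab; case: p => gh _; rewrite gh// HB.
- move=> Psi H Hc HPsi; rewrite piece_integral//.
  have [gh _] := p; rewrite !gh ?in_itv /= ?lexx ?ab'//.
  apply: (cint_FTC (U := fun t => Psi (h t)) ab _ (piece_continuous p Hc)) => t tab.
  by apply: HPsi; [exact: hT|exact: hd].
- move=> F e Fc e0; have [B B0 HB] := mab _ (piece_continuous p Fc).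
  (* The one-node error is quadratic in the length: N equal steps cost c / N^2 each and c / N
     together, which is below e for N > c / e. *)
  pose c := 4 * B * V * (b - a) ^+ 2.
  have c0 : 0 <= c by rewrite !mulr_ge0 ?exprn_ge0// subr_ge0.
  have := archi_boundP (divr_ge0 c0 (ltW e0)).
  set N := Num.Def.archi_bound _ => HN.
  have N0 : (0 < N)%N.
    rewrite lt0n; apply/negP => /eqP N0; by move: HN; rewrite N0 ltNge divr_ge0 ?(ltW e0).
  have N0' : 0 < N%:R :> R by rewrite ltr0n.
  pose d := (b - a) / N%:R; have d0 : 0 < d by rewrite divr_gt0 ?subr_gt0.
  have step (s t : R) : a <= s -> s <= t -> t <= b -> t - s = d ->
      quadrature F s t (c / N%:R ^+ 2).
    move=> as_ st tb tsd; have S u : u \in `[s, t] -> u \in `[a, b].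
      by rewrite !in_itv /= => /andP[g1 g2]; rewrite (le_trans as_ g1) (le_trans g2 tb).
    have -> : c / N%:R ^+ 2 = 4 * B * V * (t - s) ^+ 2.
      by rewrite tsd /c /d; field; rewrite gt_eqF.
    apply: quadrature_step => //; first exact: piece_sub p.
    - by move=> u /S; exact: HB.
    - by move=> u /S; exact: HV.
  have dN : a + N%:R * d = b by rewrite /d mulrC divfK ?gt_eqF// addrC subrK.
  have main k : (k < N)%N -> quadrature F a (a + k.+1%:R * d) (k.+1%:R * (c / N%:R ^+ 2)).
    elim: k => [|k IH] kN.
      rewrite !mul1r; apply: step; rewrite ?lexx ?lerDl ?(ltW d0)//; last by rewrite addrAC subrr add0r.
      by rewrite -dN lerD2l ler_peMl ?(ltW d0) ?ler1n.
    have kb : a + k.+2%:R * d <= b by rewrite -dN lerD2l ler_pM2r// ler_nat.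
    have ak : a <= a + k.+1%:R * d by rewrite lerDl mulr_ge0 ?(ltW d0).
    have kk : a + k.+1%:R * d <= a + k.+2%:R * d by rewrite lerD2l ler_pM2r// ler_nat.
    rewrite -[k.+2%:R * (c / _)](_ : k.+1%:R * (c / N%:R ^+ 2) + c / N%:R ^+ 2 = _); last first.
      by rewrite -[k.+2%:R]natr1 mulrDl mul1r.
    apply: (@quadrature_cat _ _ (a + k.+1%:R * d)) => //.
    + move=> H Hc; apply: piece_bmeasurable => //; apply: piece_sub p => //.
      exact: le_trans kb.
    + by move=> H Hc; apply: piece_bmeasurable => //; apply: piece_sub p.
    + exact/IH/ltnW.
    + by apply: step => //; rewrite -[k.+2%:R]natr1; ring.
  have := main N.-1; rewrite prednK// => /(_ (leqnn _)); rewrite dN.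
  move=> [ws T H]; exists ws => // G L Gc L0 HL; apply: le_trans (H _ _ Gc L0 HL) _.
  apply: ler_wpM2r => //.
  rewrite (_ : _ * _ = c / N%:R); last by field; rewrite gt_eqF.
  by rewrite ler_pdivrMr// mulrC -ler_pdivrMr// ltW.
Qed.

End Piece.

Lemma piecewise_C1_arc : piecewise_C1 gamma -> arc 0 1.
Proof.
move=> [s [ps /eqP ls] Hs].
(* The start of the partition is generalized for the induction. A one-piece partition is the base
   case, because a piece must have positive length. *)
have key : forall (s : seq R) a, 0 <= a -> path <%O a s -> last a s = 1 -> (0 < size s)%N ->
    (forall k, (k < size s)%N -> exists2 h : R -> R[i], C1 h &
      {in `[nth 0 (a :: s) k, nth 0 s k], gamma =1 h}) -> arc a 1.
  elim=> [//|x s' IH] a a0 /= /andP[ax px] lx _ Hk.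
  have x1 : x <= 1.
    by rewrite -lx; elim: (s') (x) px => //= y l IHl z /andP[zy /IHl]; apply: le_trans; exact: ltW.
  have [h hC1 gh] := Hk 0%N isT.
  have pa : arc a x.
    apply: (piece_arc hC1) => //; split=> t tax; first exact: gh.
    rewrite -gh//; exists t => //=; move: tax; rewrite /= !in_itv /= => /andP[h1 h2].
    by rewrite (le_trans a0 h1) (le_trans h2 x1).
  case: s' {gh} IH px lx Hk => [|y s'] IH px lx Hk; first by rewrite -lx.
  apply: (arc_cat (ltW ax) x1 pa); apply: IH => //; first exact: le_trans (ltW ax).
  by move=> k kl; have := Hk k.+1 kl.
case: s ps ls Hs key => [|x s] ps ls Hs key; first by move: ls => /= /eqP; rewrite eq_sym oner_eq0.
exact: (key (x :: s)).
Qed.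

End Contour.

(** * Contour integrals *)

Section ContourIntegral.
Context (R : realType).
Local Notation C := (R[i]^o).
Context (gamma : R -> C).
Local Notation Tr := (trace_curve gamma).
Implicit Types (H F : C -> C) (a b z : C).

(** Closedness enters through the primitives z^(k+1) / (k+1) and -(z - a)^-(k+1) / (k+1), whose end
    values cancel. *)
Lemma contour_integral_functional : piecewise_C1 gamma -> gamma 0 = gamma 1 ->
  exists V : R, contour_functional Tr V (contour_integral gamma).
Proof.
move=> /piecewise_C1_arc[mI [V V0 HV] bI pI _] closed.
exists V; split.
- exact: V0.
- move=> H1 H2 H12.
  have E t : t \in `[0, 1] -> H1 (gamma t) * cderive gamma t = H2 (gamma t) * cderive gamma t.
    by move=> t01; rewrite H12//; exists t.
  rewrite /contour_integral /cintegral01; congr (_ +i* _);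
    by apply: eq_Rintegral => t /set_mem /= t01; rewrite E.
- move=> a H1 H2 c1 c2; rewrite -[contour_integral gamma H1]/(arc_integral gamma 0 1 H1).
  rewrite -[contour_integral gamma H2]/(arc_integral gamma 0 1 H2).
  rewrite -cint_linear; [|exact: mI..].
  rewrite -[LHS]/(cint 0 1 _); congr cint; apply/funext => t; ring.
- exact: HV.
- move=> H Hc; have [B B0 HB] := bI H Hc; exists B => // z [t t01 <-]; exact: HB.
- move=> k; have Hc : continuous_in Tr (fun z => z ^+ k).
    by move=> z _; apply: continuous_at_inX; exact: continuous_at_in_id.
  rewrite -[LHS]/(arc_integral gamma 0 1 (fun z => z ^+ k)).
  rewrite (pI (fun z => k.+1%:R^-1 * z ^+ k.+1))//.
    by rewrite closed subrr.
  move=> u t l _ ul; have := is_cderiveZ (k.+1%:R^-1) (is_cderiveX k.+1 ul).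
  congr is_cderive; rewrite /= !mulrA mulVf ?mul1r// pnatr_eq0.
- move=> a k Ta; have Hc := resolvent_continuous (n := k.+2) Ta.
  rewrite -[LHS]/(arc_integral gamma 0 1 (fun z => ((z - a) ^+ k.+2)^-1)).
  rewrite (pI (fun z => - k.+1%:R^-1 * ((z - a) ^+ k.+1)^-1))//.
    by rewrite closed subrr.
  move=> u t l Tu ul.
  have ua : u t - a != 0.
    by rewrite subr_eq0; apply/negP => /eqP ua; apply: Ta; rewrite -ua.
  have := is_cderiveB ul (is_cderive_cst a t); rewrite subr0.
  move=> /(is_cderiveX k.+1)/(is_cderiveV (expf_neq0 k.+1 ua))/(is_cderiveZ (- k.+1%:R^-1)).
  congr is_cderive; rewrite /=; move: (u t - a) ua => x x0.
  rewrite !exprS; field.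
  by rewrite x0 expf_neq0 //= addrC natr1 pnatr_eq0.
Qed.

Lemma contour_quadrature F (e : R) : piecewise_C1 gamma -> continuous_in Tr F -> 0 < e ->
  quadrature gamma F 0 1 e.
Proof. by move=> /piecewise_C1_arc[_ _ _ _ q]; exact: q. Qed.

Lemma winding_numberE a :
  winding (contour_integral gamma) a = two_pi_i R * winding_number gamma a.
Proof.
rewrite /winding_number mulVKf//.
by rewrite /two_pi_i eq_complex /= eqxx /= mulf_eq0 pnatr_eq0 /= gt_eqF ?pi_gt0.
Qed.

Context (V : R) (IP : contour_functional Tr V (contour_integral gamma)).
Local Notation W := (winding (contour_integral gamma)).

(** Local constancy makes both the set where W takes the value W a and the set where it does not
    open, so the former exhausts the component. *)
Lemma winding_connected a b : ~ Tr a -> connected_component (~` Tr) a b -> W b = W a.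
Proof.
move=> Ta; set B := connected_component _ _ => Bb.
have BT c : B c -> ~ Tr c by exact: connected_component_sub.
have op (P : C -> Prop) : open [set c | ~ Tr c /\ P (W c)].
  rewrite openE => c /= [Tc Pc]; apply/nearC.
  have [d d0 Hd] := winding_locally_constant IP Tc.
  by exists d => // w /Hd[Tw Ww] /=; rewrite Ww.
have Ba : B a by exact: connected_component_refl.
have : B `&` [set c | ~ Tr c /\ W c = W a] = B.
  apply: (@component_connected _ (~` Tr) a).
  - by exists a.
  - by exists [set c | ~ Tr c /\ W c = W a] => //; exact: (op (fun x => x = W a)).
  - exists (~` [set c | ~ Tr c /\ W c <> W a]).
      by apply: open_closedC; exact: (op (fun x => x <> W a)).
    apply/seteqP; split=> c /= [Bc H]; split=> //; first by case: H => _ Wc [_].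
    by split; [exact: BT|apply: contrapT => Wc; apply: H; split; [exact: BT|]].
by move=> E; move: Bb; rewrite -E => -[_ []].
Qed.

(** An unbounded component contains points beyond the radius of [winding_far], where the winding is
    0. *)
Lemma winding_outside a : ~ Tr a -> ~ enclosed gamma a -> W a = 0.
Proof.
move=> Ta Ea; have [rho _ Hrho] := winding_far IP.
have [[b [Bb rb]]|nb] := pselect (exists b, connected_component (~` Tr) a b /\ rho < modulus b).
  by rewrite -(winding_connected Ta Bb) Hrho.
case: Ea; split=> //; exists rho%:C; split; first by rewrite complex_real.
move=> M rM b /= Bb; apply: le_trans (ltW rM).
rewrite normr_modulus lecR leNgt; apply/negP => rb; apply: nb.
by exists b.
Qed.

End ContourIntegral.

(** * Functionals bounded by the derivative *)

Section C1Functions.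
Context (R : realType).
Local Notation C := R[i].
Implicit Types (u v : R -> C) (t : R).

(** The derivative is carried as an explicit formula, so that bounds on it need no computation of
    [cderive]. *)
Definition C1_pair u (u' : R -> C) : Prop :=
  (forall t, is_cderive u t (u' t)) /\ continuous (u' : R -> R[i]^o).

Lemma is_cderive_cvg u t l : is_cderive u t l -> {for t, continuous (u : R -> R[i]^o)}.
Proof.
move=> ul A /nearC[e e0 HA]; have [d d0 Hd] := is_cderive_continuous ul e0.
by apply/nbhs_ballP; exists d => // s; rewrite -ball_normE /= distrC => /Hd; exact: HA.
Qed.

Lemma C1_pair_C1 u u' : C1_pair u u' -> C1 u.
Proof.
move=> [du cu]; split=> [t|t|]; [by case: (du t) => -[]|by case: (du t) => _ []|].
by rewrite (_ : cderive u = u')//; apply/funext => t; exact: is_cderiveE.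
Qed.

Lemma C1_C1_pair u : C1 u -> C1_pair u (cderive u).
Proof. by move=> u1; split; [move=> t; exact: C1_is_cderive | case: u1]. Qed.

Lemma C1_pair_cst (b : C) : C1_pair (fun=> b) (fun=> 0).
Proof.
split=> [t|t]; first exact: is_cderive_cst.
exact: (@cst_continuous R (R[i]^o) 0).
Qed.

Lemma C1_pairD u u' v v' : C1_pair u u' -> C1_pair v v' ->
  C1_pair (fun t => u t + v t) (fun t => u' t + v' t).
Proof.
move=> [du cu] [dv cv]; split=> [t|t]; first exact: is_cderiveD.
exact: (cvgD (cu t) (cv t)).
Qed.

Lemma C1_pairM u u' v v' : C1_pair u u' -> C1_pair v v' ->
  C1_pair (fun t => u t * v t) (fun t => u t * v' t + v t * u' t).
Proof.
move=> [du cu] [dv cv]; split=> [t|t]; first exact: is_cderiveM.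
by apply: cvgD; [exact: (cvgM (is_cderive_cvg (du t)) (cv t))
                |exact: (cvgM (is_cderive_cvg (dv t)) (cu t))].
Qed.

Lemma C1_pairZ (a : C) u u' : C1_pair u u' ->
  C1_pair (fun t => a * u t) (fun t => a * u' t).
Proof.
move=> uu'; have := C1_pairM (C1_pair_cst a) uu'; congr C1_pair.
by apply/funext => t; rewrite mulr0 addr0.
Qed.

Lemma C1_pairX u u' n : C1_pair u u' ->
  C1_pair (fun t => u t ^+ n) (fun t => n%:R * u t ^+ n.-1 * u' t).
Proof.
move=> uu'; have C1X k : exists v', C1_pair (fun t => u t ^+ k) v'.
  elim: k => [|k [v' IH]]; first by exists (fun=> 0); exact: (C1_pair_cst 1).
  exists (fun t => u t * v' t + u t ^+ k * u' t).
  by have := C1_pairM uu' IH; congr C1_pair; apply/funext => t; rewrite exprS.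
have [v' vc] := C1X n; split=> [t|]; first by apply: is_cderiveX; case: uu'.
rewrite (_ : (fun t => _) = v'); first by case: vc.
apply/funext => t; case: vc => /(_ t)/is_cderiveE <- _.
by apply/esym/is_cderiveE/is_cderiveX; case: uu'.
Qed.

Lemma C1_pairV u u' : (forall t, u t != 0) -> C1_pair u u' ->
  C1_pair (fun t => (u t)^-1) (fun t => - u' t / u t ^+ 2).
Proof.
move=> u0 [du cu]; split=> [t|t]; first exact: is_cderiveV.
apply: cvgM; first by apply: cvgN; exact: cu.
apply: cvgV; first by rewrite expf_neq0.
under eq_fun do rewrite expr2; rewrite expr2.
exact: (cvgM (is_cderive_cvg (du t)) (is_cderive_cvg (du t))).
Qed.

Lemma C1_pair_real (phi phi' : R -> R) : (forall t, is_derive t (1 : R) phi (phi' t)) ->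
  continuous phi' -> C1_pair (fun t => (phi t)%:C) (fun t => (phi' t)%:C).
Proof.
move=> dphi cphi; split=> [t|t A /nearC[e e0 HA]]; first exact: is_cderive_real.
have /cvgrPdist_lt/(_ _ e0)/nbhs_ballP[d d0 Hd] := cphi t.
apply/nbhs_ballP; exists d => // s /Hd /=; rewrite distrC => H.
by apply: HA; rewrite -rmorphB modulus_real.
Qed.

Lemma C1_pair_id : C1_pair (fun t => t%:C) (fun=> 1).
Proof.
split=> [t|t]; last exact: (@cst_continuous R (R[i]^o) 1).
exact: (is_cderive_real (is_derive_id t 1)).
Qed.

(** A C^1 function that vanishes on a half-line, from which [bent_identity] is built; at 0 the
    derivative is read off Caratheodory's factorization. *)
Lemma is_derive_sqr_pos t : is_derive t (1 : R) (fun y : R => Num.max 0 y ^+ 2) (2 * Num.max 0 t).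
Proof.
have [t0|t0|->] := ltgtP t 0.
- apply: (@near_eq_is_derive _ _ _ (cst 0)).
    near=> y; rewrite max_l ?expr0n//; apply: ltW; near: y; exact: lt_nbhsl.
  by rewrite mulr0; exact: is_derive_cst.
- apply: (@near_eq_is_derive _ _ _ (fun y : R => y ^+ 2)).
    near=> y; rewrite max_r//; apply: ltW; near: y; exact: lt_nbhsr.
  rewrite (_ : (fun y : R => y ^+ 2) = id * id); last by apply/funext => y; rewrite expr2.
  apply: (is_derive_eq (is_deriveM (is_derive_id t 1) (is_derive_id t 1))).
  by rewrite /GRing.scale /= !mulr1 mulr_natl mulr2n.
- rewrite ?maxxx mulr0; apply/is_derive1_caratheodory; exists (fun y => Num.max 0 y); split.
  + move=> y; rewrite maxxx expr0n /= !subr0 expr2.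
    by have [y0|y0] := leP 0 y; rewrite ?mul0r.
  + have := @continuous_max R R (cst 0) id; rewrite /continuous_at.
    by apply; [exact: cvg_cst | exact: cvg_id].
  + exact: maxxx.
Unshelve. all: by end_near.
Qed.

End C1Functions.

(** * Resolvents as C^1 functions *)

Section Resolvent.
Context (R : realType) (M : R).
Hypothesis M0 : 0 < M.
Local Notation C := R[i].
Implicit Types (z w : C) (x t d : R).

(* [x |-> (z - x)^-1] may have a pole on the real line outside [-M, M]; it is
   removed by bending the identity outside of [-M, M]. *)
Lemma bent_identity z : ~ csegment M z -> exists phi phi' : R -> R,
  [/\ forall t, is_derive t (1 : R) phi (phi' t), continuous phi',
      forall t, t \in `[- M, M] -> phi t = t /\ phi' t = 1 &
      forall t, z != (phi t)%:C].
Proof.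
move=> zM; have [z0|z0] := eqVneq (complex.Im z) 0; last first.
  exists id, (fun=> 1); split=> [t|t|//|t].
  - exact: is_derive_id.
  - exact: cst_continuous.
  - by apply: contra_neq z0 => ->.
pose x := complex.Re z; have zE : z = x%:C by rewrite /x; case: z z0 {zM x} => a b /= ->.
have xM : M < `|x|.
  by rewrite ltNge; apply/negP => xM; apply: zM; apply/csegmentP.
have x0 : x != 0 by rewrite -normr_gt0 (lt_trans M0).
pose sg := Num.sg x; have sg2 : sg * sg = 1 by rewrite -expr2 sqr_sg x0.
have sgx : sg * x = `|x| by rewrite normrEsg.
pose k := (`|x| - M)^-1; have k0 : 0 < k by rewrite invr_gt0 subr_gt0.
(* Beyond M, on the side of x, put p = k (sg t - M). As k (|x| - M) = 1, the equation phi t = x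
   reads p - p^2 = 1, impossible since p - p^2 <= 1/4. *)
pose phi t := t - sg * k * Num.max 0 (sg * t - M) ^+ 2.
pose phi' t := 1 - 2 * k * Num.max 0 (sg * t - M).
have dlin t : is_derive t (1 : R) (fun s => sg * s - M) sg.
  rewrite (_ : (fun s => _) = (fun s => sg *: id s) - cst M); last by apply/funext.
  apply: (is_derive_eq (is_deriveB (is_deriveZ sg (is_derive_id t 1)) (is_derive_cst M t 1))).
  by rewrite /GRing.scale /= mulr1 subr0.
have sgM t : t \in `[- M, M] -> sg * t - M <= 0.
  rewrite in_itv /= -ler_norml subr_le0 => /(le_trans _); apply.
  by apply: le_trans (ler_norm _) _; rewrite normrM normr_sg x0 mul1r.
exists phi, phi'; split.
- move=> t; have := @is_derive1_comp _ (fun y => Num.max 0 y ^+ 2) (fun s => sg * s - M) t _ _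
    (is_derive_sqr_pos _) (dlin t).
  move=> /(is_deriveZ (sg * k))/(is_deriveB (is_derive_id t 1))/is_derive_eq; apply.
  rewrite /GRing.scale /= /phi'; move: (Num.max _ _) => m.
  rewrite (_ : sg * k * (2 * m * sg) = sg * sg * (2 * k * m)); last by ring.
  by rewrite sg2 mul1r.
- move=> t; apply: cvgB; first exact: cvg_cst.
  apply: cvgM; first exact: cvg_cst.
  have := @continuous_max R R (cst 0) (fun s => sg * s - M) t; apply; first exact: cvg_cst.
  by apply/differentiable_continuous/derivable1_diffP; case: (dlin t).
- by move=> t /sgM tM; rewrite /phi /phi' max_l// expr0n !mulr0 !subr0.
- move=> t; rewrite zE (inj_eq (@complexI R)); apply/negP => /eqP xE.
  have : `|x| = sg * t - k * Num.max 0 (sg * t - M) ^+ 2.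
    rewrite -sgx {1}xE /phi mulrBr; congr (_ - _).
    by rewrite !mulrA sg2 mul1r.
  have kE : k * (`|x| - M) = 1 by rewrite mulVf// gt_eqF// subr_gt0.
  have [h|h] := leP 0 (sg * t - M); last by rewrite expr0n mulr0; lra.
  move=> yE; have : k * (`|x| - M) = k * (sg * t - M) - (k * (sg * t - M)) ^+ 2.
    by rewrite {1}yE; ring.
  rewrite kE; have := sqr_ge0 (k * (sg * t - M) - 2^-1).
  by move: (k * (sg * t - M)) => p; rewrite sqrrB; lra.
Qed.

Definition resolvent z : R -> C := fun x => (z - x%:C)^-1.

(** [rho_bound] speaks of functions that are C^1 on the whole line, so the resolvent is composed
    with the bent identity. Its derivative in x is its square, which is why squares of resolvents
    appear from here on. *)
Lemma resolvent_extension z : ~ csegment M z -> exists rho rho' : R -> C,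
  C1_pair rho rho' /\ forall x, x \in `[- M, M] ->
    rho x = resolvent z x /\ rho' x = resolvent z x ^+ 2.
Proof.
move=> /bent_identity[phi [phi' [dphi cphi pM pz]]].
have zphi t : z + -1 * (phi t)%:C != 0 by rewrite mulN1r subr_eq0.
have pp := C1_pairD (C1_pair_cst z) (C1_pairZ (-1) (C1_pair_real dphi cphi)).
exists (fun t => (z + -1 * (phi t)%:C)^-1),
  (fun t => - (0 + -1 * (phi' t)%:C) / (z + -1 * (phi t)%:C) ^+ 2).
split; first exact: C1_pairV pp.
move=> x /pM[-> ->]; rewrite /resolvent mulN1r; split=> //.
by rewrite add0r mulN1r opprK div1r exprVn.
Qed.

Definition far_from d z : Prop := forall x, x \in `[- M, M] -> d <= modulus (z - x%:C).

Lemma continuous_on_subr z : continuous_on (- M) M (fun t => z - t%:C).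
Proof.
move=> t _ e e0; exists e => // s _ st.
rewrite (_ : z - s%:C - (z - t%:C) = (t - s)%:C); first by rewrite modulus_real distrC.
by rewrite rmorphB; ring.
Qed.

(** The witness is the distance to the segment: it is attained, hence positive off the segment, and
    1-Lipschitz. *)
Lemma dist_csegment : exists m : C -> R,
  [/\ forall z, far_from (m z) z, forall z, ~ csegment M z -> 0 < m z &
      forall z w, m z <= m w + modulus (z - w)].
Proof.
have MM : - M <= M by rewrite (le_trans _ (ltW M0))// oppr_le0 ltW.
have /choice[c Hc] : forall z, exists c, c \in `[- M, M] /\
    forall t, t \in `[- M, M] -> modulus (z - c%:C) <= modulus (z - t%:C).
  move=> z; have [c cM H] := EVT_min MM
    (continuous_on_within (@lipschitz_modulus R) (continuous_on_subr z)).
  by exists c.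
exists (fun z => modulus (z - (c z)%:C)); split=> [z x|z zM|z w].
- by have [_] := Hc z; exact.
- rewrite modulus_gt0 subr_eq0; apply/negP => /eqP zc; apply: zM.
  by rewrite zc; exists (c z) => //; have [] := Hc z.
- have [_ Hz] := Hc z; have [cw _] := Hc w.
  apply: le_trans (Hz _ cw) _.
  by rewrite [leRHS]addrC; exact: modulus_triangle.
Qed.

Lemma far_csegment d z : 0 < d -> far_from d z -> ~ csegment M z.
Proof.
move=> d0 dz [x xM xz]; have := dz x xM.
by rewrite -xz subrr Normc.normc0 leNgt d0.
Qed.

Lemma modulus_resolvent d z x : 0 < d -> far_from d z -> x \in `[- M, M] ->
  modulus (resolvent z x) <= d^-1.
Proof.
move=> d0 dz xM; rewrite /resolvent Normc.normcV lef_pV2 ?posrE ?dz//.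
exact: lt_le_trans (dz x xM).
Qed.

Lemma resolventB d z w x : 0 < d -> far_from d z -> far_from d w -> x \in `[- M, M] ->
  resolvent z x - resolvent w x = (w - z) * (resolvent z x * resolvent w x).
Proof.
move=> d0 dz dw xM; rewrite /resolvent; field.
by rewrite -!modulus_gt0 (lt_le_trans d0 (dz x xM)) (lt_le_trans d0 (dw x xM)).
Qed.

(** By the resolvent identity the difference of the resolvents is at most |z - w| / d^2, and their
    sum is at most 2 / d. The constant is uniform in x. *)
Lemma resolvent_sqr_lipschitz d z w x : 0 < d -> far_from d z -> far_from d w ->
  x \in `[- M, M] ->
  modulus (resolvent z x ^+ 2 - resolvent w x ^+ 2) <= 2 / d ^+ 3 * modulus (z - w).
Proof.
move=> d0 dz dw xM; rewrite subr_sqr (resolventB d0 dz dw xM).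
have rz := modulus_resolvent d0 dz xM; have rw := modulus_resolvent d0 dw xM.
rewrite !Normc.normcM modulusB_sym.
apply: le_trans (_ : modulus (z - w) * (d^-1 * d^-1) * (d^-1 + d^-1) <= _).
  have d1 : 0 <= d^-1 by rewrite invr_ge0 ltW.
  apply: ler_pM; rewrite ?mulr_ge0 ?modulus_ge0//.
    by rewrite ler_wpM2l ?modulus_ge0// ler_pM ?modulus_ge0.
  by apply: le_trans (modulusD _ _) _; apply: lerD.
by rewrite le_eqVlt; apply/orP; left; apply/eqP; field; rewrite gt_eqF.
Qed.

End Resolvent.

(** * Functionals of resolvents: analyticity and expansion at infinity *)

Section DerivativeBounded.
Context (R : realType) (M : R).
Hypothesis M0 : 0 < M.
Local Notation C := R[i].
Implicit Types (f h : R -> C) (z w : C) (a b x d B : R).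

(** This is what remains of rho when one argument is fixed, so that the same lemmas serve both
    variables. *)
Record derivative_bounded (L : (segment M -> C) -> C) (K : R) : Prop :=
    DerivativeBounded {
  bounded_ge0 : 0 <= K ;
  bounded_linear : forall (a : C) (h1 h2 : segment M -> C), C1_segment h1 -> C1_segment h2 ->
    L (fun s : segment M => a * h1 s + h2 s) = a * L h1 + L h2 ;
  bounded_le : forall f f' B, C1_pair f f' -> 0 <= B ->
    (forall x, x \in `[- M, M] -> modulus (f' x) <= B) ->
    modulus (L (restr f)) <= K * B }.

Context (L : (segment M -> C) -> C) (K : R) (LP : derivative_bounded L K).
Let K0 := bounded_ge0 LP.
Local Notation Lr f := (L (restr (M := M) f)).
Local Notation C1s f := (C1_segment (restr (M := M) f)).
Local Notation r := (@resolvent R).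

Lemma restr_ext f h : (forall x, x \in `[- M, M] -> f x = h x) ->
  restr (M := M) f = restr (M := M) h.
Proof. by move=> fh; apply/funext => x; apply: fh; exact: (svalP x). Qed.

Lemma C1_pair_segment f f' h : C1_pair f f' ->
  (forall x, x \in `[- M, M] -> f x = h x) -> C1s h.
Proof. by move=> ff' /restr_ext <-; exists f => //; exact: C1_pair_C1 ff'. Qed.

Lemma C1_segmentP f : C1s f -> exists h h', C1_pair h h' /\
  forall x, x \in `[- M, M] -> h x = f x.
Proof.
move=> [h h1 E]; exists h, (cderive h); split; first exact: C1_C1_pair.
by move=> x xM; have := congr1 (fun u => u (exist _ x xM)) E.
Qed.

Lemma C1_segment_linear (a : C) f h : C1s f -> C1s h -> C1s (fun x => a * f x + h x).
Proof.
move=> /C1_segmentP[u [u' [uu' uf]]] /C1_segmentP[v [v' [vv' vh]]].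
apply: (C1_pair_segment (C1_pairD (C1_pairZ a uu') vv')) => x xM.
by rewrite uf// vh.
Qed.

Lemma C1_segmentX f n : C1s f -> C1s (fun x => f x ^+ n).
Proof.
move=> /C1_segmentP[u [u' [uu' uf]]].
by apply: (C1_pair_segment (C1_pairX n uu')) => x xM; rewrite uf.
Qed.

Lemma C1_segment_cst (b : C) : C1s (fun=> b).
Proof. exact: (C1_pair_segment (C1_pair_cst b)). Qed.

Lemma C1_segment_resolvent z : ~ csegment M z -> C1s (r z).
Proof.
move=> /(resolvent_extension M0)[rho [rho' [pp H]]].
by apply: (C1_pair_segment pp) => x /H[].
Qed.

Lemma bounded_sum (T : eqType) (s : seq T) (c : T -> C) (F : T -> R -> C) :
  (forall p, p \in s -> C1s (F p)) ->
  C1s (fun x => \sum_(p <- s) c p * F p x) /\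
  Lr (fun x => \sum_(p <- s) c p * F p x) = \sum_(p <- s) c p * Lr (F p).
Proof.
elim: s => [|p s IH] H.
  under eq_fun do rewrite big_nil; rewrite big_nil; split; first exact: C1_segment_cst.
  have := bounded_linear LP (-1) (C1_segment_cst 0) (C1_segment_cst 0).
  rewrite mulN1r addNr => E; rewrite -[RHS]E; congr L; apply/funext => x.
  by rewrite /restr mulr0 addr0.
have Hp : C1s (F p) by apply: H; rewrite mem_head.
have [Hs Es] : C1s (fun x => \sum_(p <- s) c p * F p x) /\
    Lr (fun x => \sum_(p <- s) c p * F p x) = \sum_(p <- s) c p * Lr (F p).
  by apply: IH => q qs; apply: H; rewrite in_cons qs orbT.
under eq_fun do rewrite big_cons; split; first exact: C1_segment_linear.
by rewrite big_cons -Es -(bounded_linear LP).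
Qed.

Lemma bounded_sum_ord n (c : nat -> C) (F : nat -> R -> C) :
  (forall k, (k < n)%N -> C1s (F k)) ->
  C1s (fun x => \sum_(k < n) c k * F k x) /\
  Lr (fun x => \sum_(k < n) c k * F k x) = \sum_(k < n) c k * Lr (F k).
Proof.
move=> H; have E (f : nat -> C) : \sum_(k < n) f k = \sum_(k <- iota 0 n) f k :> C.
  by rewrite -[in RHS](subn0 n) -/(index_iota 0 n) big_mkord.
under eq_fun do rewrite (E (fun k => c k * F k _)); rewrite (E (fun k => c k * Lr (F k))).
by apply: bounded_sum => k; rewrite mem_iota; exact: H.
Qed.

Lemma boundedB f h : C1s f -> C1s h -> Lr (fun x => f x - h x) = Lr f - Lr h.
Proof.
move=> fc hc; have := bounded_linear LP (-1) hc fc.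
rewrite mulN1r addrC => <-; congr L; apply/funext => x.
by rewrite /restr mulN1r addrC.
Qed.

Lemma boundedZ (a : C) f : C1s f -> Lr (fun x => a * f x) = a * Lr f.
Proof.
move=> fc; have [_] := bounded_sum (s := [:: tt]) (fun=> a) (F := fun=> f) (fun _ _ => fc).
by under eq_fun do rewrite big_seq1; rewrite big_seq1.
Qed.

(** Estimates the remainders of resolvent expansions, which have the form F r_z; the bounded
    quantity is the derivative of this product. *)
Lemma bounded_resolvent_le z (F F' : R -> C) d B : C1_pair F F' -> 0 < d -> far_from M d z ->
  0 <= B ->
  (forall x, x \in `[- M, M] -> modulus (F x * r z x ^+ 2 + r z x * F' x) <= B) ->
  modulus (Lr (fun x => F x * r z x)) <= K * B.
Proof.
move=> FF' d0 dz B0 HB.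
have [rho [rho' [pp H]]] := resolvent_extension M0 (far_csegment d0 dz).
rewrite (@restr_ext _ (fun x => F x * rho x)); last by move=> x /H[-> _].
apply: (bounded_le LP (C1_pairM FF' pp) B0) => x xM.
by have [-> ->] := H x xM; exact: HB.
Qed.

(** The remainder of r_z about z0 is ((z0 - z) r_z0)^n r_z. Its derivative is at most (4 / d^2) (n +
    1) (|z - z0| / d)^n, and n + 1 <= 2^n turns d into the radius d / 2. *)
Lemma bounded_resolvent_expandable z0 : ~ csegment M z0 -> expandable (fun z => Lr (r z)) z0.
Proof.
move=> z0M; have [m [mfar mpos mlip]] := dist_csegment M0.
pose d := m z0; have d0 : 0 < d by exact: mpos.
pose c k := (-1) ^+ k * Lr (fun x => r z0 x ^+ k.+1).
exists c, (K * (4 / d ^+ 2)), (d / 2); split.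
- by rewrite divr_gt0.
- by rewrite mulr_ge0// divr_ge0 ?exprn_ge0// ltW.
move=> z zd n.
have dz0 : far_from M (d / 2) z0.
  by move=> x xM; apply: le_trans (mfar z0 x xM); rewrite -/d; lra.
have dz : far_from M (d / 2) z.
  by move=> x xM; apply: le_trans (mfar z x xM); have := mlip z0 z; rewrite modulusB_sym -/d; lra.
have d2 : 0 < d / 2 by rewrite divr_gt0.
have zM := far_csegment d2 dz.
have [rho [rho' [pp H]]] := resolvent_extension M0 z0M.
pose F x := ((z0 - z) * rho x) ^+ n.
have FF' := C1_pairX n (C1_pairZ (z0 - z) pp).
have C1z0 : C1s (r z0) by exact: C1_segment_resolvent.
have [S1 S2] := bounded_sum_ord (n := n) (fun k => (z0 - z) ^+ k)
  (F := fun k x => r z0 x ^+ k.+1) (fun k _ => C1_segmentX k.+1 C1z0).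
have -> : Lr (r z) - \sum_(k < n) c k * (z - z0) ^+ k = Lr (fun x => F x * r z x).
  rewrite (_ : \sum_(k < n) c k * (z - z0) ^+ k =
      \sum_(k < n) (z0 - z) ^+ k * Lr (fun x => r z0 x ^+ k.+1)); last first.
    apply: eq_bigr => k _; rewrite /c mulrAC -exprMn mulN1r opprB; by [].
  rewrite -S2 -boundedB//; last exact: C1_segment_resolvent.
  congr L; apply: restr_ext => x xM; have [rx _] := H x xM.
  have z0x : z0 - x%:C != 0 by rewrite -modulus_gt0 (lt_le_trans d2 (dz0 x xM)).
  have zx : z0 - x%:C != z0 - z.
    rewrite (inj_eq (addrI _)) eqr_opp; apply/negP => /eqP xz.
    by apply: zM; exists x.
  have := resolvent_expand n z0x zx.
  rewrite (_ : z0 - x%:C - (z0 - z) = z - x%:C); last by ring.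
  rewrite /F rx /resolvent => {1}->.
  rewrite addrAC -[RHS]add0r; congr (_ + _).
  by rewrite -sumrB big1// => k _; rewrite exprVn subrr.
rewrite -mulrA; apply: (bounded_resolvent_le FF' d2 dz).
  by rewrite mulr_ge0 ?exprn_ge0 ?divr_ge0 ?exprn_ge0 ?modulus_ge0 ?(ltW d2) ?(ltW d0).
move=> x xM; have [rx rx'] := H x xM; rewrite rx rx'.
have r0 : modulus (r z0 x) <= d^-1 by exact: (modulus_resolvent d0 (mfar z0) xM).
have r1 : modulus (r z x) <= 2 / d.
  by have := modulus_resolvent d2 dz xM; rewrite invf_div.
set y := r z0 x in r0 *; set v := r z x in r1 *; set u := z0 - z.
have -> : (u * y) ^+ n * v ^+ 2 + v * (n%:R * (u * y) ^+ n.-1 * (u * y ^+ 2)) =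
    u ^+ n * (y ^+ n * v ^+ 2 + n%:R * (y ^+ n * y) * v).
  case: (n) => [|k]; first by rewrite /= mulr0n !expr0; ring.
  by rewrite /= !exprMn !exprS; ring.
have uE : modulus u = modulus (z - z0) by exact: modulusB_sym.
have d1 : 0 <= d^-1 by rewrite invr_ge0 ltW.
have yn : modulus (y ^+ n) <= (d^-1) ^+ n.
  by rewrite modulusX lerXn2r ?nnegrE ?modulus_ge0.
rewrite Normc.normcM modulusX uE.
rewrite (_ : 4 / d ^+ 2 * _ = modulus (z - z0) ^+ n * (4 / d ^+ 2 * (2 / d) ^+ n)); last first.
  by rewrite invf_div exprMn; ring.
apply: ler_wpM2l; first by rewrite exprn_ge0 ?modulus_ge0.
apply: le_trans (modulusD _ _) _; rewrite !Normc.normcM.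
have nE : modulus (n%:R : C) = n%:R.
  by rewrite -(rmorph_nat (@real_complex R)) modulus_real ger0_norm.
have dn0 : 0 <= d^-1 ^+ n by rewrite exprn_ge0.
apply: le_trans (_ : d^-1 ^+ n * (4 / d ^+ 2) * n.+1%:R <= _).
  rewrite -[n.+1%:R]natr1 mulrDr mulr1 [leLHS]addrC; apply: lerD.
    rewrite nE (_ : _ * n%:R = n%:R * (d^-1 ^+ n * (2 / d)) * (2 / d)); last first.
      by field; rewrite gt_eqF.
    apply: ler_pM; rewrite ?mulr_ge0 ?modulus_ge0//.
    apply: ler_wpM2l => //; apply: ler_pM; rewrite ?modulus_ge0//.
    by apply: le_trans r0 _; rewrite ler_peMl// ler1n.
  rewrite (_ : 4 / d ^+ 2 = (2 / d) ^+ 2); last by field; rewrite gt_eqF.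
  apply: ler_pM; rewrite ?modulus_ge0 ?mulr_ge0 ?modulus_ge0//.
  by rewrite expr2; apply: ler_pM; rewrite ?modulus_ge0.
rewrite (_ : d^-1 ^+ n * _ * _ = 4 / d ^+ 2 * (d^-1 ^+ n * n.+1%:R)); last by ring.
apply: ler_wpM2l; first by rewrite divr_ge0 ?exprn_ge0 ?(ltW d0).
rewrite [2 / d]mulrC exprMn ler_wpM2l//.
by rewrite -natrX ler_nat; exact: ltn_expl.
Qed.

Lemma bounded_resolvent_lipschitz d z w : 0 < d -> far_from M d z -> far_from M d w ->
  modulus (Lr (r z) - Lr (r w)) <= K * (2 / d ^+ 3) * modulus (z - w).
Proof.
move=> d0 dz dw.
have [rho [rho' [pp H]]] := resolvent_extension M0 (far_csegment d0 dz).
have [th [th' [qq G]]] := resolvent_extension M0 (far_csegment d0 dw).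
rewrite -boundedB; last 2 first.
- exact: C1_segment_resolvent (far_csegment d0 dz).
- exact: C1_segment_resolvent (far_csegment d0 dw).
rewrite (@restr_ext _ (fun x => rho x + (-1) * th x)); last first.
  by move=> x xM; have [-> _] := H x xM; have [-> _] := G x xM; rewrite mulN1r.
rewrite -mulrA; apply: (bounded_le LP (C1_pairD pp (C1_pairZ (-1) qq))).
  by rewrite mulr_ge0 ?modulus_ge0 ?divr_ge0 ?exprn_ge0 ?(ltW d0).
move=> x xM; have [_ ->] := H x xM; have [_ ->] := G x xM; rewrite mulN1r.
exact: (resolvent_sqr_lipschitz d0 dz dw xM).
Qed.

(** Each of the n copies of s^n is at most one of the terms 1, s, ..., s^(n-1) of the geometric
    series. *)
Lemma natr_geometric_le (s : R) n : 0 <= s -> s < 1 -> n%:R * s ^+ n <= (1 - s)^-1.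
Proof.
move=> s0 s1; have s1' : 0 < 1 - s by rewrite subr_gt0.
rewrite -[_^-1]mul1r ler_pdivlMr//.
apply: le_trans (_ : (\sum_(k < n) s ^+ k) * (1 - s) <= _).
  rewrite ler_pM2r// mulr_natl -[X in _ *+ X]card_ord -sumr_const.
  by apply: ler_sum => k _; apply: ler_wiXn2l; rewrite ?(ltW s1)// ltnW.
have := subrXX 1 s n; rewrite expr1n.
under eq_bigr do rewrite expr1n mul1r.
by rewrite mulrC => <-; rewrite gerBl exprn_ge0.
Qed.

Lemma bounded_resolvent_series z : M < modulus z -> forall e : R, 0 < e ->
  exists n0, forall n, (n0 <= n)%N ->
    modulus (Lr (r z) - \sum_(m < n) Lr (fun x => x%:C ^+ m) / z ^+ m.+1) <= e.
Proof.
move=> zM e e0; have mz : 0 < modulus z by exact: lt_trans zM.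
have z0 : z != 0 by rewrite -modulus_gt0.
pose d := modulus z - M; have d0 : 0 < d by rewrite subr_gt0.
have dz : far_from M d z.
  move=> x; rewrite in_itv /= -ler_norml => xM.
  have := modulusD (z - x%:C) x%:C; rewrite subrK modulus_real /d; lra.
have zMn := far_csegment d0 dz.
pose q := M / modulus z; have q0 : 0 <= q by rewrite divr_ge0 ?(ltW M0) ?(ltW mz).
have q1 : q < 1 by rewrite ltr_pdivrMr// mul1r.
(* Differentiating the remainder produces n q^n = (n s^n) s^n, where the first factor is bounded and
   the second tends to 0. *)
pose s := Num.sqrt q; have s0 : 0 <= s by exact: sqrtr_ge0.
have sq : s ^+ 2 = q by rewrite sqr_sqrtr.
have s1 : s < 1 by rewrite -(@ltr_pXn2r _ 2)// ?nnegrE// sq expr1n.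
(* For F = (x / z)^n, the first summand bounds r_z F' / s^n, using |F'| <= n q^n / M; the second
   bounds F r_z^2 / s^n. *)
pose B := (1 - s)^-1 / M / d + d^-1 ^+ 2.
have d1 : 0 <= d^-1 by rewrite invr_ge0 ltW.
have B0 : 0 <= B.
  apply: addr_ge0; last exact: exprn_ge0.
  by do 2!apply: mulr_ge0 => //; rewrite invr_ge0 ?subr_ge0 ltW.
pose A := K * B; have A0 : 0 <= A by exact: mulr_ge0.
have [n0 Hn0] := geometric_small s0 s1 (divr_gt0 e0 (ltr_wpDl A0 ltr01)).
exists n0 => n nn0.
apply: le_trans (_ : A * s ^+ n <= _); last first.
  have := Hn0 n nn0; rewrite ltr_pdivlMr ?ltr_wpDl//; have := exprn_ge0 n s0; nra.
pose F x := (x%:C / z) ^+ n.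
have FF' : C1_pair F (fun x => n%:R * (z^-1 * x%:C) ^+ n.-1 * (z^-1 * 1)).
  have := C1_pairX n (C1_pairZ z^-1 (@C1_pair_id R)); congr C1_pair.
  by apply/funext => x; rewrite /F mulrC.
have Cx m : C1s (fun x => x%:C ^+ m).
  exact: (C1_pair_segment (C1_pairX m (@C1_pair_id R))).
have [S1 S2] := bounded_sum_ord (n := n) (fun k => (z ^+ k.+1)^-1)
  (F := fun k x => x%:C ^+ k) (fun k _ => Cx k).
have -> : Lr (r z) - \sum_(m < n) Lr (fun x => x%:C ^+ m) / z ^+ m.+1 = Lr (fun x => F x * r z x).
  under eq_bigr do rewrite mulrC.
  rewrite -S2 -boundedB//; last exact: C1_segment_resolvent.
  congr L; apply: restr_ext => x xM.
  have zx : z != x%:C.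
    by apply/negP => /eqP zx; apply: zMn; exists x.
  rewrite {1}/resolvent (resolvent_expand n z0 zx) addrAC -[RHS]add0r; congr (_ + _).
  by rewrite -sumrB big1// => k _; rewrite mulrC subrr.
rewrite /A -mulrA; apply: (bounded_resolvent_le FF' d0 dz).
  by rewrite mulr_ge0 ?exprn_ge0.
move=> x xM; have rx := modulus_resolvent d0 dz xM.
have xq : modulus (z^-1 * x%:C) <= q.
  rewrite Normc.normcM Normc.normcV modulus_real mulrC /q.
  rewrite ler_wpM2r ?invr_ge0 ?(ltW mz)//.
  by move: xM; rewrite in_itv /= -ler_norml.
have qn m : modulus ((z^-1 * x%:C) ^+ m) <= q ^+ m.
  by rewrite modulusX lerXn2r ?nnegrE ?modulus_ge0.
apply: le_trans (modulusD _ _) _; rewrite mulrDl [leLHS]addrC; apply: lerD.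
  rewrite mulr1 !Normc.normcM -(rmorph_nat (@real_complex R)) modulus_real ger0_norm//.
  rewrite Normc.normcV.
  apply: le_trans (_ : d^-1 * (n%:R * q ^+ n / M) <= _).
    apply: ler_pM; rewrite ?mulr_ge0 ?invr_ge0 ?modulus_ge0//.
          by rewrite -Normc.normcV.
    rewrite Normc.normcV; case: (n) => [|k]; first by rewrite !mulr0n !mul0r.
    rewrite -!mulrA; apply: ler_wpM2l => //=; rewrite exprSr -mulrA.
    have -> : q / M = (modulus z)^-1 by rewrite /q mulrAC divff ?mul1r ?gt_eqF.
    by apply: ler_wpM2r; rewrite ?invr_ge0 ?modulus_ge0.
  rewrite (_ : _ / M / d * _ = d^-1 * ((1 - s)^-1 * s ^+ n / M)); last by ring.
  apply: ler_wpM2l => //; apply: ler_wpM2r; first by rewrite invr_ge0 ltW.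
  rewrite -sq -exprM mul2n -addnn exprD mulrA; apply: ler_wpM2r; first exact: exprn_ge0.
  exact: natr_geometric_le.
rewrite Normc.normcM [leRHS]mulrC; apply: ler_pM; rewrite ?modulus_ge0//.
  rewrite /F mulrC; apply: le_trans (qn n) _.
  by rewrite -sq -exprM mul2n -addnn exprD ler_piMl ?exprn_ge0 ?exprn_ile1 ?(ltW s1).
by rewrite modulusX lerXn2r ?nnegrE ?modulus_ge0.
Qed.

End DerivativeBounded.

(** * Cauchy's integral commutes with a functional bounded by the derivative *)

Section CauchyBounded.
Context (R : realType) (M : R).
Hypothesis M0 : 0 < M.
Local Notation C := (R[i]^o).
Local Notation r := (@resolvent R).
Local Notation tpi := (two_pi_i R).
Implicit Types (z w : C) (x y t d e : R).

Lemma is_cderive_quotient (u : R -> R[i]) t (l : R[i]) : is_cderive u t l ->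
  forall e, 0 < e -> exists2 d, 0 < d & forall s, `|s - t| < d ->
    modulus (u s - u t - l * (s - t)%:C) <= e * `|s - t|.
Proof.
have key (f : R -> R) (a : R) : is_derive t (1 : R) f a ->
    forall e, 0 < e -> exists2 d, 0 < d & forall s, `|s - t| < d ->
    `|f s - f t - a * (s - t)| <= e * `|s - t|.
  move=> /is_derive1_caratheodory[g [fg gc ga]] e e0.
  have /cvgrPdist_lt/(_ _ e0)/nbhs_ballP[d d0 Hd] := gc; exists d => // s st.
  rewrite fg -ga -mulrBl normrM ler_wpM2r// distrC ltW//.
  by apply: Hd; rewrite -ball_normE /= distrC.
move=> [u1 u2] e e0; have e2 : 0 < e / 2 by rewrite divr_gt0.
have [d1 d10 H1] := key _ _ u1 _ e2; have [d2 d20 H2] := key _ _ u2 _ e2.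
exists (Num.min d1 d2); first by rewrite lt_min d10.
move=> s; rewrite lt_min => /andP[s1 s2].
apply: le_trans (modulus_le_ReIm _) _; rewrite !(ReB, ImB, ReM, ImM) /= !mulr0 subr0 add0r.
by have := H1 s s1; have := H2 s s2; lra.
Qed.

Context (gamma : R -> C) (V : R).
Local Notation Tr := (trace_curve gamma).
Local Notation I := (contour_integral gamma).
Hypothesis gammaC1 : piecewise_C1 gamma.
Hypothesis IP : contour_functional Tr V I.
Hypothesis Tr_segment : forall z, Tr z -> ~ csegment M z.
Let V0 := contour_ge0 IP.

(** As in [dist_contour], a bound on the trace for the inverse of the distance to the segment keeps
    the two uniformly apart. *)
Lemma trace_far_from : exists2 d, 0 < d & forall z, Tr z -> far_from M d z.
Proof.
have [m [mfar mpos mlip]] := dist_csegment M0.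
have mc : continuous_in Tr (fun z => ((m z)%:C)^-1).
  move=> z Tz; have m1 := mpos z (Tr_segment Tz).
  apply: continuous_at_inV; first by rewrite -modulus_gt0 modulus_real gtr0_norm.
  apply/continuous_at_inP => e e0; exists e => // w _ wz.
  rewrite -rmorphB modulus_real; apply: le_lt_trans wz.
  have := mlip z w; have := mlip w z; rewrite (modulusB_sym z w) ler_norml.
  by move=> h1 h2; apply/andP; split; lra.
have [B B0 HB] := contour_bounded IP mc.
exists (B + 1)^-1; first by rewrite invr_gt0 ltr_wpDl.
move=> z Tz x xM; apply: le_trans (mfar z x xM).
have m1 := mpos z (Tr_segment Tz).
have := HB z Tz; rewrite Normc.normcV modulus_real gtr0_norm// => h.
by rewrite -[leRHS]invrK lef_pV2 ?posrE ?invr_gt0 ?ltr_wpDl//; lra.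
Qed.

Lemma resolvent_continuous_in x n : x \in `[- M, M] -> continuous_in Tr (fun z => r z x ^+ n).
Proof.
move=> xM z Tz; rewrite /resolvent; under eq_fun do rewrite exprVn.
apply: continuous_at_in_resolvent; apply/negP => /eqP zx.
by apply: (Tr_segment Tz); exists x.
Qed.

Context (F : C -> C) (Fc : continuous_in Tr F) (f : R -> R[i]) (f1 : C1 f).
Hypothesis Ff : forall x, x \in `[- M, M] -> I (fun z => F z * r z x) = tpi * f x.

(** Differentiation under the integral, made explicit: with r_y = r_x + (y - x) r_x r_y the error of
    the difference quotient is (y - x) times the integral of F r_x^2 r_y, which is bounded by D. *)
Lemma cauchy_formula_derivative x : x \in `[- M, M] ->
  I (fun z => F z * r z x ^+ 2) = tpi * cderive f x.
Proof.
move=> xM; have [d d0 Hd] := trace_far_from.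
have [B B0 HB] := contour_bounded IP Fc.
pose D := V * (B * d^-1 ^+ 3).
have d1 : 0 <= d^-1 by rewrite invr_ge0 ltW.
have D0 : 0 <= D by rewrite !mulr_ge0 ?exprn_ge0.
have T0 := modulus_ge0 tpi.
apply/eqP; rewrite -subr_eq0; apply/eqP; apply: modulus_le0 => e e0.
pose e1 := e / (2 * (modulus tpi + 1)).
have e10 : 0 < e1 by rewrite divr_gt0// mulr_gt0// ltr_wpDl.
have [dl dl0 Hdl] := is_cderive_quotient (C1_is_cderive x f1) e10.
(* The step is below [dl] for the differentiability of f, below M so that x moved by t towards 0
   stays in [-M, M], and small enough that t D <= e / 2. *)
pose t := Num.min (Num.min dl M) (e / (2 * (D + 1))) / 2.
have mn0 : 0 < Num.min (Num.min dl M) (e / (2 * (D + 1))).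
  by rewrite !lt_min dl0 M0 divr_gt0// mulr_gt0// ltr_wpDl.
have t0 : 0 < t by rewrite divr_gt0.
have /andP[/andP[t1 t2] t3] : (t < dl) && (t < M) && (t < e / (2 * (D + 1))).
  by rewrite -!lt_min /t ltr_pdivrMr// ltr_pMr ?ltr1n.
clearbody t; pose y := if x <= 0 then x + t else x - t.
have yx : `|y - x| = t.
  rewrite /y; case: ifP => _; first by rewrite addrAC subrr add0r gtr0_norm.
  by rewrite addrAC subrr add0r normrN gtr0_norm.
have yM : y \in `[- M, M].
  move: xM; rewrite !in_itv /= /y => /andP[h1 h2]; case: (leP x 0) => x0; apply/andP;
    split; lra.
have rc z (n : nat) u : u \in `[- M, M] -> continuous_in Tr (fun z => r z u ^+ n).
  exact: resolvent_continuous_in.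
have Frc u : u \in `[- M, M] -> continuous_in Tr (fun z => F z * r z u).
  by move=> uM; exact: (continuous_inM Fc (resolvent_continuous_in (n := 1) uM)).
have ry z : Tr z -> r z y = r z x + (y - x)%:C * (r z x * r z y).
  move=> Tz; rewrite /resolvent rmorphB; field.
  by rewrite -!modulus_gt0 !(lt_le_trans d0) ?(Hd z Tz).
have Q : tpi * f y - tpi * f x - (y - x)%:C * I (fun z => F z * r z x ^+ 2) =
    (y - x)%:C ^+ 2 * I (fun z => F z * (r z x ^+ 2 * r z y)).
  have c2 : continuous_in Tr (fun z => F z * r z x ^+ 2).
    exact: (continuous_inM Fc (resolvent_continuous_in (n := 2) xM)).
  have c3 : continuous_in Tr (fun z => F z * (r z x ^+ 2 * r z y)).
    apply: (continuous_inM Fc).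
    exact: (continuous_inM (resolvent_continuous_in (n := 2) xM) (resolvent_continuous_in (n := 1) yM)).
  have cA : continuous_in Tr (fun z => F z * r z y - F z * r z x).
    by move=> z Tz; apply: continuous_at_inB; [exact: (Frc y yM z Tz)|exact: (Frc x xM z Tz)].
  have cB : continuous_in Tr (fun z => (y - x)%:C * (F z * r z x ^+ 2)).
    exact: (continuous_inM (@continuous_in_cst _ _ (y - x)%:C) c2).
  rewrite -(Ff yM) -(Ff xM) -(contourB IP (Frc y yM) (Frc x xM)).
  rewrite -(contourZ IP (y - x)%:C c2) -(contourB IP cA cB) -(contourZ IP ((y - x)%:C ^+ 2) c3).
  apply: (contour_ext IP) => z Tz.
  have E := ry z Tz; move: E; set a := r z x; set b := r z y; set k := (y - x)%:C => E.
  have -> : F z * b - F z * a - k * (F z * a ^+ 2) =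
     F z * ((b - (a + k * (a * b))) + k * a * (b - (a + k * (a * b)))) +
     k ^+ 2 * (F z * (a ^+ 2 * b)) by ring.
  by rewrite {1 3}E !subrr mulr0 addr0 mulr0 add0r.
have I3 : modulus (I (fun z => F z * (r z x ^+ 2 * r z y))) <= D.
  apply: (contour_bound IP).
  - apply: (continuous_inM Fc).
    exact: (continuous_inM (resolvent_continuous_in (n := 2) xM) (resolvent_continuous_in (n := 1) yM)).
  - by rewrite mulr_ge0 ?exprn_ge0.
  move=> z Tz; have ax := modulus_resolvent d0 (Hd z Tz) xM.
  have ay := modulus_resolvent d0 (Hd z Tz) yM.
  rewrite !Normc.normcM (_ : d^-1 ^+ 3 = d^-1 * d^-1 * d^-1); last by rewrite !exprS expr0 mulr1 mulrA.
  apply: ler_pM; rewrite ?mulr_ge0 ?modulus_ge0 ?HB//.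
  apply: ler_pM; rewrite ?mulr_ge0 ?modulus_ge0//.
  by apply: ler_pM; rewrite ?modulus_ge0.
clearbody D; have Hq := Hdl y; rewrite yx in Hq; have {}Hq := Hq t1.
rewrite modulusB_sym.
have -> : tpi * cderive f x - I (fun z => F z * r z x ^+ 2) =
    ((y - x)%:C ^+ 2 * I (fun z => F z * (r z x ^+ 2 * r z y)) -
     tpi * (f y - f x - cderive f x * (y - x)%:C)) / (y - x)%:C.
  rewrite -Q; field.
  by rewrite -modulus_gt0 -rmorphB modulus_real yx.
rewrite Normc.normcM Normc.normcV modulus_real yx ler_pdivrMr//.
apply: le_trans (modulusB _ _) _; rewrite !Normc.normcM !modulus_real !yx.
apply: le_trans (_ : t ^+ 2 * D + modulus tpi * (e1 * t) <= _).
  apply: lerD.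
    by rewrite expr2; apply: ler_wpM2l => //; rewrite mulr_ge0 ?(ltW t0).
  by apply: ler_wpM2l.
have h1 : t * D <= e / 2.
  move: t3; rewrite ltr_pdivlMr ?mulr_gt0 ?ltr_wpDl// => t3.
  have : 0 <= t by exact: ltW.
  nra.
have h2 : modulus tpi * e1 <= e / 2.
  rewrite /e1 mulrA ler_pdivrMr ?mulr_gt0 ?ltr_wpDl//.
  rewrite (_ : e / 2 * _ = modulus tpi * e + e); last by field.
  by rewrite lerDl ltW.
have -> : t ^+ 2 * D + modulus tpi * (e1 * t) = t * (t * D + modulus tpi * e1) by ring.
by rewrite [e * t]mulrC; apply: ler_wpM2l; [exact: ltW|lra].
Qed.

Lemma resolvent_combination (ws : seq (C * C)) : (forall p, p \in ws -> Tr p.2) ->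
  exists S S' : R -> R[i], C1_pair S S' /\ forall x, x \in `[- M, M] ->
    S x = \sum_(p <- ws) p.1 * r p.2 x /\ S' x = \sum_(p <- ws) p.1 * r p.2 x ^+ 2.
Proof.
elim: ws => [|p ws IH] Tws.
  exists (fun=> 0), (fun=> 0); split; first exact: C1_pair_cst.
  by move=> x _; rewrite !big_nil.
have [|S [S' [SS HS]]] := IH; first by move=> q qs; apply: Tws; rewrite in_cons qs orbT.
have [rho [rho' [pp H]]] := resolvent_extension M0 (Tr_segment (Tws p (mem_head _ _))).
exists (fun x => p.1 * rho x + S x), (fun x => p.1 * rho' x + S' x); split.
  exact: C1_pairD (C1_pairZ _ pp) SS.
by move=> x xM; have [-> ->] := H x xM; have [-> ->] := HS x xM; rewrite !big_cons.
Qed.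

(** With nodes z_i and weights W_i, the sum of W_i L(r_z_i) is close to the left side by quadrature.
    It is close to the right side because tpi f minus the sum of W_i r_z_i has a small derivative on
    [-M, M], by quadrature with the same nodes for r_z(x)^2. *)
Lemma bounded_cauchy (L : (segment M -> R[i]) -> R[i]) (K : R) : derivative_bounded L K ->
  I (fun z => F z * L (restr (r z))) = tpi * L (restr f).
Proof.
move=> LP; have [d d0 Hd] := trace_far_from; have K0 := bounded_ge0 LP.
pose D := 2 / d ^+ 3; have D0 : 0 <= D by rewrite divr_ge0 ?exprn_ge0 ?(ltW d0).
apply/eqP; rewrite -subr_eq0; apply/eqP; apply: modulus_le0 => e e0.
pose A := K * D; have A0 : 0 <= A by exact: mulr_ge0.
(* Each of the two approximations below costs at most e1 A. *)
pose e1 := e / (2 * (A + 1)); have e10 : 0 < e1 by rewrite divr_gt0 ?mulr_gt0 ?ltr_wpDl.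
have [ws Tws Hws] := contour_quadrature gammaC1 Fc e10.
have [S [S' [SS HS]]] := resolvent_combination Tws.
have Phic : continuous_in Tr (fun z => L (restr (r z))).
  move=> z Tz; apply: expandable_continuous_at_in.
  exact: (bounded_resolvent_expandable M0 LP (Tr_segment Tz)).
have q1 := Hws _ A Phic A0; rewrite -[arc_integral _ _ _ _]/(I _) in q1.
have {}q1 := q1 (fun z w Tz Tw => bounded_resolvent_lipschitz M0 LP d0 (Hd z Tz) (Hd w Tw)).
have pair := C1_pairD (C1_pairZ tpi (C1_C1_pair f1)) (C1_pairZ (-1) SS).
have q2 : modulus (L (restr (fun x => tpi * f x + -1 * S x))) <= K * (e1 * D).
  apply: (bounded_le LP pair); first by rewrite mulr_ge0// ltW.
  move=> x xM; have [_ ->] := HS x xM.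
  rewrite -cauchy_formula_derivative// mulN1r.
  have := Hws (fun z => r z x ^+ 2) D (resolvent_continuous_in (n := 2) xM) D0.
  by apply=> z w Tz Tw; exact: (resolvent_sqr_lipschitz d0 (Hd z Tz) (Hd w Tw) xM).
have [C1sum Lsum] := bounded_sum LP (s := ws) (fun p => p.1) (F := fun p => r p.2)
  (fun p pw => C1_segment_resolvent M0 (Tr_segment (Tws p pw))).
have C1f : C1_segment (restr (M := M) f) by exists f.
have C1S : C1_segment (restr (M := M) S) by exact: (C1_pair_segment SS (fun _ _ => erefl)).
have E : L (restr (fun x => tpi * f x + -1 * S x)) =
    tpi * L (restr f) - \sum_(p <- ws) p.1 * L (restr (r p.2)).
  rewrite -Lsum.
  rewrite (_ : restr (fun x => \sum_(p <- ws) p.1 * r p.2 x) = restr (M := M) S); last first.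
    by apply: restr_ext => x /HS[].
  rewrite -(boundedZ LP tpi C1f) -(boundedB LP)//; last first.
    exact: (C1_pair_segment (C1_pairZ tpi (C1_C1_pair f1))).
  by congr L; apply: restr_ext => x _; rewrite mulN1r.
rewrite {}E in q2.
rewrite (_ : _ - _ = (I (fun z => F z * L (restr (r z))) - \sum_(p <- ws) p.1 * L (restr (r p.2))) -
  (tpi * L (restr f) - \sum_(p <- ws) p.1 * L (restr (r p.2)))); last by ring.
apply: le_trans (modulusB _ _) _; apply: le_trans (lerD q1 q2) _.
rewrite (_ : e1 * A + K * (e1 * D) = e1 * A * 2); last by rewrite /A; ring.
rewrite /e1 (_ : _ * A * 2 = e * (A / (A + 1))); last first.
  by field; rewrite gt_eqF// ltr_wpDl.
by rewrite ler_piMr ?(ltW e0)// ler_pdivrMr ?ltr_wpDl// mul1r lerDl.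
Qed.

End CauchyBounded.

(** * Power series in one and two variables *)

Section PowerSeries.
Context (R : realType).
Local Notation C := (R[i]^o).
Implicit Types (f : C -> C) (a z w : C) (c : nat -> C).

(** Abel's lemma: convergence at distance r0 = e0 / 2 bounds the terms there, so on the disc of
    radius r0 / 2 the tails are dominated by a geometric series of ratio at most 1/2. *)
Lemma power_series_expandable f a c (e0 : R) : 0 < e0 ->
  (forall z, modulus (z - a) < e0 -> forall e : R, 0 < e -> exists n0, forall n, (n0 <= n)%N ->
    modulus (\sum_(k < n) c k * (z - a) ^+ k - f z) < e) -> expandable f a.
Proof.
move=> e00 H; pose r0 := e0 / 2; have r00 : 0 < r0 by rewrite divr_gt0.
have [B B0 HB] : exists2 B : R, 0 <= B & forall k, modulus (c k) * r0 ^+ k <= B.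
  have z1 : modulus (a + r0%:C - a) = r0.
    by rewrite addrAC subrr add0r modulus_real gtr0_norm.
  have z1e : modulus (a + r0%:C - a) < e0 by rewrite z1 /r0; lra.
  have [N HN] := H _ z1e 1 ltr01.
  (* From N on, consecutive partial sums are within 1 of the limit, so a term is at most 2; the sum
     covers the earlier terms. *)
  exists (2 + \sum_(k < N) modulus (c k) * r0 ^+ k).
    by rewrite addr_ge0// sumr_ge0// => k _; rewrite mulr_ge0 ?modulus_ge0 ?exprn_ge0 ?(ltW r00).
  move=> k; have [kN|Nk] := ltnP k N.
    apply: le_trans (_ : \sum_(k < N) modulus (c k) * r0 ^+ k <= _); last by rewrite lerDr.
    rewrite (bigD1 (Ordinal kN))//= lerDl sumr_ge0// => j _.
    by rewrite mulr_ge0 ?modulus_ge0 ?exprn_ge0 ?(ltW r00).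
  apply: le_trans (_ : 2 <= _); last first.
    by rewrite lerDl sumr_ge0// => j _; rewrite mulr_ge0 ?modulus_ge0 ?exprn_ge0 ?(ltW r00).
  have := HN k Nk; have := HN k.+1 (leqW Nk); rewrite big_ord_recr /=.
  set S := \sum_(_ < _) _; set y := c k * _ => h1 h2.
  rewrite -{1}z1 -modulusX -Normc.normcM -/y.
  rewrite (_ : y = (S + y - f (a + r0%:C)) - (S - f (a + r0%:C))); last by ring.
  by apply: le_trans (modulusB _ _) _; apply: le_trans (ltW (ltrD h1 h2)) _; rewrite -mulr2n.
pose r := r0 / 2; have rr0 : 0 < r by rewrite divr_gt0.
exists c, (2 * B), r; split=> //; first exact: mulr_ge0.
move=> z zr n; have ze : modulus (z - a) < e0 by move: zr; rewrite /r /r0; lra.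
pose x := modulus (z - a) / r0; have x0 : 0 <= x by rewrite divr_ge0 ?modulus_ge0 ?(ltW r00).
have x1 : x <= 2^-1 by rewrite ler_pdivrMr// mulrC ltW.
have xr : x <= modulus (z - a) / r.
  apply: ler_wpM2l; first exact: modulus_ge0.
  by rewrite lef_pV2 ?posrE// /r; lra.
apply: le_trans (_ : 2 * B * x ^+ n <= _); last first.
  apply: ler_wpM2l; first exact: mulr_ge0.
  have r1 : 0 <= modulus (z - a) / r by rewrite divr_ge0 ?modulus_ge0 ?(ltW rr0).
  exact: lerXn2r.
apply/ler_addgt0Pr => e e_gt0; have [N HN] := H z ze e e_gt0.
have := HN (n + N)%N (leq_addl _ _); rewrite big_split_ord /=.
set S := \sum_(i < n) _; set T := \sum_(i < N) _ => h.
rewrite (_ : f z - S = T - (S + T - f z)); last by ring.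
apply: le_trans (modulusB _ _) (lerD _ (ltW h)).
apply: le_trans (modulus_sum _ _ _) _.
apply: le_trans (_ : \sum_(i < N) B * x ^+ n * x ^+ i <= _).
  apply: ler_sum => i _; rewrite Normc.normcM modulusX -mulrA -exprD /x expr_div_n.
  rewrite mulrA ler_pdivlMr ?exprn_gt0// mulrAC.
  by apply: ler_wpM2r; rewrite ?exprn_ge0 ?modulus_ge0.
rewrite -mulr_sumr (_ : 2 * B * x ^+ n = B * x ^+ n * 2); last by ring.
apply: ler_wpM2l; first by rewrite mulr_ge0 ?exprn_ge0.
apply: le_trans (_ : (1 - x)^-1 <= _); last first.
  by rewrite -[leRHS]invrK lef_pV2 ?posrE ?invr_gt0//; lra.
have x1' : 0 < 1 - x by lra.
rewrite -[_^-1]mul1r ler_pdivlMr//.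
have := subrXX 1 x N; rewrite expr1n; under eq_bigr do rewrite expr1n mul1r.
by rewrite mulrC => <-; rewrite gerBl exprn_ge0.
Qed.

Lemma analytic_on_expandable (D : set C) f a : analytic_on D f -> D a -> expandable f a.
Proof.
move=> fD /fD[c /nearC[e0 e00 H]].
apply: (power_series_expandable (c := c) e00) => z /H/cvgC Hz e /Hz[n0 Hn0].
by exists n0 => n /Hn0; rewrite /series /= big_mkord.
Qed.

(** Every rectangle that contains the finite set supplied by the unconditional convergence is as
    good as that set. *)
Lemma partial_sum_rectangle (u : nat * nat -> C) (l : C) :
  partial_sum u @ totally --> l -> forall e : R, 0 < e -> exists N, forall m n,
  (N <= m)%N -> (N <= n)%N -> modulus (\sum_(i < m) \sum_(j < n) u (i : nat, j : nat) - l) < e.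
Proof.
move=> ul e e0; have : (partial_sum u @ totally) [set z | modulus (z - l) < e].
  by apply: ul; apply/nearC; exists e.
move=> [A _ HA].
pose N := (\max_(p <- enum_fset A) maxn p.1 p.2).+1.
have AN p : p \in A -> (p.1 < N)%N && (p.2 < N)%N.
  by move=> pA; rewrite -gtn_max ltnS; exact: (leq_bigmax_seq (F := fun p => maxn p.1 p.2) p pA).
exists N => m n Nm Nn.
pose s := [seq (i, j) | i <- iota 0 m, j <- iota 0 n].
pose B := seq_fset tt s.
have AB : (A `<=` B)%fset.
  apply/fsubsetP => -[i j] /AN/andP[/= iN jN]; rewrite seq_fsetE; apply/allpairsP.
  by exists (i, j); rewrite !mem_iota /= (leq_trans iN) ?(leq_trans jN).
have := HA B AB; rewrite /= /partial_sum; congr (modulus (_ - l) < e).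
rewrite -(big_seq_fsetE _ _ xpredT u) (perm_big s); last first.
  apply: uniq_perm; [exact: (fset_uniq B)| |by move=> p; rewrite seq_fsetE].
  by apply: allpairs_uniq; rewrite ?iota_uniq// => -[? ?] [? ?] _ _ [-> ->].
rewrite big_allpairs_dep /=.
rewrite -[in LHS](subn0 m) -/(index_iota 0 m) big_mkord; apply: eq_bigr => i _.
by rewrite -[in LHS](subn0 n) -/(index_iota 0 n) big_mkord.
Qed.

(** For fixed m only m rows occur, so a single n brings all of them close to their sums at once. *)
Lemma partial_sum_iterated (u : nat * nat -> C) (l : C) (row : nat -> C) :
  partial_sum u @ totally --> l ->
  (forall m (e : R), 0 < e -> exists n0, forall n, (n0 <= n)%N ->
    modulus (\sum_(j < n) u (m, j : nat) - row m) <= e) ->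
  forall e : R, 0 < e -> exists m0, forall m, (m0 <= m)%N ->
    modulus (\sum_(i < m) row i - l) <= e.
Proof.
move=> ul Hrow e e0; have e2 : 0 < e / 2 by rewrite divr_gt0.
have [N HN] := partial_sum_rectangle ul e2; exists N => m Nm.
have em : 0 < e / 2 / m.+1%:R by rewrite divr_gt0.
have [n1 Hn1] : exists n1, forall n, (n1 <= n)%N -> forall i, (i < m)%N ->
    modulus (\sum_(j < n) u (i, j : nat) - row i) <= e / 2 / m.+1%:R.
  elim: {Nm em} m (e / 2 / m.+1%:R) em => [|m IH] d d0; first by exists 0%N.
  have [n1 H1] := IH d d0; have [n2 H2] := Hrow m d d0; exists (maxn n1 n2) => n.
  rewrite geq_max => /andP[h1 h2] i; rewrite ltnS leq_eqVlt => /orP[/eqP ->|im].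
    exact: H2.
  exact: H1.
pose n := maxn N n1; have h := HN m n Nm (leq_maxl _ _).
set S := \sum_(i < m) \sum_(j < n) _ in h.
rewrite (_ : _ - l = (S - l) - (S - \sum_(i < m) row i)); last by ring.
apply: le_trans (modulusB _ _) _; rewrite [e]splitr; apply: lerD; first exact: ltW.
rewrite -sumrB; apply: le_trans (modulus_sum _ _ _) _.
apply: le_trans (_ : \sum_(i < m) e / 2 / m.+1%:R <= _).
  by apply: ler_sum => i _; apply: Hn1 => //; exact: leq_maxr.
rewrite sumr_const card_ord -[_ *+ m]mulr_natr [_ * m%:R]mulrAC ler_pdivrMr//.
by apply: ler_wpM2l; [exact: ltW|rewrite ler_nat].
Qed.

Lemma analytic2_on_near (D : set (C * C)) (f : C -> C -> C) p : analytic2_on D f -> D p ->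
  exists (c : nat * nat -> C) (e0 : R), 0 < e0 /\ forall z w,
    modulus (z - p.1) < e0 -> modulus (w - p.2) < e0 -> forall e : R, 0 < e ->
    exists N, forall m n, (N <= m)%N -> (N <= n)%N ->
      modulus (\sum_(i < m) \sum_(j < n) c (i : nat, j : nat) * (z - p.1) ^+ i * (w - p.2) ^+ j - f z w) < e.
Proof.
move=> fD /fD[c [[A B] /= [/nearC[e1 e10 HA] /nearC[e2 e20 HB]] H]].
exists c, (Num.min e1 e2); split; first by rewrite lt_min e10.
move=> z w; rewrite !lt_min => /andP[z1 _] /andP[_ w2] e e0.
exact: (partial_sum_rectangle (H (z, w) (conj (HA _ z1) (HB _ w2))) e0).
Qed.

Lemma analytic2_on_expandable_l (D1 D2 : set C) (f : C -> C -> C) a w :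
  analytic2_on (D1 `*` D2) f -> D1 a -> D2 w -> expandable (f^~ w) a.
Proof.
move=> fD Da Dw; have [c [e0 [e00 H]]] := analytic2_on_near fD (conj Da Dw : (D1 `*` D2) (a, w)).
apply: (power_series_expandable (c := fun k => c (k, 0%N)) e00) => z za e e_gt0.
have ww : modulus (w - (a, w).2) < e0 by rewrite subrr Normc.normc0.
have [N HN] := H z w za ww e e_gt0; exists N => n Nn.
(* At second coordinate w only the column of index 0 survives; [N.+1] ensures that it is present. *)
have := HN n N.+1 Nn (leqnSn N); congr (modulus (_ - _) < _); apply: eq_bigr => i _.
rewrite big_ord_recl /= expr0 mulr1 big1 ?addr0// => j _.
by rewrite subrr expr0n mulr0.
Qed.

Lemma analytic2_on_expandable_r (D1 D2 : set C) (f : C -> C -> C) z a :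
  analytic2_on (D1 `*` D2) f -> D1 z -> D2 a -> expandable (f z) a.
Proof.
move=> fD Dz Da; have [c [e0 [e00 H]]] := analytic2_on_near fD (conj Dz Da : (D1 `*` D2) (z, a)).
apply: (power_series_expandable (c := fun k => c (0%N, k)) e00) => w wa e e_gt0.
have zz : modulus (z - (z, a).1) < e0 by rewrite subrr Normc.normc0.
have [N HN] := H z w zz wa e e_gt0; exists N => n Nn.
have := HN N.+1 n (leqnSn N) Nn; congr (modulus (_ - _) < _).
rewrite big_ord_recl /= [X in _ + X]big1 ?addr0 => [|i _].
  by apply: eq_bigr => j _; rewrite expr0 mulr1.
by rewrite big1// => j _; rewrite subrr expr0n mulr0 mul0r.
Qed.

End PowerSeries.

(** * The asymptotic covariance of resolvents *)

Section AsymptoticCovariance.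
Context (R : realType) (M K : R).
Hypotheses (M0 : 0 < M) (K0 : 0 < K).
Local Notation C := (R[i]^o).
Context (alpha : nat -> nat -> C) (rho : (segment M -> R[i]) -> (segment M -> R[i]) -> R[i]).
Hypothesis rhoP : asymptotic_covariance K alpha rho.
Implicit Types (f : R -> R[i]) (z w : C).

Local Notation rr z := (restr (M := M) (resolvent z)).
Local Notation mono n := (restr (M := M) (fun x => x%:C ^+ n)).

Lemma sup_norm_on_ge0 f : 0 <= sup_norm_on M f.
Proof.
rewrite /sup_norm_on; set A := [set _ | _ in _].
(* Without a supremum, [sup] takes the default value 0. *)
have [hs|/sup_out -> //] := pselect (has_sup A).
have [[y Ay] ubA] := hs; apply: le_trans (ub_le_sup ubA Ay).
by case: Ay => x _ <-; exact: modulus_ge0.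
Qed.

Lemma sup_norm_on_le f (B : R) :
  (forall x, x \in `[- M, M] -> modulus (f x) <= B) -> sup_norm_on M f <= B.
Proof.
move=> H; apply: ge_sup; last by move=> _ [x xM <-]; exact: H.
exists (modulus (f 0)), 0 => //.
by rewrite /= in_itv /= oppr_le0 !ltW.
Qed.

Lemma C1_pair_derivative f f' x : C1_pair f f' -> cderive f x = f' x.
Proof. by move=> [df _]; exact: is_cderiveE. Qed.

Lemma covariance_bounded_l f : C1 f ->
  derivative_bounded (fun u => rho u (restr f)) (K * sup_norm_on M (cderive f)).
Proof.
move=> f1; split; first by rewrite mulr_ge0 ?sup_norm_on_ge0 ?(ltW K0).
- by move=> a h1 h2 c1 c2; apply: (rho_linear_l rhoP) => //; exists f.
- move=> u u' B uu' B0 HB; apply: le_trans (rho_bound rhoP (C1_pair_C1 uu') f1) _.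
  rewrite [leLHS]mulrAC; apply: ler_wpM2l; first by rewrite mulr_ge0 ?sup_norm_on_ge0 ?(ltW K0).
  by apply: sup_norm_on_le => x xM; rewrite (C1_pair_derivative x uu') HB.
Qed.

Lemma covariance_bounded_r f : C1 f ->
  derivative_bounded (rho (restr f)) (K * sup_norm_on M (cderive f)).
Proof.
move=> f1; split; first by rewrite mulr_ge0 ?sup_norm_on_ge0 ?(ltW K0).
- by move=> a h1 h2 c1 c2; apply: (rho_linear_r rhoP) => //; exists f.
- move=> u u' B uu' B0 HB; apply: le_trans (rho_bound rhoP f1 (C1_pair_C1 uu')) _.
  apply: ler_wpM2l; first by rewrite mulr_ge0 ?sup_norm_on_ge0 ?(ltW K0).
  by apply: sup_norm_on_le => x xM; rewrite (C1_pair_derivative x uu') HB.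
Qed.

Lemma resolvent_C1 z : ~ csegment M z -> exists2 h, C1 h & restr (M := M) h = rr z.
Proof. by move=> /(C1_segment_resolvent M0). Qed.

Lemma monomial_C1 n : C1 (fun x : R => x%:C ^+ n).
Proof. exact: C1_pair_C1 (C1_pairX n (@C1_pair_id R)). Qed.

Lemma monomial_C1_segment n : C1_segment (mono n).
Proof. exact: (C1_pair_segment (C1_pairX n (@C1_pair_id R)) (fun _ _ => erefl)). Qed.

Lemma covariance_resolvent_l z : ~ csegment M z ->
  exists K', derivative_bounded (fun u => rho u (rr z)) K'.
Proof. by move=> /resolvent_C1[h h1 <-]; eexists; exact: covariance_bounded_l. Qed.

Lemma covariance_resolvent_r z : ~ csegment M z ->
  exists K', derivative_bounded (rho (rr z)) K'.
Proof. by move=> /resolvent_C1[h h1 <-]; eexists; exact: covariance_bounded_r. Qed.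

Lemma far_not_csegment z : M < modulus z -> ~ csegment M z.
Proof.
move=> zM [x + xz]; rewrite /= in_itv /= -ler_norml leNgt => /negP; apply.
by rewrite -modulus_real xz.
Qed.

Context (G2 : C -> C -> C).
Hypothesis G2P : second_order_cauchy M alpha G2.

(** Both resolvents are expanded at infinity, in w for each monomial in the first argument and then
    in z, giving the iterated form of the unconditional series. The terms of index 0 are constants,
    which rho annihilates; so indices start at 1. *)
Lemma second_order_cauchy_far z w : M < modulus z -> M < modulus w ->
  G2 z w = rho (rr z) (rr w).
Proof.
move=> zM wM; have [G2s _] := G2P.
have [zn wn] := (far_not_csegment zM, far_not_csegment wM).
have z0 : z != 0 by rewrite -modulus_gt0 (lt_trans M0).
have w0 : w != 0 by rewrite -modulus_gt0 (lt_trans M0).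
have mono0 : mono 0 = (fun=> 1) by apply/funext => x; rewrite /restr expr0.
have [h h1 hz] := resolvent_C1 wn.
have C1w : C1_segment (rr w) by exact: C1_segment_resolvent.
have [Kw Lw] := covariance_resolvent_l wn.
pose row i := rho (mono i.+1) (rr w) / z ^+ i.+2.
have Hrow i (e : R) : 0 < e -> exists n0, forall n, (n0 <= n)%N ->
    modulus (\sum_(j < n) alpha i.+1 j.+1 / (z ^+ i.+2 * w ^+ j.+2) - row i) <= e.
  move=> e0; have Li := covariance_bounded_r (monomial_C1 i.+1).
  have zi : 0 < modulus (z ^+ i.+2) by rewrite modulus_gt0 expf_neq0.
  have [n0 Hn0] := bounded_resolvent_series M0 Li wM (mulr_gt0 e0 zi).
  exists n0 => n n0n; have := Hn0 n.+1 (leqW n0n).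
  rewrite big_ord_recl mono0 (rho_1r rhoP) ?mul0r ?add0r; last first.
    exact: monomial_C1_segment.
  rewrite modulusB_sym -ler_pdivrMr// -Normc.normcV -Normc.normcM mulrBl.
  congr (modulus (_ - _) <= _); rewrite mulr_suml; apply: eq_bigr => j _.
  by rewrite lift0 (rho_monomial rhoP)// -mulrA [in RHS]invfM [_ / z ^+ _]mulrC.
have HG := partial_sum_iterated (G2s z w zM wM) Hrow.
apply/eqP; rewrite -subr_eq0; apply/eqP; apply: modulus_le0 => e e0.
have e2 : 0 < e / 2 by rewrite divr_gt0.
have [m1 H1] := HG _ e2; have [m2 H2] := bounded_resolvent_series M0 Lw zM e2.
have := H1 _ (leq_maxl m1 m2); have := H2 (maxn m1 m2).+1 (leqW (leq_maxr m1 m2)).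
rewrite big_ord_recl mono0 (rho_1l rhoP)// mul0r add0r.
pose S := \sum_(i < maxn m1 m2) row i; rewrite -/S => h2 h3.
have {}h2 : modulus (rho (rr z) (rr w) - S) <= e / 2 := h2.
rewrite (_ : _ - _ = - (rho (rr z) (rr w) - S) - (S - G2 z w)); last by ring.
apply: le_trans (modulusB _ _) _; rewrite modulusN [e]splitr.
exact: lerD.
Qed.

(** Two continuations in one variable: in the first with the second one far away ([half]), then in
    the second with the first one fixed anywhere off the segment. *)
Lemma second_order_cauchy_resolvent z w : ~ csegment M z -> ~ csegment M w ->
  G2 z w = rho (rr z) (rr w).
Proof.
have [_ G2a] := G2P.
have half u v : ~ csegment M u -> M < modulus v -> G2 u v = rho (rr u) (rr v).
  move=> uM vM; have vn := far_not_csegment vM.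
  have [Kv Lv] := covariance_resolvent_l vn.
  apply/eqP; rewrite -subr_eq0; apply/eqP; move: u uM.
  apply: (expandable_identity M0 (f := fun u => G2 u v - rho (rr u) (rr v))).
    move=> a aM; apply: expandableB; last exact: (bounded_resolvent_expandable M0 Lv aM).
    exact: (analytic2_on_expandable_l G2a).
  by move=> u uM; rewrite second_order_cauchy_far ?subrr.
move=> zM; have [Kz Lz] := covariance_resolvent_r zM.
move=> wM; apply/eqP; rewrite -subr_eq0; apply/eqP; move: w wM.
apply: (expandable_identity M0 (f := fun w => G2 z w - rho (rr z) (rr w))).
  move=> a aM; apply: expandableB; last exact: (bounded_resolvent_expandable M0 Lz aM).
  exact: (analytic2_on_expandable_r G2a).
by move=> w wM; rewrite half ?subrr.
Qed.

End AsymptoticCovariance.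

(** * The given contour and the final formula *)

Section ContourFormula.
Context (R : realType) (M : R) (gamma : R -> R[i]^o) (V : R) (Omega : set R[i]^o).
Local Notation C := (R[i]^o).
Local Notation Tr := (trace_curve gamma).
Local Notation I := (contour_integral gamma).
Hypothesis IP : contour_functional Tr V I.
Hypothesis gamma_positive : positively_oriented gamma.
Hypothesis Omega_open : open Omega.
Hypothesis Tr_Omega : Tr `<=` Omega.
Hypothesis enclosed_Omega : enclosed gamma `<=` Omega.
Hypothesis segment_enclosed : csegment M `<=` enclosed gamma.

Lemma analytic_continuous_in (F : C -> C) : analytic_on Omega F -> continuous_in Tr F.
Proof.
move=> FO z Tz; apply: expandable_continuous_at_in.
exact: analytic_on_expandable FO (Tr_Omega Tz).
Qed.

(** The winding number is 1 on the segment by orientation, and 0 off Omega because all enclosed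
    points lie in Omega. *)
Lemma contour_cauchy (F : C -> C) (f : R -> R[i]) : analytic_on Omega F ->
  (forall x : R, x \in `[- M, M] -> F x%:C = f x) ->
  forall x : R, x \in `[- M, M] -> I (fun z => F z * resolvent z x) = two_pi_i R * f x.
Proof.
move=> FO Ff x xM.
have Ex : enclosed gamma x%:C by apply: segment_enclosed; exists x.
have [Tx _] := Ex.
have op a : Omega a -> exists2 d : R, 0 < d & forall z, modulus (z - a) < d -> Omega z.
  by move=> Oa; apply/nearC; exact: open_nbhs_nbhs.
have W0 a : ~ Omega a -> winding I a = 0.
  move=> Oa; apply: (winding_outside IP); first by move=> /Tr_Omega.
  by move=> /enclosed_Omega.
rewrite (cauchy_formula IP op (fun a => analytic_on_expandable FO (a := a)) Tr_Omega W0)//.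
  by rewrite winding_numberE gamma_positive// mulr1 Ff// mulrC.
exact: enclosed_Omega.
Qed.

End ContourFormula.

Theorem theorem11 (R : realType) (d : nat -> measure_display)
    (T : forall N, measurableType (d N)) (P : forall N, probability (T N) R)
    (X : forall N, T N -> 'M[R[i]]_N) (M K : R)
    (alpha1 : nat -> R[i]^o) (alpha2 : nat -> nat -> R[i]^o)
    (rho : (segment M -> R[i]) -> (segment M -> R[i]) -> R[i])
    (G2 : R[i]^o -> R[i]^o -> R[i]^o)
    (f g : R -> R[i]) (Omega : set R[i]^o) (F G : R[i]^o -> R[i]^o)
    (gamma : R -> R[i]^o) :
  self_adjoint_ensemble P X -> 0 < M -> 0 < K ->
  (forall n, (fun N => N%:R^-1 *
      cexpectation (P N) (fun w => \tr (X N w ^+ n)) : R[i]^o)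
    @ \oo --> alpha1 n) ->
  (forall m n, (fun N => ccovariance (P N)
      (fun w => \tr (X N w ^+ m)) (fun w => \tr (X N w ^+ n)) : R[i]^o)
    @ \oo --> alpha2 m n) ->
  (fun N => N%:R ^+ 8 * fine (P N [set w | M < operator_norm (X N w)]))
    @ \oo --> (0 : R) ->
  (forall h, C1 h -> forall N,
    (cvariance (P N) (fun w => trace_fun h (X N w))
      <= K%:E * sup_norm (cderive h) ^+ 2)%E) ->
  asymptotic_covariance K alpha2 rho ->
  second_order_cauchy M alpha2 G2 ->
  classS f -> classS g ->
  open Omega -> connected Omega -> csegment M `<=` Omega ->
  analytic_on Omega F -> analytic_on Omega G ->
  (forall x : R, x \in `[- M, M] -> F x%:C = f x) ->
  (forall x : R, x \in `[- M, M] -> G x%:C = g x) ->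
  simple_closed_contour gamma -> positively_oriented gamma ->
  trace_curve gamma `<=` Omega -> enclosed gamma `<=` Omega ->
  csegment M `<=` enclosed gamma ->
  rho (restr f) (restr g) =
    (two_pi_i R ^+ 2)^-1 *
      contour_integral gamma (fun w =>
        contour_integral gamma (fun z => F z * G w * G2 z w)).
Proof.
move=> _ M0 K0 _ _ _ _ rhoP G2P [f1 _] [g1 _] Oopen _ _ FO GO Ff Gg [gC1 gclosed _].
move=> gpos TrO enO segen.
have [V IP] := contour_integral_functional gC1 gclosed.
have Tseg z : trace_curve gamma z -> ~ csegment M z by move=> Tz /segen[].
have Fc := analytic_continuous_in TrO FO; have Gc := analytic_continuous_in TrO GO.
have cauchy := contour_cauchy IP gpos Oopen TrO enO segen.
(* For fixed w on the contour, [bounded_cauchy] is applied to the functional u |-> rho(u, r_w). *)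
have inner w : trace_curve gamma w ->
    contour_integral gamma (fun z => F z * G w * G2 z w) =
    two_pi_i R * (G w * rho (restr f) (restr (resolvent w))).
  move=> Tw; have wM := Tseg w Tw.
  have [Kw Lw] := covariance_resolvent_l M0 K0 rhoP wM.
  have Lc : continuous_in (trace_curve gamma)
      (fun z => F z * rho (restr (resolvent z)) (restr (resolvent w))).
    apply: (continuous_inM Fc) => z Tz; apply: expandable_continuous_at_in.
    exact: (bounded_resolvent_expandable M0 Lw (Tseg z Tz)).
  rewrite mulrCA -(bounded_cauchy M0 gC1 IP Tseg Fc f1 (cauchy _ _ FO Ff) Lw).
  rewrite -(contourZ IP (G w) Lc); apply: (contour_ext IP) => z Tz.
  rewrite (second_order_cauchy_resolvent M0 K0 rhoP G2P (Tseg z Tz) wM); ring.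
(* The outer integral is treated in the same way, with the functional rho(f, .). *)
have Lf := covariance_bounded_r M0 K0 rhoP f1.
have Lc : continuous_in (trace_curve gamma)
    (fun w => G w * rho (restr f) (restr (resolvent w))).
  apply: (continuous_inM Gc) => w Tw; apply: expandable_continuous_at_in.
  exact: (bounded_resolvent_expandable M0 Lf (Tseg w Tw)).
rewrite (contour_ext IP inner) (contourZ IP (two_pi_i R) Lc).
rewrite (bounded_cauchy M0 gC1 IP Tseg Gc g1 (cauchy _ _ GO Gg) Lf).
rewrite mulrA -expr2 mulKf// expf_neq0//.
by rewrite /two_pi_i eq_complex /= eqxx /= mulf_eq0 pnatr_eq0 /= gt_eqF ?pi_gt0.
Qed.
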